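(* For each $n\ge2$, define $$E_n:=\Phi_{\mathrm{OL}}^{(n+1)}\circ F_n\circ(\Phi_{\mathrm{OL}}^{(n)})^{-1}:(\mathrm{Cor}^+(n),g^{\mathrm{OL}})\longrightarrow(\mathrm{Cor}^+(n+1),g^{\mathrm{OL}}),$$ where $\Phi_{\mathrm{OL}}^{(n)}:\mathcal S^+(n-1)\to\mathrm{Cor}^+(n)$, $\Phi_{\mathrm{OL}}^{(n)}(X)=\exp\bigl(\mathcal D(\psi_{\mathrm{OL}}^{(n)}(\log X))+\psi_{\mathrm{OL}}^{(n)}(\log X)\bigr)$, and $F_n:\mathcal S^+(n-1)\to\mathcal S^+(n)$, $F_n(X)=\exp(\psi_{\mathrm{OL}}^{(n)}(\log X))$. Then $E_n$ is a totally geodesic isometric embedding. In off-log coordinates, if $C\in\mathrm{Cor}^+(n)$ and $S=\mathrm{Log}(C)\in\mathrm{Hol}(n)$, then $$\mathrm{Log}(E_n(C))=\iota_n(S),\qquad\iota_n:=\psi_{\mathrm{OL}}^{(n+1)}\big|_{\mathrm{Hol}(n)}:\mathrm{Hol}(n)\hookrightarrow\mathrm{Hol}(n+1),$$ and thus $$E_n(C)=\mathrm{Exp}\bigl(\iota_n(\mathrm{Log}(C))\bigr)=\exp\bigl(\iota_n(\mathrm{Log}(C))+\mathcal D(\iota_n(\mathrm{Log}(C)))\bigr).$$ Consequently, for every $2\le m<n$ the composition $E_n\circ\cdots\circ E_m$ is a totally geodesic isometric embedding $(\mathrm{Cor}^+(m),g^{\mathrm{OL}})\hookrightarrow(\ma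thrm{Cor}^+(n+1),g^{\mathrm{OL}})$.
   Context: $\mathcal S(k)$ = real symmetric $k\times k$ matrices, $\mathcal S^+(k)$ = symmetric positive-definite ones, $\mathrm{Cor}^+(n)$ = matrices in $\mathcal S^+(n)$ with unit diagonal, $\mathrm{Hol}(n)\subset\mathcal S(n)$ = symmetric matrices with zero diagonal, $\mathrm{Diag}(n)$ = diagonal matrices; $\mathrm{off}(A)$ is $A$ with its diagonal set to zero; $\exp,\log$ are the matrix exponential and logarithm; $\langle A,B\rangle=\mathrm{tr}(AB)$ is the Frobenius inner product. Known facts: for each $S\in\mathcal S(n)$ there is a unique $\mathcal D(S)\in\mathrm{Diag}(n)$ with $\exp(S+\mathcal D(S))\in\mathrm{Cor}^+(n)$, and $\mathcal D$ is smooth; $\mathrm{Log}:=\mathrm{off}\circ\log:\mathrm{Cor}^+(n)\to\mathrm{Hol}(n)$ is a diffeomorphism with inverse $\mathrm{Exp}(S)=\exp(S+\mathcal D(S))$. $g^{\mathrm{OL}}=\mathrm{Log}^*\langle\cdot,\cdot\rangle$ on $\mathrm{Cor}^+(n)$. For $n\ge 2$, $\psi_{\mathrm{OL}}^{(n)}:\mathcal S(n-1)\to\mathrm{Hol}(n)$ is the linear isometry $$\psi_{\mathrm{OL}}^{(n)}(S)=\begin{bmatrix}0&\tfrac1{\sqrt2}\mathrm{diag}(S)^\top\\\tfrac1{\sqrt2}\mathrm{diag}(S)&\mathrm{off}(S)\end{bmatrix},$$ with $\mathrm{diag}(S)\in\mathbb R^{n-1}$ the column vector of diagonal entries of $S$.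 The maps $\Phi_{\mathrm{OL}}^{(n)}$ are diffeomorphisms. *)

(* Defs.v *)
From mathcomp Require Import all_boot all_order all_algebra.
From mathcomp Require Import all_classical all_reals all_analysis.

Set Implicit Arguments.
Unset Strict Implicit.
Unset Printing Implicit Defensive.

Import Order.TTheory GRing.Theory Num.Theory.
Import numFieldNormedType.Exports.
Local Open Scope classical_set_scope.
Local Open Scope ring_scope.

Section RiemannianSlices.
Context {R : realType}.

(* All manifolds here are relatively open subsets M of an affine subspace of a
   normed space E.  With T the direction of that subspace, T is the tangent
   space of M at every point, and for C in M and V in T the directional
   derivative 'D_V f C only depends on the values of f on M near C. *)

(* f is C^k on M: f and its iterated directional derivatives of order <= k
   along T exist and are continuous on M. *)
Fixpoint Ck_on {E W : normedModType R} (M T : set E) (k : nat) (f : E -> W)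
    : Prop :=
  {within M, continuous f} /\
  if k is k'.+1 then
    forall V, T V ->
      (forall C, M C -> derivable f C V) /\ Ck_on M T k' ('D_V f)
  else True.

Definition smooth_on {E W : normedModType R} (M T : set E) (f : E -> W) :=
  forall k, Ck_on M T k f.

(* metric C is only meaningful on tangent vectors at points C of the carrier *)
Record riemSlice (E : normedModType R) := RiemSlice {
  carrier : set E;
  tangent : set E;
  metric : E -> E -> E -> R }.

(* Levi-Civita connection in the affine chart: christoffel C U V is the
   tangent vector given by the Koszul formula for the constant (hence
   commuting) vector fields U, V. *)
Definition christoffel {E : normedModType R} (X : riemSlice E) (C U V : E) : E :=
  xget 0 [set Z | tangent X Z /\
    forall W, tangent X W ->
      metric X C Z W =
        2^-1 * ('D_U (fun c => metric X c V W : R^o) C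
              + 'D_V (fun c => metric X c U W : R^o) C
              - 'D_W (fun c => metric X c U V : R^o) C)].

(* the smooth curve gamma : I -> X satisfies nabla_(gamma') gamma' = 0 *)
Definition geodesic {E : normedModType R} (X : riemSlice E)
    (I : set R) (gamma : R -> E) : Prop :=
  [/\ open I, is_interval I,
      smooth_on (E := R^o) I setT gamma,
      forall t, I t -> carrier X (gamma t)
    & forall t, I t ->
        derive1 (derive1 gamma) t
          + christoffel X (gamma t) (derive1 gamma t) (derive1 gamma t) = 0].

Definition smooth_embedding {E E' : normedModType R}
    (X : riemSlice E) (Y : riemSlice E') (f : E -> E') : Prop :=
  [/\ set_fun (carrier X) (carrier Y) f,
      smooth_on (carrier X) (tangent X) f,
      forall C V, carrier X C -> tangent X V -> 'D_V f C = 0 -> V = 0,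
      set_inj (carrier X) f
    & {within f @` carrier X, continuous ('pinv_(fun=> 0) (carrier X) f)}].

Definition isometric {E E' : normedModType R}
    (X : riemSlice E) (Y : riemSlice E') (f : E -> E') : Prop :=
  forall C V W, carrier X C -> tangent X V -> tangent X W ->
    metric Y (f C) ('D_V f C) ('D_W f C) = metric X C V W.

Definition totally_geodesic {E E' : normedModType R}
    (X : riemSlice E) (Y : riemSlice E') (f : E -> E') : Prop :=
  forall I gamma, geodesic X I gamma -> geodesic Y I (f \o gamma).

Definition totally_geodesic_isometric_embedding {E E' : normedModType R}
    (X : riemSlice E) (Y : riemSlice E') (f : E -> E') : Prop :=
  [/\ smooth_embedding X Y f, isometric X Y f & totally_geodesic X Y f].

End RiemannianSlices.

Section OffLog.
Context {R : realType}.

Definition Sym n : set 'M[R]_n := [set A | A^T = A].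

Definition SymPD n : set 'M[R]_n :=
  [set A | Sym A /\ forall x : 'cV[R]_n, x != 0 -> 0 < (x^T *m A *m x) 0 0].

Definition Hol n : set 'M[R]_n := [set A | Sym A /\ forall i, A i i = 0].

Definition Corp n : set 'M[R]_n := [set A | SymPD A /\ forall i, A i i = 1].

Definition off n (A : 'M[R]_n) : 'M[R]_n :=
  \matrix_(i, j) (if i == j then 0 else A i j).

Definition frobenius n (A B : 'M[R]_n) : R := \tr (A *m B).

Definition expm n (A : 'M[R]_n) : 'M[R]_n :=
  limn (series (fun k : nat => (k`!%:R)^-1 *: A ^+ k)).

(* inverse of the bijection expm : Sym n -> SymPD n *)
Definition logm n : 'M[R]_n -> 'M[R]_n := 'pinv_(fun=> 0) (@Sym n) (@expm n).

(* the unique diagonal matrix D such that expm (S + D) is in Corp n *)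
Definition Dcor n (S : 'M[R]_n) : 'M[R]_n :=
  xget 0 [set D : 'M[R]_n | is_diag_mx D /\ Corp (expm (S + D))].

Definition LogOL n (C : 'M[R]_n) : 'M[R]_n := off (logm C).

Definition ExpOL n (S : 'M[R]_n) : 'M[R]_n := expm (S + Dcor S).

Definition gOL n (C V W : 'M[R]_n) : R :=
  frobenius ('D_V (@LogOL n) C) ('D_W (@LogOL n) C).

(* Corp n is relatively open in the affine space 1 + Hol n. *)
Definition corOL n : riemSlice 'M[R]_n := RiemSlice (@Corp n) (@Hol n) (@gOL n).

(* The sizes below are shifted by one: psiOL k, PhiOL k, FOL k, EOL k, iotaOL k
   are psi^(n), Phi^(n), F_n, E_n, iota_n for n = k + 1. *)

Definition psiOL k (S : 'M[R]_k) : 'M[R]_k.+1 :=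
  let d : 'cV[R]_k := (Num.sqrt 2)^-1 *: \col_i S i i in
  block_mx (0 : 'M[R]_1) d^T d (off S).

Definition PhiOL k (X : 'M[R]_k) : 'M[R]_k.+1 :=
  expm (Dcor (psiOL (logm X)) + psiOL (logm X)).

Definition FOL k (X : 'M[R]_k) : 'M[R]_k.+1 := expm (psiOL (logm X)).

Definition PhiOLV k : 'M[R]_k.+1 -> 'M[R]_k :=
  'pinv_(fun=> 0) (@SymPD k) (@PhiOL k).

Definition EOL k : 'M[R]_k.+1 -> 'M[R]_k.+2 :=
  @PhiOL k.+1 \o @FOL k \o @PhiOLV k.

Definition iotaOL k : 'M[R]_k.+1 -> 'M[R]_k.+2 := @psiOL k.+1.

(* EOLcomp m d = EOL (m + d - 1) \o ... \o EOL m, with d factors *)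
Fixpoint EOLcomp m d : 'M[R]_m.+1 -> 'M[R]_((d + m).+1) :=
  match d return 'M[R]_m.+1 -> 'M[R]_((d + m).+1) with
  | 0%N => id
  | d'.+1 => @EOL (d' + m) \o @EOLcomp m d'
  end.

End OffLog.

Arguments Sym {R} n _.
Arguments SymPD {R} n _.
Arguments Hol {R} n _.
Arguments Corp {R} n _.
Arguments corOL R n : clear implicits.
Arguments PhiOL {R k} _.
Arguments PhiOLV {R k} _.
Arguments FOL {R k} _.
Arguments EOL R k _ : clear implicits.
Arguments iotaOL R k _ : clear implicits.
Arguments EOLcomp R m d _ : clear implicits.

(* Main.v *)
(* In the global coordinate Log, the metric g^OL is the flat Frobenius metric on the
   vector space Hol(n).  Unfolding E_n with the inverse bijections exp/log and
   Exp/Log gives Log(E_n(C)) = psi(Log C), and psi restricted to Hol(n) is a linear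
   Frobenius isometry with a linear left inverse.  Any map that is such a linear
   isometry in off-log coordinates is a smooth isometric embedding, and it preserves
   geodesics since these are the curves with affine off-log coordinate; the class is
   closed under composition.
   The facts on which this rests are: the derivative of exp is a block of
   exp [[A, V], [0, A]], so exp is smooth; by the spectral theorem exp is strongly
   monotone on symmetric matrices, so exp : Sym -> SymPD is bijective and the
   derivatives of exp and of d |-> diag exp(S + diag d) are coercive; a coercive
   implicit equation has smooth solutions, whence log and D are smooth; D(S) exists
   as the minimum of tr exp(S + diag d) - sum d. *)
Require Import Defs.
From HB Require Import structures.
From mathcomp Require Import all_boot all_order all_algebra ring lra.
From mathcomp Require complex.
From mathcomp Require Import all_classical all_reals all_analysis.

Set Implicit Arguments.
Unset Strict Implicit.
Unset Printing Implicit Defensive.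

Import Order.TTheory GRing.Theory Num.Theory.
Import numFieldNormedType.Exports.
Local Open Scope classical_set_scope.
Local Open Scope ring_scope.

(** * Calculus of C^k maps on open sets *)

(** The statement differentiates maps on [Corp], a relatively open piece of an affine subspace,
    whereas the calculus below lives on open sets. Every map is therefore replaced by an extension
    to an open set that agrees with it on the slice; directional derivatives along [Hol] cannot tell
    the two apart. Neither the logarithm nor the correction is handled by a formula, only by its
    equation. Strong monotonicity of the exponential serves three times: for uniqueness of the
    solution, for its continuity, and infinitesimally for the coercivity of the derivative. As
    continuity is known in advance, the implicit function argument involves no fixed point: it only
    upgrades a continuous solution to a smooth one. In the affine chart of [Corp] the metric is not
    constant, so the geodesic equation has a Christoffel term; identifying it with a second
    derivative of [Lg] takes the symmetry of second derivatives, hence Schwarz's theorem. A linear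
    left inverse accompanies each linear isometry because an embedding needs a continuous inverse on
    its image. *)

(* C^(k+1) is expressed by the tangent map (x, v) |-> 'd f x v being C^k: this is
   functorial, so the chain rule follows by induction on k without choosing
   bases. *)
Fixpoint Ck {R : realType} (k : nat) {E W : normedModType R} (U : set E)
    (f : E -> W) {struct k} : Prop :=
  if k is k'.+1 then
    (forall x, U x -> differentiable f x) /\
    Ck k' (U `*` [set: E]) (fun p : E * E => 'd f (p.1 : E) p.2)
  else forall x, U x -> {for x, continuous f}.

Section CkTheory.
Context {R : realType}.
Implicit Types E F G W : normedModType R.

Lemma Ck_continuous k E W (U : set E) (f : E -> W) :
  Ck k U f -> forall x, U x -> {for x, continuous f}.
Proof.
case: k => // k [df _] x Ux; exact/differentiable_continuous/df.
Qed.

Lemma Ck_sub k E W (U V : set E) (f : E -> W) :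
  V `<=` U -> Ck k U f -> Ck k V f.
Proof.
elim: k E W U V f => [|k IH] E W U V f VU /=; first by move=> cf x /VU /cf.
move=> [df Cf]; split; first by move=> x /VU /df.
by apply: IH Cf => -[x v] [/= /VU].
Qed.

Lemma CkW k E W (U : set E) (f : E -> W) : Ck k.+1 U f -> Ck k U f.
Proof.
elim: k E W U f => [|k IH] E W U f [df Cf].
  move=> x Ux; exact/differentiable_continuous/df.
by split => //; apply: IH.
Qed.

Lemma differentiable_of_bound E W (f : E -> W) (x : E) (L : {linear E -> W}) :
  continuous L ->
  (forall e : R, 0 < e ->
    \forall h \near 0, `|f (h + x) - f x - L h| <= e * `|h|) ->
  differentiable f x /\ 'd f x = L :> (E -> W).
Proof.
move=> cL fL; have h : f \o shift x = cst (f x) + L +o_ 0 id.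
  apply/eqaddoP => e e0; near=> h; rewrite !fctE /= opprD addrA.
  by near: h; exact: fL.
have dE : 'd f x = L :> (_ -> _) by exact: diff_unique.
by split => //; apply/diff_locallyP; rewrite dE.
Unshelve. all: by end_near. Qed.

Lemma near_eq_diff E W (f g : E -> W) (x : E) :
  (\near x, f x = g x) -> differentiable f x ->
  differentiable g x /\ 'd g x = 'd f x :> (E -> W).
Proof.
move=> fg df; apply: differentiable_of_bound => [|e e0]; first exact: diff_continuous.
have /eqaddoP/(_ e e0) := diff_locally df.
have : \forall y \near (0 : E), f (y + x) = g (y + x).
  by move: fg; rewrite (near_shift 0) subr0 => fg; near=> y; near: y.
apply: filterS2 => y fgy; rewrite !fctE /= opprD addrA.
by rewrite fgy (nbhs_singleton fg).
Unshelve. all: by end_near. Qed.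

Lemma open_prodT E F (U : set E) : open U -> open (U `*` [set: F]).
Proof.
rewrite !openE => oU [x v] [/= Ux _]; exists (U, setT); last by move=> [].
by split; [exact: oU|exact: filterT].
Qed.

Lemma Ck_eq k E W (U : set E) (f g : E -> W) :
  open U -> (forall x, U x -> f x = g x) -> Ck k U f -> Ck k U g.
Proof.
elim: k E W U f g => [|k IH] E W U f g oU fg.
  move=> cf x Ux; rewrite /prop_for /continuous_at -fg //; apply: cvg_trans (cf _ Ux).
  apply: near_eq_cvg; have : nbhs x U by exact: open_nbhs_nbhs.
  by apply: filterS => y /fg ->.
have nfg x : U x -> \near x, f x = g x.
  move=> Ux; have : nbhs x U by exact: open_nbhs_nbhs.
  by apply: filterS => y /fg ->.
move=> [df Cf]; split.
  by move=> x Ux; case: (near_eq_diff (nfg _ Ux) (df _ Ux)).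
apply: IH Cf; first exact: open_prodT.
move=> [x v] [/= Ux _].
by case: (near_eq_diff (nfg _ Ux) (df _ Ux)) => _ ->.
Qed.

Lemma Ck_pair k E F W (U : set E) (f : E -> F) (g : E -> W) :
  open U -> Ck k U f -> Ck k U g -> Ck k U (fun x => (f x, g x)).
Proof.
elim: k E F W U f g => [|k IH] E F W U f g oU.
  by move=> cf cg x Ux; apply: cvg_pair; [exact: cf|exact: cg].
move=> [df Cf] [dg Cg]; split.
  by move=> x Ux; apply: differentiable_pair; [exact: df|exact: dg].
apply: (@Ck_eq _ _ _ _ (fun p : E * E => ('d f (p.1 : E) p.2, 'd g (p.1 : E) p.2))).
- exact: open_prodT.
- by move=> [x v] [/= Ux _]; rewrite diff_pair //; [exact: df|exact: dg].
- by apply: IH => //; exact: open_prodT.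
Qed.

(** The tangent map of [f] is [(x, v) |-> f v], again linear and continuous, so the induction
    closes. *)
Lemma Ck_linear k E W (f : {linear E -> W}) (U : set E) :
  open U -> continuous f -> Ck k U f.
Proof.
elim: k E W f U => [|k IH] E W f U oU cf; first by move=> x _; exact: cf.
split; first by move=> x _; exact: linear_differentiable.
have fl : linear (fun p : E * E => f p.2).
  by move=> a [x y] [z t] /=; rewrite linearP.
pose M := GRing.isLinear.Build _ _ _ _ _ fl.
pose L : {linear (E * E)%type -> W} := HB.pack (fun p : E * E => f p.2) M.
apply: (@Ck_eq _ _ _ _ L).
- exact: open_prodT.
- by move=> [x v] _ /=; rewrite diff_lin.
- apply: IH; first exact: open_prodT.
  move=> p; apply: (@continuous_comp _ _ _ snd f); [exact: cvg_snd|exact: cf].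
Qed.

Lemma Ck_lin k E W (f : E -> W) (U : set E) :
  open U -> linear f -> continuous f -> Ck k U f.
Proof.
move=> oU lf cf; pose M := GRing.isLinear.Build _ _ _ _ _ lf.
pose L : {linear E -> W} := HB.pack f M.
exact: (@Ck_linear k _ _ L).
Qed.

Lemma Ck_fst k E F (U : set (E * F)) : open U -> Ck k U fst.
Proof.
by move=> oU; apply: Ck_lin => // p; exact: cvg_fst.
Qed.

Lemma Ck_snd k E F (U : set (E * F)) : open U -> Ck k U snd.
Proof.
by move=> oU; apply: Ck_lin => // p; exact: cvg_snd.
Qed.

Lemma Ck_id k E (U : set E) : open U -> Ck k U id.
Proof. by move=> oU; apply: Ck_lin => // x; exact: cvg_id. Qed.

Lemma Ck_cst k E W (U : set E) (c : W) : open U -> Ck k U (fun=> c).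
Proof.
elim: k E U c => [|k IH] E U c oU; first by move=> x _; exact: cst_continuous.
split; first by move=> x _; exact: differentiable_cst.
apply: (@Ck_eq _ _ _ _ (fun=> 0)).
- exact: open_prodT.
- by move=> [x v] _ /=; rewrite diff_cst.
- by apply: IH; exact: open_prodT.
Qed.

(** The tangent map of the composite is the tangent map of [g] after [(x, v) |-> (f x, 'd f x v)].
    The induction hypothesis serves twice: for this composition, and for [f \o fst], its inner first
    component. *)
Lemma Ck_comp k E F W (U : set E) (V : set F) (f : E -> F) (g : F -> W) :
  open U -> open V -> (forall x, U x -> V (f x)) ->
  Ck k U f -> Ck k V g -> Ck k U (fun x => g (f x)).
Proof.
elim: k E F W U V f g => [|k IH] E F W U V f g oU oV fUV Cf Cg.
  move=> x Ux; apply: (@continuous_comp _ _ _ f g); first exact: Cf.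
  by apply: Cg; exact: fUV.
have [df Cdf] := Cf; have [dg Cdg] := Cg.
split.
  move=> x Ux; apply: (@differentiable_comp _ _ _ _ f g); first exact: df.
  by apply: dg; exact: fUV.
apply: (@Ck_eq _ _ _ _ (fun p : E * E => 'd g (f p.1) ('d f (p.1 : E) p.2))).
- exact: open_prodT.
- move=> [x v] [/= Ux _]; rewrite (@diff_comp _ _ _ _ f g) //; first exact: df.
  by apply: dg; exact: fUV.
- apply: (IH _ _ _ _ (V `*` setT) (fun p : E * E => (f p.1, 'd f (p.1 : E) p.2))
    (fun p : F * F => 'd g (p.1 : F) p.2)) => //.
  + exact: open_prodT.
  + exact: open_prodT.
  + by move=> [x v] [/= Ux _]; split => //=; exact: fUV.
  + apply: Ck_pair; [exact: open_prodT| |exact: Cdf].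
    apply: (IH _ _ _ _ U fst f) => //.
    * exact: open_prodT.
    * by move=> [x v] [].
    * by apply: Ck_fst; exact: open_prodT.
    * exact: CkW.
Qed.

Lemma Ck_compT k E F W (U : set E) (f : E -> F) (g : F -> W) :
  open U -> Ck k U f -> Ck k setT g -> Ck k U (fun x => g (f x)).
Proof. by move=> oU Cf Cg; apply: Ck_comp Cf Cg => //; exact: openT. Qed.

Lemma Ck_comp_lin k E F W (U : set E) (f : E -> F) (g : F -> W) :
  open U -> linear g -> continuous g -> Ck k U f -> Ck k U (fun x => g (f x)).
Proof.
by move=> oU lg cg Cf; apply: Ck_compT Cf _ => //; apply: Ck_lin => //; exact: openT.
Qed.

Lemma CkD k E W (U : set E) (f g : E -> W) :
  open U -> Ck k U f -> Ck k U g -> Ck k U (fun x => f x + g x).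
Proof.
move=> oU Cf Cg.
apply: (@Ck_comp_lin _ _ _ _ _ (fun x => (f x, g x)) (fun p : W * W => p.1 + p.2)) => //.
- by move=> a [x y] [z t] /=; rewrite scalerDr addrACA.
- exact: add_continuous.
- exact: Ck_pair.
Qed.

Lemma CkN k E W (U : set E) (f : E -> W) :
  open U -> Ck k U f -> Ck k U (fun x => - f x).
Proof.
move=> oU; apply: Ck_comp_lin => //; last exact: opp_continuous.
by move=> a x y; rewrite opprD scalerN.
Qed.

Lemma CkB k E W (U : set E) (f g : E -> W) :
  open U -> Ck k U f -> Ck k U g -> Ck k U (fun x => f x - g x).
Proof. by move=> oU Cf Cg; apply: CkD => //; exact: CkN. Qed.

(** By the product rule the tangent map is a sum of two copies of [f] precomposed with pairs of
    projections, so the induction returns to [f] itself. It is run on the whole space, so that these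
    projections need not land in [U]. *)
Lemma Ck_bilin k E F W (f : {bilinear E -> F -> W}) (U : set (E * F)) :
  open U -> continuous (fun p : E * F => f p.1 p.2) ->
  Ck k U (fun p : E * F => f p.1 p.2).
Proof.
move=> oU cf; apply: (@Ck_sub _ _ _ setT) => //; move: cf; clear U oU.
elim: k => [|k IH] cf; first by move=> p _; exact: cf.
split; first by move=> p _; exact: differentiable_bilin.
have oT : open ([set: E * F] `*` [set: E * F]) by apply: open_prodT; exact: openT.
apply: (@Ck_eq _ _ _ _
  (fun q : (E * F) * (E * F) => f q.1.1 q.2.2 + f q.2.1 q.1.2)).
- exact: oT.
- by move=> [x v] _ /=; rewrite diff_bilin.
- apply: CkD => //.
    apply: (@Ck_compT _ _ _ _ _
      (fun q : (E * F) * (E * F) => (q.1.1, q.2.2)) _ _ _ (IH cf)) => //.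
    apply: Ck_pair => //.
      apply: (@Ck_compT _ _ _ _ _ fst fst) => //; apply: Ck_fst => //; exact: openT.
    apply: (@Ck_compT _ _ _ _ _ snd snd) => //; apply: Ck_snd => //; exact: openT.
  apply: (@Ck_compT _ _ _ _ _
    (fun q : (E * F) * (E * F) => (q.2.1, q.1.2)) _ _ _ (IH cf)) => //.
  apply: Ck_pair => //.
    apply: (@Ck_compT _ _ _ _ _ snd fst) => //; [exact: Ck_snd|].
    apply: Ck_fst => //; exact: openT.
  apply: (@Ck_compT _ _ _ _ _ fst snd) => //; [exact: Ck_fst|].
  apply: Ck_snd => //; exact: openT.
Qed.

Lemma Ck_scale k W (U : set (R^o * W)) :
  open U -> Ck k U (fun p : R^o * W => (p.1 : R) *: p.2).
Proof.
move=> oU.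
have bl : bilinear_for
    (GRing.Scale.Law.clone _ _ *:%R _) (GRing.Scale.Law.clone _ _ *:%R _)
    (fun (a : R^o) (w : W) => (a : R) *: w).
  split=> [u'|u] a x y /=; first by rewrite scalerDl scalerA.
  by rewrite scalerDr !scalerA mulrC.
pose M := bilinear_isBilinear.Build _ _ _ _ _ _ _ bl.
pose L : {bilinear R^o -> W -> W} := HB.pack (fun (a : R^o) (w : W) => (a : R) *: w) M.
apply: (@Ck_bilin _ _ _ _ L) => //.
exact: scale_continuous.
Qed.

End CkTheory.

(** * Implicit functions defined by coercive equations *)

Section Implicit.
Context {R : realType}.
Implicit Types P E F : normedModType R.

Lemma continuous_pair (T : topologicalType) E F (f : T -> E) (g : T -> F) (x : T) :
  {for x, continuous f} -> {for x, continuous g} ->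
  {for x, continuous (fun y => (f y, g y))}.
Proof. by move=> cf cg; apply: cvg_pair; [exact: cf|exact: cg]. Qed.

(** [Q] solves the linearised equation. Coercivity applied to the remainder [r = D - Q h], with [D]
    the increment of [g], bounds [c * |r|] by [eps * |(h, D)|], where [D] still contains [r]. *)
Lemma implicit_differentiable P E F (f : P * E -> F) (g : P -> E) (p0 : P) (c : R)
    (Q : {linear P -> E}) :
  0 < c -> continuous Q ->
  differentiable f (p0, g p0) -> {for p0, continuous g} ->
  (\near p0, f (p0, g p0) = 0) ->
  (forall v, c * `|v| <= `|'d f (p0, g p0) (0, v)|) ->
  (forall p, 'd f (p0, g p0) (p, Q p) = 0) ->
  differentiable g p0 /\ 'd g p0 = Q :> (P -> E).
Proof.
move=> c0 cQ df cg fg0 coer QP.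
have [K K0 QK] := linear_lipschitz cQ.
apply: differentiable_of_bound => // _/posnumP[e].
(* As [|(h, D)| <= |r| + (1 + K) * |h|], the bound [c / 2] absorbs the term in [r], and the other
   bound then leaves [|r| <= e * |h|]. *)
pose eps := Num.min (c / 2) (c * e%:num / (2 * (1 + K))).
have eps0 : 0 < eps.
  rewrite lt_min divr_gt0 //= divr_gt0 // ?mulr_gt0 //.
  by rewrite addr_gt0.
have w0 : (fun h : P => (h, g (h + p0) - g p0)) @ (0 : P) --> ((0, 0) : P * E).
  apply: cvg_pair; first exact: cvg_id.
  suff : g (h + p0) - g p0 @[h --> (0 : P)] --> g p0 - g p0 by rewrite subrr.
  apply: cvgB; last exact: cvg_cst.
  apply: (@cvg_comp _ _ _ (fun h => h + p0) g _ (nbhs p0)) => //.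
  suff : h + p0 @[h --> (0 : P)] --> 0 + p0 by rewrite add0r.
  by apply: cvgD; [exact: cvg_id|exact: cvg_cst].
have /eqaddoP/(_ _ eps0) := diff_locally df.
move=> /w0 hf; near=> h.
have fh : f (h + p0, g (h + p0)) = 0.
  near: h; move: fg0; rewrite (near_shift 0) subr0 => fg0.
  by near=> y; near: y.
have : `|f (h + p0, g (h + p0) - g p0 + g p0)
    - (f (p0, g p0) + 'd f (p0, g p0) (h, g (h + p0) - g p0))|
    <= eps * `|(h, g (h + p0) - g p0)|.
  by near: h; exact: hf.
rewrite subrK fh (nbhs_singleton fg0) sub0r normrN add0r.
set D := g _ - _.
have -> : (h, D) = (h, Q h) + (0, D - Q h).
  by congr pair; rewrite /= ?addr0 // addrC subrK.
rewrite linearD QP add0r => /(le_trans (coer _)).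
set r := D - Q h => hr.
have nD : `|(h, Q h) + (0, r)| <= `|r| + (1 + K) * `|h|.
  have -> : (h, Q h) + (0, r) = (h, Q h + r) by congr pair; rewrite /= addr0.
  rewrite prod_normE /= ge_max; apply/andP; split.
    by rewrite mulrDl mul1r addrCA lerDl addr_ge0 // mulr_ge0 // ltW.
  rewrite (le_trans (ler_normD _ _)) // addrC lerD2l (le_trans (QK _)) //.
  by rewrite mulrDl mul1r lerDr.
have e1 : eps <= c / 2 by rewrite /eps ge_min lexx.
have e2 : eps * (1 + K) <= c * e%:num / 2.
  rewrite -ler_pdivlMr ?addr_gt0 // /eps ge_min; apply/orP; right.
  by rewrite invfM mulrA.
have {}hr := le_trans hr (ler_wpM2l (ltW eps0) nD).
have h1 := ler_wpM2r (normr_ge0 r) e1.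
have h2 := ler_wpM2r (normr_ge0 h) e2.
rewrite -(ler_pM2l c0); move: hr h1 h2; rewrite mulrDr mulrA.
move: (`|r|) (`|h|) => a b; lra.
Unshelve. all: by end_near. Qed.

(* The derivative q of g at p in the direction p' is itself implicitly defined,
   by 'd f (p, g p) (p', q) = 0, an equation with the same partial derivative in
   its unknown as f: hence the induction on k. *)
Lemma Ck_implicit k P E F (U : set P) (f : P * E -> F) (g : P -> E) :
  open U -> Ck k (U `*` [set: E]) f ->
  (forall p, U p -> f (p, g p) = 0) ->
  (forall p, U p -> {for p, continuous g}) ->
  (forall p, U p -> exists2 c, 0 < c &
     \forall q \near p, forall v, c * `|v| <= `|'D_(0, v) f (q, g q)|) ->
  (forall p w, U p -> exists v, 'D_(0, v) f (p, g p) = w) ->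
  Ck k U g.
Proof.
elim: k P E F U f g => [//|k IH] P E F U f g oU Cf fg0 cg coer surj.
have [df Cdf] := Cf.
have D0 p v : U p -> 'D_(0, v) f (p, g p) = 'd f (p, g p) (0, v).
  by move=> Up; rewrite deriveE //; apply: df.
have ex p p' : U p -> exists q, 'd f (p, g p) (p', q) = 0.
  move=> Up; have [q] := surj p (- 'd f (p, g p) (p', 0)) Up.
  rewrite D0 // => h; exists q.
  have -> : (p', q) = (p', 0) + (0, q) by congr pair; rewrite /= ?addr0 ?add0r.
  by rewrite linearD h addrN.
have inj p v : U p -> 'd f (p, g p) (0, v) = 0 -> v = 0.
  move=> Up h; have [c c0 /nbhs_singleton/(_ v)] := coer p Up.
  rewrite D0 // h normr0 pmulr_rle0 // normr_le0 => /eqP //.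
have uniq p p' q q' : U p -> 'd f (p, g p) (p', q) = 0 ->
    'd f (p, g p) (p', q') = 0 -> q = q'.
  move=> Up h h'; apply/eqP; rewrite -subr_eq0; apply/eqP/(inj p) => //.
  have -> : (0, q - q') = (p', q) - (p', q').
    by congr pair; rewrite /= subrr.
  by rewrite linearB h h' subrr.
pose Q p p' := xget 0 [set q | 'd f (p, g p) (p', q) = 0].
have QP p p' : U p -> 'd f (p, g p) (p', Q p p') = 0.
  by move=> Up; rewrite /Q; case: xgetP => // h; have [q /h] := ex p p' Up.
have Qlin p : U p -> linear (Q p).
  move=> Up a x y; apply: (uniq p (a *: x + y)) => //; first exact: QP.
  have -> : (a *: x + y, a *: Q p x + Q p y) = a *: (x, Q p x) + (y, Q p y) by [].
  by rewrite linearP !QP //= scaler0 addr0.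
(* The equation for the derivative has [g] in its coefficients, so order [k] for [g] must come
   before order [k.+1]. *)
have Ckg : Ck k U g by apply: (IH P E F U f) => //; exact: CkW.
have oU2 : open (U `*` [set: P]) by exact: open_prodT.
have oU3 : open ((U `*` [set: P]) `*` [set: E]) by exact: open_prodT.
pose f2 (z : (P * P) * E) := 'd f (z.1.1, g z.1.1) (z.1.2, z.2).
have Cf2 : Ck k ((U `*` [set: P]) `*` [set: E]) f2.
  apply: (@Ck_comp _ _ _ _ _ _ ((U `*` [set: E]) `*` [set: P * E])
    (fun z : (P * P) * E => ((z.1.1, g z.1.1), (z.1.2, z.2)))
    (fun z : (P * E) * (P * E) => 'd f (z.1 : P * E) z.2)) => //.
  - by apply: open_prodT; exact: open_prodT.
  - have c11 : Ck k ((U `*` [set: P]) `*` [set: E]) (fun z : (P * P) * E => z.1.1).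
      apply: (@Ck_compT _ _ _ _ _ _ fst fst) => //; first exact: Ck_fst.
      by apply: Ck_fst; exact: openT.
    apply: Ck_pair => //; apply: Ck_pair => //.
    + by apply: (@Ck_comp _ _ _ _ _ _ U _ g) c11 Ckg => // -[[x y] z] [[]].
    + apply: (@Ck_compT _ _ _ _ _ _ fst snd) => //; first exact: Ck_fst.
      by apply: Ck_snd; exact: openT.
    + exact: Ck_snd.
have D2 (z : P * P) q v : 'D_(0, v) f2 (z, q) = 'd f (z.1, g z.1) (0, v).
  rewrite /derive; apply: lim_near_cst => //; near=> h.
  have h0 : h != 0 by near: h; exact: nbhs_dnbhs_neq.
  rewrite /f2 /= !scaler0 !add0r -linearB.
  have -> : (z.2, h *: v + q) - (z.2, q) = h *: (0, v).
    by congr pair; rewrite /= ?scaler0 ?subrr // addrK.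
  by rewrite linearZ /= scalerA mulVf // scale1r.
(* Freeze the solution [q0] at [(p, p')]. Since [Q] solves the equation at [z], coercivity there
   gives [c * |q0 - Q z.1 z.2| <= |f2 (z, q0)|], and the right side tends to
   [f2 ((p, p'), q0) = 0]. *)
have contQ : forall x, (U `*` [set: P]) x ->
    {for x, continuous (fun z : P * P => Q z.1 z.2)}.
  move=> [p p'] [/= Up _]; have [c c0 cc] := coer p Up.
  apply/cvgrPdist_lt => /= e e0; set q0 := Q p p'.
  have cf2 : {for (p, p'), continuous (fun z => f2 (z, q0))}.
    apply: (@continuous_comp _ _ _ (fun z => (z, q0)) f2).
      by apply: continuous_pair; [exact: cvg_id|exact: cst_continuous].
    exact: (Ck_continuous Cf2 (x := ((p, p'), q0))).
  have ce0 : 0 < c * e by exact: mulr_gt0.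
  have f20 : f2 ((p, p'), q0) = 0 by rewrite /f2 /= QP.
  have /cvgrPdist_lt/(_ _ ce0) := cf2; rewrite f20 => nf2.
  near=> z.
  have Uz : U z.1.
    near: z; apply: (@cvg_fst _ _ (nbhs p) (nbhs p')) => /=.
    exact: open_nbhs_nbhs.
  have hz : forall v, c * `|v| <= `|'d f (z.1, g z.1) (0, v)|.
    move=> v; rewrite -D0 //; move: v; near: z.
    exact: (@cvg_fst _ _ (nbhs p) (nbhs p') _ _ cc).
  rewrite -(ltr_pM2l c0) (le_lt_trans (hz _)) //.
  have -> : (0, q0 - Q z.1 z.2) = (z.2, q0) - (z.2, Q z.1 z.2).
    by congr pair; rewrite /= ?subrr.
  rewrite linearB QP // subr0 -normrN -sub0r.
  by near: z; exact: nf2.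
have dg p : U p -> differentiable g p /\ 'd g p = Q p :> (P -> E).
  move=> Up; pose M := GRing.isLinear.Build _ _ _ _ _ (Qlin p Up).
  pose L : {linear P -> E} := HB.pack (Q p) M.
  have [c c0 cc] := coer p Up.
  apply: (@implicit_differentiable _ _ _ f g p c L) => //.
  - move=> x; apply: (@continuous_comp _ _ _ (fun z => (p, z)) (fun z => Q z.1 z.2)).
      by apply: continuous_pair; [exact: cst_continuous|exact: cvg_id].
    exact: contQ.
  - by apply: df.
  - exact: cg.
  - have : nbhs p U by exact: open_nbhs_nbhs.
    by apply: filterS => q /fg0.
  - by move=> v; rewrite -D0 //; apply: (nbhs_singleton cc).
  - by move=> p'; exact: QP.
split; first by move=> p /dg [].
apply: (@Ck_eq _ _ _ _ _ (fun z : P * P => Q z.1 z.2)) => //.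
  by move=> [x v] [/= /dg [_ ->]].
apply: (IH _ _ _ _ f2) => //.
- by move=> [x v] [/= Ux _]; rewrite /f2 /= QP.
- move=> [x v] [/= Ux _]; have [c c0 cc] := coer x Ux; exists c => //.
  have nU : nbhs x U by exact: open_nbhs_nbhs.
  have h : \forall z \near ((x, v) : P * P),
      U z.1 /\ forall w, c * `|w| <= `|'D_(0, w) f (z.1, g z.1)|.
    exact: (@cvg_fst _ _ (nbhs x) (nbhs v) _ _ (filterI nU cc)).
  near=> z; have [Uz hz] : U z.1 /\ forall w, c * `|w| <= `|'D_(0, w) f (z.1, g z.1)|.
    by near: z.
  by move=> w; rewrite D2 -D0.
- move=> [x v] w [/= Ux _]; have [u hu] := surj x w Ux; exists u.
  by rewrite D2 -D0.
Unshelve. all: by end_near. Qed.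
End Implicit.

(** * The matrix exponential *)

Section MatrixNorm.
Context {R : realType}.

Lemma mxnorm_ge m n (A : 'M[R]_(m, n)) i j : `|A i j| <= `|A|.
Proof.
by rewrite [leRHS]/Num.Def.normr/= mx_normrE; exact: (le_bigmax _ _ (i, j)).
Qed.

Lemma mxnorm_le m n (A : 'M[R]_(m, n)) c :
  0 <= c -> (forall i j, `|A i j| <= c) -> `|A| <= c.
Proof.
move=> c0 Ac; rewrite [leLHS]/Num.Def.normr/= mx_normrE.
by rewrite (bigmax_le _ c0).
Qed.

(** The norm is the largest absolute entry, which is submultiplicative only up to the inner
    dimension; this is the source of the size factors in the later bounds. *)
Lemma mxnormM m n p (A : 'M[R]_(m, n)) (B : 'M[R]_(n, p)) :
  `|A *m B| <= n%:R * `|A| * `|B|.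
Proof.
apply: mxnorm_le => [|i j]; first by rewrite !mulr_ge0.
rewrite mxE (le_trans (ler_norm_sum _ _ _)) //.
rewrite (le_trans (y := \sum_(k < n) `|A| * `|B|)) //.
  by apply: ler_sum => k _; rewrite normrM ler_pM ?mxnorm_ge.
by rewrite sumr_const card_ord -[leLHS]mulr_natl mulrA.
Qed.

Lemma cvg_mx (T : Type) (F : set_system T) (FF : Filter F) m n
    (f : T -> 'M[R]_(m, n)) (L : 'M[R]_(m, n)) :
  (forall i j, f x i j @[x --> F] --> L i j) -> f @ F --> L.
Proof.
move=> h; apply/cvgrPdist_le => /= e e0; near=> x.
apply: mxnorm_le; first exact: ltW.
move=> i j; rewrite !mxE; move: i j; near: x.
apply: filter_forall => i; apply: filter_forall => j.
by have /cvgrPdist_le/(_ _ e0) := h i j.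
Unshelve. all: by end_near. Qed.

Lemma mx_linear_continuous m n (W : normedModType R) (f : 'M[R]_(m, n) -> W) :
  linear f -> continuous f.
Proof.
move=> lf; pose M := GRing.isLinear.Build _ _ _ _ _ lf.
pose L : {linear 'M[R]_(m, n) -> W} := HB.pack f M.
have -> : f = fun A => \sum_(i < m) \sum_(j < n) A i j *: L (delta_mx i j).
  apply/funext => A; rewrite -[LHS]/(L A) {1}[A]matrix_sum_delta linear_sum.
  by apply: eq_bigr => i _; rewrite linear_sum; apply: eq_bigr => j _; rewrite linearZ.
have addc : continuous (fun z : W * W => z.1 + z.2) by exact: add_continuous.
apply: continuous_big => [|i _]; first exact: addc.
apply: continuous_big => [|j _]; first exact: addc.
move=> A; apply: (@continuous_comp _ R _ (fun M : 'M[R]_(m, n) => M i j)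
  (fun a => a *: L (delta_mx i j))).
  exact: coord_continuous.
exact: scalel_continuous.
Qed.

End MatrixNorm.

Section MatrixExp.
Context {R : realType}.

Definition expm_coeff n (A : 'M[R]_n) : nat -> 'M[R]_n :=
  fun k => (k`!%:R)^-1 *: A ^+ k.

Lemma mxnormX n (A : 'M[R]_n) k : `|A ^+ k| <= (n.+1%:R * `|A|) ^+ k.
Proof.
elim: k => [|k IH].
  rewrite !expr0; apply: mxnorm_le => // i j; rewrite !mxE.
  by case: eqP; rewrite ?normr1 ?normr0.
rewrite !exprS (le_trans (mxnormM _ _)) // ler_pM ?mulr_ge0 //.
by rewrite ler_wpM2r // ler_nat.
Qed.

Lemma expm_coeff_le n (A : 'M[R]_n) k i j :
  `|expm_coeff A k i j| <= exp_coeff (n.+1%:R * `|A|) k.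
Proof.
rewrite /exp_coeff /= mxE normrM mulrC.
rewrite [X in _ * X]ger0_norm ?invr_ge0 // ler_wpM2r ?invr_ge0 //.
exact: le_trans (mxnorm_ge _ _ _) (mxnormX _ _).
Qed.

Lemma series_mxE m n (u : nat -> 'M[R]_(m, n)) i j :
  (fun N => series u N i j) = series (fun k => u k i j).
Proof. by apply/funext => N; rewrite /series /= summxE. Qed.

Lemma normed_cvg_expm_coeff n (A : 'M[R]_n) i j :
  cvgn [normed series (fun k => expm_coeff A k i j)].
Proof.
apply: (@series_le_cvg _ _ (exp_coeff (n.+1%:R * `|A|))).
- by move=> k /=.
- by move=> k; rewrite (le_trans _ (expm_coeff_le A k i j)).
- by move=> k; exact: expm_coeff_le.
- exact: is_cvg_series_exp_coeff.
Qed.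

Lemma cvg_expm n (A : 'M[R]_n) : series (expm_coeff A) @ \oo --> expm A.
Proof.
suff : cvgn (series (expm_coeff A)) by [].
apply/cvg_ex; exists (\matrix_(i, j) limn (series (fun k => expm_coeff A k i j))).
apply: cvg_mx => i j; rewrite mxE series_mxE.
have := normed_cvg (@normed_cvg_expm_coeff _ A i j); exact.
Qed.

Lemma expmE n (A : 'M[R]_n) i j :
  expm A i j = limn (series (fun k => expm_coeff A k i j)).
Proof.
apply/esym/cvg_lim => //; rewrite -series_mxE.
apply: (@cvg_comp _ _ _ (series (expm_coeff A)) (fun M : 'M[R]_n => M i j)).
  exact: cvg_expm.
exact: coord_continuous.
Qed.

Lemma expm_norm n (A : 'M[R]_n) : `|expm A| <= expR (n.+1%:R * `|A|).
Proof.
apply: mxnorm_le => [|i j]; first exact: expR_ge0.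
rewrite expmE (le_trans (lim_series_norm (@normed_cvg_expm_coeff _ A i j))) //.
apply: lim_series_le.
- exact: normed_cvg_expm_coeff.
- exact: is_cvg_series_exp_coeff.
- by move=> k; exact: expm_coeff_le.
Qed.

Lemma cvg_expm_linear n (A : 'M[R]_n) (W : normedModType R) (f : 'M[R]_n -> W) :
  linear f ->
  series (fun k => (k`!%:R)^-1 *: f (A ^+ k)) @ \oo --> f (expm A).
Proof.
move=> lf; pose M := GRing.isLinear.Build _ _ _ _ _ lf.
pose L : {linear 'M[R]_n -> W} := HB.pack f M.
have -> : series (fun k => (k`!%:R)^-1 *: f (A ^+ k)) =
    f \o series (expm_coeff A).
  apply/funext => N; rewrite /= /series /= -[RHS]/(L _) linear_sum.
  by apply: eq_bigr => k _; rewrite /expm_coeff linearZ.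
apply: cvg_comp; first exact: cvg_expm.
exact: mx_linear_continuous.
Qed.

(** Both sides are limits of the linear images of partial sums, so an identity between exponentials
    reduces to one between powers. *)
Lemma expm_transfer n p (W : normedModType R) (A : 'M[R]_n) (B : 'M[R]_p)
    (f : 'M[R]_n -> W) (g : 'M[R]_p -> W) :
  linear f -> linear g ->
  (forall k, f (A ^+ k) = g (B ^+ k)) -> f (expm A) = g (expm B).
Proof.
move=> lf lg fg; have /cvg_unique := @cvg_expm_linear _ A _ _ lf; apply => //.
have -> : (fun k => (k`!%:R)^-1 *: f (A ^+ k)) = fun k => (k`!%:R)^-1 *: g (B ^+ k).
  by apply/funext => k; rewrite fg.
exact: cvg_expm_linear.
Qed.

End MatrixExp.

(** * Differentiability of the exponential through block triangular matrices *)

Section MatrixExpDiff.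
Context {R : realType}.

(** This is the sum over [i < k] of [A ^+ i *m V *m B ^+ (k - 1 - i)]: for [A = B] the derivative of
    the [k]-th power, and for [V = B - A] a telescoping sum. *)
Fixpoint urpow n (A V B : 'M[R]_n) k : 'M[R]_n :=
  if k is k'.+1 then A *m urpow A V B k' + V *m B ^+ k' else 0.

Lemma block_expr n (A V B : 'M[R]_n) k :
  block_mx A V 0 B ^+ k = block_mx (A ^+ k) (urpow A V B k) 0 (B ^+ k).
Proof.
elim: k => [|k IH]; first by rewrite !expr0 /= -scalar_mx_block.
rewrite !exprS IH -!mulmxE mulmx_block /=.
by rewrite !mulmx0 !mul0mx !addr0 add0r.
Qed.

Lemma urpowP n (A B : 'M[R]_n) k a V W :
  urpow A (a *: V + W) B k = a *: urpow A V B k + urpow A W B k.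
Proof.
elim: k => [|k IH] /=; first by rewrite scaler0 addr0.
by rewrite IH mulmxDr mulmxDl scalerDr -!scalemxAr -!scalemxAl addrACA.
Qed.

Lemma urpow_sub n (A B : 'M[R]_n) k : urpow A (B - A) B k = B ^+ k - A ^+ k.
Proof.
elim: k => [|k IH] /=; first by rewrite !expr0 subrr.
by rewrite IH mulmxBr mulmxBl !exprS -!mulmxE addrC addrA subrK.
Qed.

(** For [A = B] this is the derivative of [expm] in the direction [V]; for [V = B - A] it is the
    exact increment of [expm]. Keeping two base points puts increment and derivative in one
    family. *)
Definition durexp n (A V B : 'M[R]_n) : 'M[R]_n :=
  ursubmx (expm (block_mx A V 0 B)).

Lemma cvg_durexp n (A V B : 'M[R]_n) :
  series (fun k => (k`!%:R)^-1 *: urpow A V B k) @ \oo --> durexp A V B.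
Proof.
have lu : linear (fun M : 'M[R]_(n + n) => ursubmx M).
  by move=> a X Y; apply/matrixP => i j; rewrite !mxE.
have := @cvg_expm_linear _ _ (block_mx A V 0 B) _ _ lu.
suff -> : (fun k => (k`!%:R)^-1 *: ursubmx (block_mx A V 0 B ^+ k)) =
  (fun k => (k`!%:R)^-1 *: urpow A V B k) by [].
by apply/funext => k; rewrite block_expr block_mxKur.
Qed.

Lemma durexp_linear n (A B : 'M[R]_n) : linear (fun V => durexp A V B).
Proof.
move=> a V W; have /cvg_unique := @cvg_durexp n A (a *: V + W) B; apply => //.
have -> : series (fun k => (k`!%:R)^-1 *: urpow A (a *: V + W) B k) =
    a *: series (fun k => (k`!%:R)^-1 *: urpow A V B k) +
      series (fun k => (k`!%:R)^-1 *: urpow A W B k).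
  apply/funext => N; rewrite /= /series !fctE /= scaler_sumr -big_split.
  by apply: eq_bigr => k _; rewrite urpowP scalerDr !scalerA mulrC.
by apply: cvgD; [apply: cvgZl_tmp|]; exact: cvg_durexp.
Qed.

Lemma durexpZ n (A B : 'M[R]_n) a V : durexp A (a *: V) B = a *: durexp A V B.
Proof.
pose M := GRing.isLinear.Build _ _ _ _ _ (@durexp_linear n A B).
pose L : {linear 'M[R]_n -> 'M[R]_n} := HB.pack (fun V => durexp A V B) M.
by rewrite -[LHS]/(L (a *: V)) linearZ.
Qed.

Lemma expm_sub n (A B : 'M[R]_n) : expm B - expm A = durexp A (B - A) B.
Proof.
apply/esym; have /cvg_unique := @cvg_durexp n A (B - A) B; apply => //.
have -> : series (fun k => (k`!%:R)^-1 *: urpow A (B - A) B k) =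
    series (expm_coeff B) - series (expm_coeff A).
  apply/funext => N; rewrite /= /series !fctE /= -sumrB.
  by apply: eq_bigr => k _; rewrite urpow_sub scalerBr.
by apply: cvgB; exact: cvg_expm.
Qed.

Lemma mxnorm_block n (A V B : 'M[R]_n) r :
  `|A| <= r -> `|V| <= r -> `|B| <= r -> `|block_mx A V 0 B| <= r.
Proof.
move=> Ar Vr Br; have r0 : 0 <= r by exact: le_trans Ar.
apply: mxnorm_le => // i j.
rewrite -[i]splitK -[j]splitK; case: (fintype.split i) => i'; case: (fintype.split j) => j' /=.
- by rewrite block_mxEul (le_trans (mxnorm_ge _ _ _)).
- by rewrite block_mxEur (le_trans (mxnorm_ge _ _ _)).
- by rewrite block_mxEdl mxE normr0.
- by rewrite block_mxEdr (le_trans (mxnorm_ge _ _ _)).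
Qed.

Lemma mxnorm_ursubmx n (M : 'M[R]_(n + n)) : `|ursubmx M| <= `|M|.
Proof. by apply: mxnorm_le => // i j; rewrite !mxE mxnorm_ge. Qed.

Lemma durexp_norm n (A V B : 'M[R]_n) r :
  `|A| <= r -> `|V| <= r -> `|B| <= r ->
  `|durexp A V B| <= expR ((n + n).+1%:R * r).
Proof.
move=> Ar Vr Br; rewrite (le_trans (mxnorm_ursubmx _)) //.
rewrite (le_trans (expm_norm _)) // ler_expR ler_wpM2l //.
exact: mxnorm_block.
Qed.

(* Rescaling [V] to norm 1 exploits the linearity of [durexp A V B] in [V]. *)
Lemma expm_lipschitz n (A B : 'M[R]_n) r :
  1 <= r -> `|A| <= r -> `|B| <= r ->
  `|expm B - expm A| <= expR ((n + n).+1%:R * r) * `|B - A|.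
Proof.
move=> r1 Ar Br; have [->|BA] := eqVneq B A; first by rewrite !subrr !normr0 mulr0.
have s0 : 0 < `|B - A| by rewrite normr_gt0 subr_eq0.
rewrite expm_sub -[X in durexp _ X _](scalerKV (a := `|B - A|)) ?gt_eqF //.
rewrite durexpZ normrZ normr_id mulrC ler_wpM2r //.
apply: durexp_norm => //.
by rewrite normrZ normfV normr_id mulVf ?gt_eqF.
Qed.

(** The remainder at [V] is [durexp A V (V + A) - durexp A V A], a block of a difference of two
    exponentials of double size. For the unit direction [W] the Lipschitz bound makes it at most
    [K * |V|], and rescaling gives a quadratic remainder. *)
Lemma expm_diff n (A : 'M[R]_n) :
  differentiable (@expm R n) A /\ 'd (@expm R n) A = (fun V => durexp A V A) :> (_ -> _).
Proof.
pose M := GRing.isLinear.Build _ _ _ _ _ (@durexp_linear n A A).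
pose L : {linear 'M[R]_n -> 'M[R]_n} := HB.pack (fun V => durexp A V A) M.
have cL : continuous L by apply: mx_linear_continuous; exact: linearP.
apply: (@differentiable_of_bound _ _ _ (@expm R n) A L cL) => _/posnumP[e].
(* [r] bounds [A], [V + A] and the unit direction [W] together; [K] is the Lipschitz constant of
   [expm] for matrices of size [n + n]. *)
pose r := 1 + `|A|; pose K := expR (((n + n) + (n + n)).+1%:R * r).
near=> V; rewrite expm_sub addrK -[L V]/(durexp A V A).
have V1 : `|V| <= 1 by near: V; apply: (@nbhs0_le R ('M[R]_n : normedModType R)).
have VK : `|V| <= e%:num / K.
  near: V; apply: (@nbhs0_le R ('M[R]_n : normedModType R));
  by rewrite divr_gt0 ?expR_gt0.
have [->|V0] := eqVneq V 0; first by rewrite add0r subrr !normr0 mulr0.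
have s0 : 0 < `|V| by rewrite normr_gt0.
pose W := `|V|^-1 *: V.
have dW B : durexp A V B = `|V| *: durexp A W B.
  by rewrite -durexpZ scalerKV ?gt_eqF.
rewrite !dW -scalerBr normrZ normr_id mulrC ler_wpM2r //.
have W1 : `|W| <= 1 by rewrite normrZ normfV normr_id mulVf ?gt_eqF.
have r1 : 1 <= r by rewrite lerDl.
have Ar : `|A| <= r by rewrite lerDr.
have VAr : `|V + A| <= r by rewrite (le_trans (ler_normD _ _)) // lerD2r.
have -> : durexp A W (V + A) - durexp A W A =
  ursubmx (expm (block_mx A W 0 (V + A)) - expm (block_mx A W 0 A)).
  by apply/matrixP => i j; rewrite !mxE.
rewrite (le_trans (mxnorm_ursubmx _)) // (le_trans (expm_lipschitz r1 _ _)) //.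
- by apply: mxnorm_block => //; exact: le_trans W1 r1.
- by apply: mxnorm_block => //; exact: le_trans W1 r1.
rewrite -/K mulrC -ler_pdivlMr ?expR_gt0 //; apply: le_trans VK.
rewrite opp_block_mx add_block_mx !subrr addrK.
by apply: mxnorm_block; rewrite ?normr0.
Unshelve. all: by end_near. Qed.

(* The derivative of expm is a block of the exponential of a matrix of double
   size, so the induction on k is made for all sizes at once. *)
Lemma Ck_expm k n : Ck k [set: 'M[R]_n] (@expm R n).
Proof.
elim: k n => [|k IH] n.
  by move=> A _; apply: differentiable_continuous; case: (expm_diff A).
split; first by move=> A _; case: (expm_diff A).
have oT : open ([set: 'M[R]_n] `*` [set: 'M[R]_n]).
  by apply: open_prodT; exact: openT.
apply: (@Ck_eq _ _ _ _ _ (fun p : 'M[R]_n * 'M[R]_n => durexp p.1 p.2 p.1)) => //.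
  by move=> [A V] _; case: (expm_diff A) => _ ->.
have lu : linear (fun M : 'M[R]_(n + n) => ursubmx M).
  by move=> a X Y; apply/matrixP => i j; rewrite !mxE.
apply: (@Ck_comp_lin _ _ _ _ _ _
  (fun p : 'M[R]_n * 'M[R]_n => expm (block_mx p.1 p.2 0 p.1)) _ oT lu).
  exact: mx_linear_continuous.
apply: (@Ck_compT _ _ _ _ _ _
  (fun p : 'M[R]_n * 'M[R]_n => block_mx p.1 p.2 0 p.1)) => //.
apply: (@Ck_eq _ _ _ _ _
  (fun p : 'M[R]_n * 'M[R]_n => block_mx p.1 0 0 p.1 + block_mx 0 p.2 0 0)) => //.
  by move=> p _; rewrite add_block_mx !addr0 !add0r.
have l1 : linear (fun A : 'M[R]_n => block_mx A 0 0 A).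
  by move=> a X Y; rewrite scale_block_mx add_block_mx !scaler0 !addr0.
have l2 : linear (fun A : 'M[R]_n => block_mx (0 : 'M[R]_n) A 0 (0 : 'M[R]_n)).
  by move=> a X Y; rewrite scale_block_mx add_block_mx !scaler0 !addr0.
apply: CkD => //.
  apply: (@Ck_comp_lin _ _ _ _ _ _ fst _ oT l1); last exact: Ck_fst.
  exact: mx_linear_continuous.
apply: (@Ck_comp_lin _ _ _ _ _ _ snd _ oT l2); last exact: Ck_snd.
exact: mx_linear_continuous.
Qed.

End MatrixExpDiff.

(** * Symmetric matrices *)

Section Spectral.
Import complex.
Context {R : realType}.

Lemma dotE n (x y : 'rV[R]_n) : (x *m y^T) 0 0 = \sum_i x 0 i * y 0 i.
Proof. by rewrite mxE; apply: eq_bigr => i _; rewrite mxE. Qed.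

Lemma dot_ge0 n (x : 'rV[R]_n) : 0 <= (x *m x^T) 0 0.
Proof. by rewrite dotE sumr_ge0 // => i _; rewrite -expr2 sqr_ge0. Qed.

Lemma dot_eq0 n (x : 'rV[R]_n) : (x *m x^T) 0 0 = 0 -> x = 0.
Proof.
rewrite dotE => /eqP; rewrite psumr_eq0 => [/allP h|i _]; last first.
  by rewrite -expr2 sqr_ge0.
apply/rowP => i; rewrite mxE; apply/eqP.
have := h i; rewrite mem_index_enum => /(_ isT) /=.
by rewrite -expr2 sqrf_eq0.
Qed.

Lemma sym_eigenvector n (A : 'M[R]_n.+1) : A^T = A ->
  exists a, exists2 u : 'rV[R]_n.+1, u != 0 & u *m A = a *: u.
Proof.
move=> sA; pose f := real_complex R.
have [a /eigenvalueP[v vA v0]] := eigenvalue_closed (map_mx f A) (ltn0Sn n).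
pose p : 'rV[R]_n.+1 := map_mx (@complex.Re R) v.
pose q : 'rV[R]_n.+1 := map_mx (@complex.Im R) v.
have pA : p *m A = complex.Re a *: p - complex.Im a *: q.
  apply/rowP => j; have /rowP/(_ j) := vA; rewrite !mxE => /(congr1 (@complex.Re R)).
  rewrite raddf_sum /= => h.
  transitivity (\sum_i complex.Re (v 0 i * map_mx f A i j)).
    apply: eq_bigr => i _; rewrite !mxE /=; case: (v 0 i) => x y /=.
    by rewrite mulr0 subr0.
  by rewrite h; case: (a) => x y; case: (v 0 j).
have qA : q *m A = complex.Im a *: p + complex.Re a *: q.
  apply/rowP => j; have /rowP/(_ j) := vA; rewrite !mxE => /(congr1 (@complex.Im R)).
  rewrite raddf_sum /= => h.
  transitivity (\sum_i complex.Im (v 0 i * map_mx f A i j)).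
    apply: eq_bigr => i _; rewrite !mxE /=; case: (v 0 i) => x y /=.
    by rewrite mulr0 add0r.
  by rewrite h addrC; case: (a) => x y; case: (v 0 j).
have pq0 : ~ (p = 0 /\ q = 0).
  move=> [/rowP p0 /rowP q0]; move/eqP: v0; apply; apply/rowP => j.
  by have := p0 j; have := q0 j; rewrite !mxE; case: (v 0 j) => x y /= -> ->.
have tr00 (M : 'M[R]_1) : M^T 0 0 = M 0 0 by rewrite mxE.
(* Symmetry of [A] equates these two numbers; expanding them by [pA] and [qA] leaves [Im a] times
   the sum of the squared lengths of [p] and [q], which is positive. So the eigenvalue is real, and
   [p] or [q] is a real eigenvector. *)
have pqE : (p *m A *m q^T) 0 0 = (q *m A *m p^T) 0 0.
  by rewrite -tr00 !trmx_mul trmxK sA mulmxA.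
have Im0 : complex.Im a = 0.
  move: pqE; rewrite pA qA mulmxBl mulmxDl -!scalemxAl.
  rewrite ![((_ + _) : 'M[R]_1) 0 0]mxE ![(- _ : 'M[R]_1) 0 0]mxE.
  rewrite ![(_ *: _ : 'M[R]_1) 0 0]mxE.
  have -> : (q *m p^T) 0 0 = (p *m q^T) 0 0 by rewrite -tr00 trmx_mul trmxK.
  move=> h; have : complex.Im a * ((p *m p^T) 0 0 + (q *m q^T) 0 0) = 0 by lra.
  move/eqP; rewrite mulf_eq0 => /orP[/eqP //|].
  rewrite paddr_eq0 ?dot_ge0 // => /andP[/eqP/dot_eq0 p0 /eqP/dot_eq0 q0].
  by case: pq0.
move: pA qA; rewrite Im0 !scale0r subr0 add0r => pA qA.
exists (complex.Re a); have [p0|p0] := eqVneq p 0; last by exists p.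
by exists q => //; apply/eqP => q0; case: pq0.
Qed.

(** For [e != u] take the reflection in the hyperplane orthogonal to [e - u], which exchanges two
    vectors of equal length. It stands in for completing [u] to an orthonormal basis. *)
Lemma householder n (u : 'rV[R]_n) (e : 'rV[R]_n) :
  u *m u^T = 1 -> e *m e^T = 1 ->
  exists2 H : 'M[R]_n, H *m H^T = 1%:M & e *m H = u.
Proof.
move=> uu ee; have [<-|ue] := eqVneq e u.
  by exists 1%:M; rewrite ?mulmx1 ?trmx1 ?mulmx1.
pose w := e - u; pose s := (w *m w^T) 0 0.
have s0 : s != 0 by apply/eqP => /dot_eq0 /eqP; rewrite subr_eq0 (negbTE ue).
have wwE : w *m w^T = s%:M by rewrite [LHS]mx11_scalar.
pose K := w^T *m w.
have KK : K *m K = s *: K.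
  by rewrite /K mulmxA -[w^T *m w *m _]mulmxA wwE mul_mx_scalar scalemxAl.
pose H : 'M[R]_n := 1%:M - (2 / s) *: K.
have HT : H^T = H by rewrite /H linearB linearZ /= trmx1 trmx_mul trmxK.
have euE : u *m e^T = e *m u^T.
  by rewrite -[LHS]trmxK trmx_mul trmxK [LHS]mx11_scalar mxE -mx11_scalar.
have sE : s = 2 - 2 * (e *m u^T) 0 0.
  rewrite /s /w linearB /= mulmxBr !mulmxBl uu ee euE.
  by rewrite !mxE eqxx /=; ring.
exists H.
  rewrite HT /H mulmxBr mulmx1 mulmxBl mul1mx -scalemxAl -scalemxAr KK !scalerA.
  have -> : 2 / s * (2 / s) * s = 2 / s + 2 / s by field.
  by rewrite scalerDl opprB addrK subrK.
rewrite /H mulmxBr mulmx1 -scalemxAr /K mulmxA.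
have -> : e *m w^T = (s / 2)%:M.
  rewrite [LHS]mx11_scalar; congr (_%:M); rewrite sE /w linearB /= mulmxBr ee.
  by rewrite !mxE eqxx /=; field.
rewrite mul_scalar_mx scalerA mulrA divfK // divff ?pnatr_eq0 // scale1r.
by rewrite /w opprB addrC subrK.
Qed.

(** Deflation: conjugating by an orthogonal matrix that carries the first basis vector to a unit
    eigenvector makes the first row of [B] equal to [(a, 0)]; symmetry clears the first column, and
    the remaining block is diagonalised by induction. *)
Lemma sym_spectral n (A : 'M[R]_n) : A^T = A ->
  exists (P : 'M[R]_n) (d : 'rV[R]_n),
    [/\ P *m P^T = 1%:M, P^T *m P = 1%:M & A = P^T *m diag_mx d *m P].
Proof.
elim: n A => [|n IH] A sA.
  by exists 1%:M, 0; split; apply/matrixP => -[].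
have [a [v v0 vA]] := sym_eigenvector sA.
pose s := Num.sqrt ((v *m v^T) 0 0).
have s0 : 0 < s.
  rewrite sqrtr_gt0 lt_neqAle dot_ge0 andbT eq_sym.
  by apply: contra v0 => /eqP/dot_eq0/eqP.
pose u := s^-1 *: v.
have uu : u *m u^T = 1.
  rewrite /u linearZ /= -scalemxAr -scalemxAl scalerA -invfM -expr2.
  rewrite sqr_sqrtr ?dot_ge0 // [X in _ *: X]mx11_scalar scale_scalar_mx mulVf //.
  by apply: contra v0 => /eqP/dot_eq0/eqP.
have uA : u *m A = a *: u by rewrite -scalemxAl vA !scalerA mulrC.
pose e : 'rV[R]_(1 + n) := row_mx 1 0.
have ee : e *m e^T = 1.
  by rewrite tr_row_mx mul_row_col trmx0 mulmx0 addr0 trmx1 mulmx1.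
have [H HH eH] := @householder (1 + n) u e uu ee.
have HH' : H^T *m H = 1%:M by rewrite mulmx1C.
pose B : 'M[R]_(1 + n) := H *m A *m H^T.
have sB : B^T = B by rewrite /B !trmx_mul trmxK sA mulmxA.
have eB : e *m B = a *: e.
  by rewrite /B !mulmxA eH uA -scalemxAl -eH -mulmxA HH mulmx1.
have BE : B = block_mx a%:M 0 0 (drsubmx B).
  have := eB; rewrite -{1}[B]submxK mul_row_block !mul1mx !mul0mx !addr0.
  rewrite scale_row_mx scaler0 => /eq_row_mx[h1 h2].
  have h3 : dlsubmx B = 0 by rewrite -[LHS]trmxK trmx_dlsub sB h2 trmx0.
  by rewrite -[LHS]submxK h1 h2 h3 scalemx1.
have [P' [d' [PP PP' dB]]] := IH (drsubmx B) (etrans (trmx_drsub B) (congr1 _ sB)).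
pose P : 'M[R]_(1 + n) := block_mx 1%:M 0 0 P' *m H.
exists P, (row_mx a%:M d').
have QT : (block_mx 1%:M 0 0 P' : 'M[R]_(1 + n))^T = block_mx 1%:M 0 0 P'^T.
  by rewrite tr_block_mx !trmx0 trmx1.
have QQ : block_mx 1%:M 0 0 P' *m (block_mx 1%:M 0 0 P' : 'M[R]_(1 + n))^T = 1%:M.
  rewrite QT mulmx_block !mulmx0 !mul0mx !addr0 add0r mulmx1 PP.
  by rewrite -scalar_mx_block.
have PPT : P *m P^T = 1%:M.
  by rewrite /P trmx_mul mulmxA -[_ *m H *m H^T]mulmxA HH mulmx1 QQ.
split => //; first exact: mulmx1C.
have AB : A = H^T *m B *m H by rewrite /B !mulmxA HH' mul1mx -mulmxA HH' mulmx1.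
have E : block_mx a%:M 0 0 (P'^T *m diag_mx d' *m P') =
    (block_mx 1%:M 0 0 P' : 'M[R]_(1 + n))^T *m
      @diag_mx R (1 + n) (row_mx a%:M d') *m block_mx 1%:M 0 0 P'.
  rewrite diag_mx_row QT !mulmx_block !mulmx0 !mul0mx !addr0 !add0r.
  rewrite !mul1mx !mulmx1; congr (block_mx _ _ _ _); last by rewrite mul0mx.
  by rewrite [LHS]mx11_scalar [RHS]mx11_scalar !mxE !eqxx.
apply: (etrans AB); by rewrite BE {1}dB E /P trmx_mul !mulmxA.
Qed.

End Spectral.

(** * Functional calculus, trace inequalities and the logarithm *)

Section SpectralCalculus.
Context {R : realType}.

Definition specmx n (P : 'M[R]_n) (d : 'rV[R]_n) := P^T *m diag_mx d *m P.

Lemma expm_conj n (P D : 'M[R]_n) : P *m P^T = 1%:M ->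
  expm (P^T *m D *m P) = P^T *m expm D *m P.
Proof.
move=> PP; have PP' := mulmx1C PP.
apply: (expm_transfer (f := id) (g := fun M => P^T *m M *m P)) => //.
  by move=> a X Y; rewrite mulmxDr mulmxDl -scalemxAr -scalemxAl.
elim=> [|k IH]; first by rewrite !expr0 mulmx1.
by rewrite !exprS -!mulmxE IH -!mulmxA [P *m (P^T *m _)]mulmxA PP mul1mx.
Qed.

Lemma diag_mxX n (d : 'rV[R]_n) k : diag_mx d ^+ k = diag_mx (map_mx (fun x => x ^+ k) d).
Proof.
elim: k => [|k IH].
  by rewrite expr0; apply/matrixP => i j; rewrite !mxE expr0.
rewrite exprS IH -mulmxE mulmx_diag; apply/matrixP => i j; rewrite !mxE exprS.
by case: eqP => [->|].
Qed.

Lemma expm_diag n (d : 'rV[R]_n) : expm (diag_mx d) = diag_mx (map_mx expR d).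
Proof.
apply/matrixP => i j; rewrite expmE !mxE.
have -> : (fun k => expm_coeff (diag_mx d) k i j) =
    if i == j then exp_coeff (d 0 i) else fun=> 0.
  apply/funext => k; rewrite /expm_coeff diag_mxX !mxE.
  by case: eqP => [->|_]; rewrite ?mulr1n ?mulr0n ?mulr0 // mulrC.
case: eqP => [->|_]; first by rewrite mulr1n.
rewrite mulr0n; apply: cvg_lim => //.
have -> : series (fun=> 0) = (fun=> 0 : R).
  by apply/funext => N; rewrite /series /= big1.
exact: cvg_cst.
Qed.

Lemma expm_spec n (P : 'M[R]_n) d : P *m P^T = 1%:M ->
  expm (specmx P d) = specmx P (map_mx expR d).
Proof. by move=> PP; rewrite /specmx expm_conj // expm_diag. Qed.

Lemma specmx_sym n (P : 'M[R]_n) d : (specmx P d)^T = specmx P d.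
Proof. by rewrite /specmx !trmx_mul trmxK tr_diag_mx mulmxA. Qed.

Lemma specmxM n (P : 'M[R]_n) a b : P *m P^T = 1%:M ->
  specmx P a *m specmx P b = specmx P (\row_i (a 0 i * b 0 i)).
Proof.
move=> PP; rewrite /specmx -!mulmxA [P *m (P^T *m _)]mulmxA PP mul1mx.
rewrite [diag_mx a *m (_ *m _)]mulmxA mulmx_diag; congr (_ *m (diag_mx _ *m _)).
Qed.

Lemma specmx1 n (P : 'M[R]_n) : P *m P^T = 1%:M -> specmx P (const_mx 1) = 1%:M.
Proof. by move=> PP; rewrite /specmx diag_const_mx mulmx1 (mulmx1C PP). Qed.

Lemma specmx_quad n (P : 'M[R]_n) d (x : 'cV[R]_n) :
  (x^T *m specmx P d *m x) 0 0 = \sum_i d 0 i * ((P *m x) i 0) ^+ 2.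
Proof.
have -> : x^T *m specmx P d *m x = (P *m x)^T *m diag_mx d *m (P *m x).
  by rewrite /specmx trmx_mul !mulmxA.
rewrite mxE; apply: eq_bigr => i _.
rewrite mul_mx_diag !mxE; ring.
Qed.

Lemma sq_quad n (P : 'M[R]_n) (x : 'cV[R]_n) : P *m P^T = 1%:M ->
  (x^T *m x) 0 0 = \sum_i ((P *m x) i 0) ^+ 2.
Proof.
move=> PP; have := specmx_quad P (const_mx 1) x; rewrite specmx1 // mulmx1 => ->.
by apply: eq_bigr => i _; rewrite mxE mul1r.
Qed.

Lemma specmx_eigen n (P : 'M[R]_n) d i : P *m P^T = 1%:M ->
  exists2 x : 'cV[R]_n, (x^T *m x) 0 0 = 1 & (x^T *m specmx P d *m x) 0 0 = d 0 i.
Proof.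
move=> PP; exists (P^T *m delta_mx i 0).
  rewrite (sq_quad _ PP) mulmxA PP mul1mx (bigD1 i) //= big1 ?addr0.
    by rewrite mxE !eqxx expr1n.
  by move=> j ji; rewrite mxE (negbTE ji) /= expr0n.
rewrite specmx_quad mulmxA PP mul1mx (bigD1 i) //= big1 ?addr0.
  by rewrite mxE !eqxx expr1n mulr1.
by move=> j ji; rewrite mxE (negbTE ji) /= expr0n mulr0.
Qed.

Lemma tr_specmx n (P Q : 'M[R]_n) a b :
  \tr (specmx P a *m specmx Q b) =
    \sum_i \sum_j ((P *m Q^T) i j) ^+ 2 * (a 0 i * b 0 j).
Proof.
rewrite /specmx -!mulmxA mxtrace_mulC !mulmxA -[_ *m P *m Q^T]mulmxA.
set U := P *m Q^T; have -> : diag_mx a *m U *m diag_mx b *m Q *m P^T =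
  (diag_mx a *m U) *m (diag_mx b *m U^T).
  by rewrite /U trmx_mul trmxK !mulmxA.
rewrite /mxtrace; apply: eq_bigr => i _; rewrite mxE; apply: eq_bigr => j _.
by rewrite mul_diag_mx mul_diag_mx !mxE; ring.
Qed.

Lemma frobenius_ge0 n (A : 'M[R]_n) : A^T = A -> 0 <= \tr (A *m A).
Proof.
move=> sA; rewrite -{1}sA /mxtrace sumr_ge0 // => i _; rewrite mxE sumr_ge0 // => j _.
by rewrite mxE -expr2 sqr_ge0.
Qed.

Lemma frobenius_eq0 n (A : 'M[R]_n) : A^T = A -> \tr (A *m A) <= 0 -> A = 0.
Proof.
move=> sA; rewrite -{1}sA => h; apply/matrixP => i j; rewrite mxE.
have F0 k : 0 <= (A^T *m A) k k.
  by rewrite mxE sumr_ge0 // => l _; rewrite mxE -expr2 sqr_ge0.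
have /eqP : \tr (A^T *m A) = 0.
  by apply/eqP; rewrite eq_le h sumr_ge0.
rewrite /mxtrace psumr_eq0 // => /allP/(_ j); rewrite mem_index_enum => /(_ isT) /=.
rewrite mxE psumr_eq0 => [|k _]; last by rewrite mxE -expr2 sqr_ge0.
move/allP/(_ i); rewrite mem_index_enum => /(_ isT) /=.
by rewrite mxE -expr2 sqrf_eq0 => /eqP.
Qed.

Lemma expR_tangent (a b : R) : expR a * (b - a) <= expR b - expR a.
Proof.
have : expR a * (1 + (b - a)) <= expR b.
  by rewrite -[X in _ <= expR X](subrK a b) expRD mulrC ler_wpM2r ?expR_ge0 // expR_ge1Dx.
by rewrite mulrDr mulr1 lerBrDl.
Qed.

(** The exponential lies above its tangent at the smaller of the two points, where the slope is at
    least [c]. *)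
Lemma expR_mono (a b c : R) : c <= expR a -> c <= expR b ->
  c * (a - b) ^+ 2 <= (expR a - expR b) * (a - b).
Proof.
wlog : a b / b <= a => [hw ca cb|ba ca cb].
  have [ba|/ltW ab] := leP b a; first exact: hw.
  have := hw b a ab cb ca; rewrite -sqrrN opprB => /le_trans; apply.
  by rewrite le_eqVlt; apply/orP; left; apply/eqP; ring.
rewrite expr2 mulrA ler_wpM2r ?subr_ge0 //.
apply: le_trans (expR_tangent b a).
by rewrite ler_wpM2r ?subr_ge0.
Qed.

(** Inserting the identity as [specmx Q (const_mx 1)] gives a trace that involves one eigenbasis the
    same double weights as the mixed traces, so that inequalities can be compared term by term. *)
Lemma tr_specmxl n (P Q : 'M[R]_n) a : Q *m Q^T = 1%:M ->
  \tr (specmx P a) = \sum_i \sum_j ((P *m Q^T) i j) ^+ 2 * a 0 i.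
Proof.
move=> QQ; rewrite -[specmx P a]mulmx1 -(specmx1 QQ) tr_specmx.
by apply: eq_bigr => i _; apply: eq_bigr => j _; rewrite !mxE mulr1.
Qed.

Lemma tr_specmxr n (P Q : 'M[R]_n) b : P *m P^T = 1%:M ->
  \tr (specmx Q b) = \sum_i \sum_j ((P *m Q^T) i j) ^+ 2 * b 0 j.
Proof.
move=> PP; rewrite -[specmx Q b]mul1mx -(specmx1 PP) tr_specmx.
by apply: eq_bigr => i _; apply: eq_bigr => j _; rewrite !mxE mul1r.
Qed.

Lemma tr_specmxB n (P Q : 'M[R]_n) a a' b b' :
  P *m P^T = 1%:M -> Q *m Q^T = 1%:M ->
  \tr ((specmx P a' - specmx Q b') *m (specmx P a - specmx Q b)) =
  \sum_i \sum_j ((P *m Q^T) i j) ^+ 2 * ((a' 0 i - b' 0 j) * (a 0 i - b 0 j)).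
Proof.
move=> PP QQ.
have -> : (specmx P a' - specmx Q b') *m (specmx P a - specmx Q b) =
    specmx P a' *m specmx P a - specmx P a' *m specmx Q b
    - (specmx Q b' *m specmx P a - specmx Q b' *m specmx Q b).
  by rewrite mulmxBl !mulmxBr.
rewrite !linearB /= !specmxM // (tr_specmxl _ _ QQ) ?(tr_specmxr _ _ PP) //.
rewrite [\tr (specmx Q b' *m _)]mxtrace_mulC !tr_specmx.
rewrite opprK [- _ + _]addrC -!sumrB -big_split; apply: eq_bigr => i _ /=.
rewrite -!sumrB -big_split; apply: eq_bigr => j _ /=.
by rewrite !mxE; ring.
Qed.

(* Writing A and B in orthonormal eigenbases, both sides become sums weighted by
   the squared entries of the change of basis, which reduces the claim to the
   scalar inequality expR_mono; expm_klein is proved in the same way. *)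
Lemma expm_strong_mono n (A B : 'M[R]_n) (c : R) : A^T = A -> B^T = B ->
  (forall x : 'cV[R]_n, c * (x^T *m x) 0 0 <= (x^T *m expm A *m x) 0 0) ->
  (forall x : 'cV[R]_n, c * (x^T *m x) 0 0 <= (x^T *m expm B *m x) 0 0) ->
  c * \tr ((A - B) *m (A - B)) <= \tr ((expm A - expm B) *m (A - B)).
Proof.
move=> /sym_spectral[P [a [PP _ ->]]] /sym_spectral[Q [b [QQ _ ->]]].
rewrite -!/(specmx _ _) !expm_spec // => cA cB.
have ca i : c <= expR (a 0 i).
  have [x x1 xE] := specmx_eigen (map_mx expR a) i PP.
  by have := cA x; rewrite x1 xE mulr1 mxE.
have cb i : c <= expR (b 0 i).
  have [x x1 xE] := specmx_eigen (map_mx expR b) i QQ.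
  by have := cB x; rewrite x1 xE mulr1 mxE.
rewrite !tr_specmxB // mulr_sumr; apply: ler_sum => i _.
rewrite mulr_sumr; apply: ler_sum => j _.
rewrite mulrCA ler_wpM2l ?sqr_ge0 // -expr2 !mxE.
exact: expR_mono.
Qed.

(** Klein's inequality, the tangent form of the convexity of [tr exp]. Existence of the diagonal
    correction and the bound on its size both come from it. *)
Lemma expm_klein n (A B : 'M[R]_n) : A^T = A -> B^T = B ->
  \tr (expm A *m (B - A)) <= \tr (expm B) - \tr (expm A).
Proof.
move=> /sym_spectral[P [a [PP _ ->]]] /sym_spectral[Q [b [QQ _ ->]]].
rewrite -!/(specmx _ _) !expm_spec // mulmxBr linearB /= specmxM // tr_specmx.
rewrite ![\tr (specmx P _)](tr_specmxl _ _ QQ) (tr_specmxr _ _ PP) -!sumrB; apply: ler_sum => i _.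
rewrite -!sumrB; apply: ler_sum => j _.
rewrite -!mulrBr ler_wpM2l ?sqr_ge0 // !mxE -mulrBr.
exact: expR_tangent.
Qed.

Lemma expm_sym n (A : 'M[R]_n) : A^T = A -> (expm A)^T = expm A.
Proof.
by move=> /sym_spectral[P [a [PP _ ->]]]; rewrite -/(specmx _ _) expm_spec // specmx_sym.
Qed.

(** An eigenvalue is the value of the quadratic form at a unit vector, whose entries are at most 1;
    each of the two matrix products costs a factor [n]. *)
Lemma spec_bound n (P : 'M[R]_n) d i r : P *m P^T = 1%:M ->
  `|specmx P d| <= r -> `|d 0 i| <= n%:R * (n%:R * r).
Proof.
move=> PP Ar; have [x x1 <-] := specmx_eigen d i PP.
have xk k : `|x k 0| <= 1.
  rewrite -(expr_le1 (n := 2)) // real_normK ?num_real // -x1 mxE.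
  rewrite (bigD1 k) //= mxE -expr2 lerDl sumr_ge0 // => j _.
  by rewrite mxE -expr2 sqr_ge0.
have r0 : 0 <= r by exact: le_trans Ar.
have nx : `|x| <= 1 by apply: mxnorm_le => // k j; rewrite ord1.
have nxT : `|x^T| <= 1 by apply: mxnorm_le => // k j; rewrite mxE ord1.
rewrite (le_trans (mxnorm_ge _ _ _)) // (le_trans (mxnormM _ _)) //.
rewrite -mulrA ler_wpM2l // -[leRHS]mulr1 ler_pM //.
rewrite (le_trans (mxnormM _ _)) // -mulrA ler_wpM2l //.
by rewrite -[leRHS]mul1r ler_pM.
Qed.

(** By [spec_bound] all eigenvalues are at least [- (n * (n * r))]. The point is uniformity: one [c]
    serves a whole ball, as needed to compare nearby matrices. *)
Lemma expm_lower n (r : R) : exists2 c, 0 < c &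
  forall A : 'M[R]_n, A^T = A -> `|A| <= r ->
  forall x : 'cV[R]_n, c * (x^T *m x) 0 0 <= (x^T *m expm A *m x) 0 0.
Proof.
exists (expR (- (n%:R * (n%:R * r)))); first exact: expR_gt0.
move=> A /sym_spectral[P [a [PP _ ->]]]; rewrite -!/(specmx _ _) expm_spec // => Ar x.
rewrite specmx_quad (sq_quad _ PP) mulr_sumr; apply: ler_sum => i _.
rewrite ler_wpM2r ?sqr_ge0 // mxE ler_expR lerNl.
have := spec_bound i PP Ar; rewrite ler_norml => /andP[+ _]; lra.
Qed.

Lemma expm_inj n (A B : 'M[R]_n) : A^T = A -> B^T = B -> expm A = expm B -> A = B.
Proof.
move=> sA sB AB; pose r := Num.max `|A| `|B|.
have [c c0 cP] := expm_lower n r.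
have Ar : `|A| <= r by rewrite le_max lexx.
have Br : `|B| <= r by rewrite le_max lexx orbT.
have := expm_strong_mono sA sB (cP _ sA Ar) (cP _ sB Br).
rewrite AB subrr mul0mx linear0 pmulr_rle0 // => h.
by apply/subr0_eq/frobenius_eq0 => //; rewrite linearB /= sA sB.
Qed.

Lemma SymPD_of_lower n (Y : 'M[R]_n) c : Y^T = Y -> 0 < c ->
  (forall x : 'cV[R]_n, c * (x^T *m x) 0 0 <= (x^T *m Y *m x) 0 0) -> SymPD n Y.
Proof.
move=> sY c0 cP; split => // x x0; apply: lt_le_trans (cP x); rewrite mulr_gt0 //.
rewrite -[x in x *m _]trmxK -[x in _ *m x]trmxK lt_neqAle eq_sym.
have := dot_ge0 x^T; rewrite trmxK => ->; rewrite andbT.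
apply: contra x0 => /eqP h; rewrite -[x]trmxK (@dot_eq0 _ _ x^T) ?trmx0 //.
by rewrite trmxK.
Qed.

Lemma expm_SymPD n (A : 'M[R]_n) : Sym n A -> SymPD n (expm A).
Proof.
move=> sA; have [c c0 cP] := expm_lower n `|A|.
exact: SymPD_of_lower (expm_sym sA) c0 (cP _ sA (lexx _)).
Qed.

Lemma expm_surj n (X : 'M[R]_n) : SymPD n X -> exists2 A, Sym n A & expm A = X.
Proof.
move=> [/sym_spectral[P [d [PP _ ->]]] pX]; rewrite -/(specmx _ _) in pX *.
have d0 i : 0 < d 0 i.
  have [x x1 <-] := specmx_eigen d i PP; apply: pX.
  by apply/eqP => x0; move: x1; rewrite x0 mulmx0 mxE => /eqP; rewrite eq_sym oner_eq0.
exists (specmx P (map_mx (@ln R) d)); first exact: specmx_sym.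
rewrite expm_spec //; congr (specmx _ _); apply/rowP => i.
by rewrite !mxE lnK ?posrE.
Qed.

Lemma logmK n (A : 'M[R]_n) : Sym n A -> logm (expm A) = A.
Proof.
move=> sA; rewrite /logm pinvKV ?inE // => {sA} {A} A B /set_mem sA /set_mem sB.
exact: expm_inj.
Qed.

Lemma logm_sym n (X : 'M[R]_n) : SymPD n X -> Sym n (logm X).
Proof. by move=> /expm_surj[A sA <-]; rewrite logmK. Qed.

Lemma expmK n (X : 'M[R]_n) : SymPD n X -> expm (logm X) = X.
Proof. by move=> /expm_surj[A sA <-]; rewrite logmK. Qed.

End SpectralCalculus.

(** * Directional derivatives along lines *)

Section LineDerivative.
Context {R : realType}.
Implicit Types E F : normedModType R.

(** A directional derivative sees only the values on a line. This is what lets a map on a slice be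
    exchanged for an extension to an open set, in tangent directions. *)
Lemma near_line_derive E F (f g : E -> F) x v :
  (\forall h \near (0 : R), f (h *: v + x) = g (h *: v + x)) ->
  derivable f x v -> derivable g x v /\ 'D_v g x = 'D_v f x.
Proof.
move=> fg df; have fgx : f x = g x.
  by have := nbhs_singleton fg; rewrite scale0r add0r.
have h : (fun h : R => h^-1 *: (f (h *: v + x) - f x)) @ 0^' --> 'D_v f x by exact: df.
have {}h : (fun h : R => h^-1 *: (g (h *: v + x) - g x)) @ 0^' --> 'D_v f x.
  apply: cvg_trans h; apply: near_eq_cvg; apply: nbhs_dnbhs.
  by apply: filterS fg => t; rewrite fgx => ->.
by split; [apply/cvg_ex; exists ('D_v f x)|apply: cvg_lim].
Qed.

Lemma derive_linear E F (W : normedModType R) (f : E -> F) (L : F -> W) x v :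
  linear L -> continuous L -> derivable f x v ->
  derivable (L \o f) x v /\ 'D_v (L \o f) x = L ('D_v f x).
Proof.
move=> lL cL df; pose M := GRing.isLinear.Build _ _ _ _ _ lL.
pose L' : {linear F -> W} := HB.pack L M.
have h : (fun h : R => h^-1 *: (f (h *: v + x) - f x)) @ 0^' --> 'D_v f x by exact: df.
have {}h : (fun h : R => h^-1 *: ((L \o f) (h *: v + x) - (L \o f) x)) @ 0^'
    --> L ('D_v f x).
  have -> : (fun h : R => h^-1 *: ((L \o f) (h *: v + x) - (L \o f) x)) =
      L \o (fun h : R => h^-1 *: (f (h *: v + x) - f x)).
    by apply/funext => t /=; rewrite -[RHS]/(L' _) linearZ (linearB L').
  by apply: cvg_comp; [exact: h|exact: cL].
by split; [apply/cvg_ex; exists (L ('D_v f x))|apply: cvg_lim].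
Qed.

Lemma continuous_dist E F (f : E -> F) x :
  (forall e : R, 0 < e -> \forall y \near x, `|f x - f y| <= e) ->
  {for x, continuous f}.
Proof. by move=> h; apply/cvgrPdist_le => e e0; exact: h. Qed.

Lemma near0_line E (P : set E) (x v : E) :
  nbhs x P -> \forall h \near (0 : R), P (h *: v + x).
Proof.
move=> Px; have h : (fun h : R => h *: v + x) @ (0 : R) --> x.
  suff : h *: v + x @[h --> (0 : R)] --> 0 *: v + x by rewrite scale0r add0r.
  by apply: cvgD; [exact: scalel_continuous|exact: cvg_cst].
exact: h.
Qed.

End LineDerivative.

(** * Coercivity estimates and the derivative of the exponential *)

Section MatrixBounds.
Context {R : realType}.

(** Finite dimension: the matrix of [L] on vectorised arguments is square with trivial kernel.
    Coercivity thereby yields the surjectivity that [Ck_implicit] asks for. *)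
Lemma mx_inj_surj m n (L : {linear 'M[R]_(m, n) -> 'M[R]_(m, n)}) :
  (forall V, L V = 0 -> V = 0) -> forall W, exists V, L V = W.
Proof.
move=> injL W; pose M := lin_mx L.
have Mfree : row_free M.
  rewrite -kermx_eq0; apply/eqP/row_matrixP => i; rewrite row0.
  have : row i (kermx M) *m M = 0 by apply/eqP; rewrite -sub_kermx row_sub.
  rewrite -[row i _]vec_mxK mul_vec_lin => h.
  have {}h : L (vec_mx (row i (kermx M))) = 0 by apply: (can_inj mxvecK); rewrite h linear0.
  by rewrite (injL _ h) linear0.
have /row_fullP[N NM] : row_full M by rewrite row_full_unit -row_free_unit.
exists (vec_mx (mxvec W *m N)); apply: (can_inj mxvecK).
by rewrite -mul_vec_lin vec_mxK -mulmxA NM mulmx1.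
Qed.

Lemma tr_norm n (M : 'M[R]_n) : `|\tr M| <= n%:R * `|M|.
Proof.
rewrite /mxtrace (le_trans (ler_norm_sum _ _ _)) //.
rewrite (le_trans (y := \sum_(k < n) `|M|)) //.
  by apply: ler_sum => k _; rewrite mxnorm_ge.
by rewrite sumr_const card_ord -[leLHS]mulr_natl.
Qed.

Lemma trM_norm n (M N : 'M[R]_n) : \tr (M *m N) <= n%:R * n%:R * `|M| * `|N|.
Proof.
rewrite (le_trans (ler_norm _)) // (le_trans (tr_norm _)) // -!mulrA ler_wpM2l //.
by rewrite mulrA mxnormM.
Qed.

Lemma mxnorm_sq_tr n (M : 'M[R]_n) : M^T = M -> `|M| ^+ 2 <= \tr (M *m M).
Proof.
move=> sM.
have T0 : 0 <= \tr (M *m M) by exact: frobenius_ge0.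
rewrite -[leRHS]sqr_sqrtr // ler_pXn2r ?nnegrE ?sqrtr_ge0 //.
apply: mxnorm_le => [|i j]; first exact: sqrtr_ge0.
rewrite -sqrtr_sqr ler_sqrt //.
have -> : \tr (M *m M) = \sum_k \sum_l M k l ^+ 2.
  apply: eq_bigr => k _; rewrite mxE; apply: eq_bigr => l _.
  by rewrite expr2 -[in X in _ * X]sM mxE.
rewrite (bigD1 i) //= (bigD1 j) //= -addrA lerDl addr_ge0 //.
  by apply: sumr_ge0 => k _; exact: sqr_ge0.
by apply: sumr_ge0 => k _; apply: sumr_ge0 => l _; exact: sqr_ge0.
Qed.

(** Chain [c * |V| ^+ 2 <= c * \tr (V *m V) <= \tr (S *m V) <= n * n * |S| * |V|] and cancel
    [|V|]. *)
Lemma coercive_bound n (V S : 'M[R]_n) c : V^T = V ->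
  c * \tr (V *m V) <= \tr (S *m V) -> 0 < c -> c * `|V| <= n%:R * n%:R * `|S|.
Proof.
move=> sV h c0; have [->|V0] := eqVneq V 0.
  by rewrite normr0 mulr0 !mulr_ge0.
have nV : 0 < `|V| by rewrite normr_gt0.
rewrite -(ler_pM2r nV) -[c * _ * _]mulrA.
apply: le_trans _ (trM_norm S V); apply: le_trans _ h; rewrite ler_pM2l //.
by apply: le_trans _ (mxnorm_sq_tr sV); rewrite expr2.
Qed.

Lemma quad_bound n (M : 'M[R]_n) (x : 'cV[R]_n) :
  `|(x^T *m M *m x) 0 0| <= n%:R * `|M| * (x^T *m x) 0 0.
Proof.
rewrite -mulmxA mxE.
have -> : \sum_j x^T 0 j * (M *m x) j 0 = \sum_j \sum_k x j 0 * M j k * x k 0.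
  apply: eq_bigr => j _; rewrite !mxE mulr_sumr; apply: eq_bigr => k _.
  by rewrite mulrA.
rewrite (le_trans (ler_norm_sum _ _ _)) //.
apply: (@le_trans _ _ (\sum_j \sum_k `|M| * ((x j 0 ^+ 2 + x k 0 ^+ 2) / 2))).
  apply: ler_sum => j _; rewrite (le_trans (ler_norm_sum _ _ _)) //.
  apply: ler_sum => k _; rewrite !normrM mulrAC mulrC ler_pM ?mulr_ge0 ?mxnorm_ge //.
  rewrite -(real_normK (num_real (x j 0))) -(real_normK (num_real (x k 0))).
  have := sqr_ge0 (`|x j 0| - `|x k 0|); rewrite sqrrB; lra.
under eq_bigr do rewrite -mulr_sumr; rewrite -mulr_sumr [n%:R * _]mulrC -mulrA.
rewrite ler_wpM2l //.
have -> : (x^T *m x) 0 0 = \sum_j x j 0 ^+ 2.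
  by rewrite mxE; apply: eq_bigr => j _; rewrite mxE.
set s := \sum_j x j 0 ^+ 2.
have -> : \sum_(i < n) \sum_(k < n) (x i 0 ^+ 2 + x k 0 ^+ 2) / 2 =
    \sum_(i < n) (n%:R * x i 0 ^+ 2 + s) / 2.
  apply: eq_bigr => i _; rewrite -mulr_suml big_split /= sumr_const card_ord.
  by rewrite -[X in X + _]mulr_natl.
rewrite -mulr_suml big_split /= -mulr_sumr -/s sumr_const card_ord -[X in _ + X]mulr_natl.
lra.
Qed.

Lemma tr_mulr_linear n (V : 'M[R]_n) : linear (fun M : 'M[R]_n => \tr (M *m V) : R^o).
Proof. by move=> a X Y; rewrite mulmxDl -scalemxAl linearP. Qed.

(** The infinitesimal form of [expm_strong_mono]: apply it to [h *: V + A] and [A], divide by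
    [h ^+ 2] and let [h] tend to 0. The radius [r + 1] leaves room for the perturbed matrix. *)
Lemma dexpm_mono n (r : R) : exists2 c, 0 < c &
  forall A V : 'M[R]_n, A^T = A -> V^T = V -> `|A| <= r ->
    c * \tr (V *m V) <= \tr ('D_V (@expm R n) A *m V).
Proof.
have [c c0 cP] := expm_lower n (r + 1); exists c => // A V sA sV Ar.
have ddA : derivable (@expm R n) A V by apply: diff_derivable; case: (expm_diff A).
have := derive_linear (tr_mulr_linear V) (mx_linear_continuous (tr_mulr_linear V)) ddA.
move=> [dfA <-]; apply: limr_ge; first exact: dfA.
near=> h; have h0 : h != 0 by near: h; exact: nbhs_dnbhs_neq.
rewrite /= -[_ *: _]/(_ * _) -linearB /= -mulmxBl.
have Ar1 : `|A| <= r + 1 by rewrite (le_trans Ar) // lerDl.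
have hAr : `|h *: V + A| <= r + 1.
  rewrite (le_trans (ler_normD _ _)) // addrC lerD //.
  near: h; apply: nbhs_dnbhs.
  have := @near0_line R _ (fun x : 'M[R]_n => `|x| <= 1) 0 V.
  have h : \forall x \near (0 : 'M[R]_n), `|x| <= 1.
    by apply: (@nbhs0_le R ('M[R]_n : normedModType R)).
  by move=> /(_ h); apply: filterS => t; rewrite addr0.
have shA : (h *: V + A)^T = h *: V + A by rewrite linearD linearZ /= sV sA.
have := expm_strong_mono shA sA (cP _ shA hAr) (cP _ sA Ar1).
rewrite addrK -scalemxAl -!scalemxAr !linearZ /= => hh.
have h20 : 0 < h ^+ 2 by rewrite lt_neqAle sqr_ge0 eq_sym sqrf_eq0 h0.
rewrite -(ler_pM2l h20).
have -> : h ^+ 2 * (h^-1 * \tr ((expm (h *: V + A) - expm A) *m V)) =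
  h * \tr ((expm (h *: V + A) - expm A) *m V) by field.
by apply: le_trans hh; rewrite le_eqVlt; apply/orP; left; apply/eqP; ring.
Unshelve. all: by end_near. Qed.

Lemma dexpm_sym n (A V : 'M[R]_n) : A^T = A -> V^T = V ->
  ('D_V (@expm R n) A)^T = 'D_V (@expm R n) A.
Proof.
move=> sA sV; have ddA : derivable (@expm R n) A V by apply: diff_derivable; case: (expm_diff A).
have lt : linear (fun M : 'M[R]_n => M^T - M).
  by move=> a X Y; rewrite linearP scalerBr opprD addrACA.
have [_ h] := derive_linear lt (mx_linear_continuous lt) ddA.
apply/subr0_eq; rewrite -h.
have [|_ ->] := @near_line_derive R _ _ (cst 0) ((fun M => M^T - M) \o @expm R n) A V _
   (derivable_cst _ _ _); last exact: derive_cst.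
near=> t => /=; rewrite expm_sym ?subrr //.
by rewrite linearD linearZ /= sV sA.
Unshelve. all: by end_near. Qed.

End MatrixBounds.

(** * Smoothness of the logarithm *)

Section SmoothLog.
Context {R : realType}.

(* Functions on the slices Sym, SymPD, Hol and Corp are extended to open sets of
   matrices by precomposition with the projections symp and holp. *)
Definition symp n (A : 'M[R]_n) : 'M[R]_n := 2^-1 *: (A + A^T).

Lemma symp_linear n : linear (@symp n).
Proof.
by move=> a X Y; apply/matrixP => i j; rewrite !mxE; ring.
Qed.

Lemma symp_continuous n : continuous (@symp n).
Proof. exact: mx_linear_continuous (@symp_linear n). Qed.

HB.instance Definition _ n := GRing.isLinear.Build R 'M[R]_n 'M[R]_n *:%R (@symp n)
  (@symp_linear n).

Lemma symp_sym n (A : 'M[R]_n) : (symp A)^T = symp A.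
Proof. by rewrite /symp linearZ linearD /= trmxK addrC. Qed.

Lemma symp_id n (A : 'M[R]_n) : A^T = A -> symp A = A.
Proof.
by move=> sA; rewrite /symp sA; apply/matrixP => i j; rewrite !mxE; field.
Qed.

Lemma symp_norm n (A : 'M[R]_n) : `|symp A| <= `|A|.
Proof.
apply: mxnorm_le => // i j; rewrite !mxE normrM gtr0_norm ?invr_gt0 //.
have := mxnorm_ge A i j; have := mxnorm_ge A j i; have := ler_normD (A i j) (A j i).
lra.
Qed.

Lemma SymPD_near n (X : 'M[R]_n) : SymPD n X ->
  exists2 c, 0 < c & \forall Y \near X, forall x : 'cV[R]_n,
    c * (x^T *m x) 0 0 <= (x^T *m Y *m x) 0 0.
Proof.
move=> /expm_surj[A sA <-]; have [c c0 cP] := expm_lower n `|A|.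
exists (c / 2); first exact: divr_gt0.
(* By [quad_bound], a perturbation of norm at most [d] changes the quadratic form by at most [c / 2]
   times the squared length, half of what [expm_lower] provides. *)
pose d := c / 2 / n.+1%:R.
have d0 : 0 < d by rewrite !divr_gt0.
near=> Y => x.
have Yd : `|Y - expm A| <= d.
  rewrite distrC; near: Y.
  by apply: cvgr_dist_le d0; exact: cvg_id.
have := quad_bound (Y - expm A) x; rewrite ler_norml => /andP[+ _].
rewrite mulmxBr mulmxBl.
have -> : (x^T *m Y *m x - x^T *m expm A *m x) 0 0 =
  (x^T *m Y *m x) 0 0 - (x^T *m expm A *m x) 0 0 by rewrite !mxE.
have := cP A sA (lexx _) x.
have xx : 0 <= (x^T *m x) 0 0 by have := dot_ge0 x^T; rewrite trmxK.
have : n%:R * `|Y - expm A| <= c / 2.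
  rewrite (le_trans (y := n.+1%:R * d)) //; first by rewrite ler_pM // ler_nat.
  by rewrite /d mulrC divfK.
move=> /(ler_wpM2r xx); lra.
Unshelve. all: by end_near. Qed.

Definition PDs n : set 'M[R]_n := [set Y | SymPD n (symp Y)].
Definition logs n (Y : 'M[R]_n) := logm (symp Y).

Lemma open_PDs n : open (@PDs n).
Proof.
rewrite openE => Y PY; rewrite /interior.
have [c c0 cP] := SymPD_near PY.
have h : \forall Z \near Y, forall x : 'cV[R]_n,
    c * (x^T *m x) 0 0 <= (x^T *m symp Z *m x) 0 0 by exact: symp_continuous cP.
apply: filterS h => Z cZ; by apply: SymPD_of_lower cZ => //; exact: symp_sym.
Qed.

Lemma logs_sym n (Y : 'M[R]_n) : PDs Y -> (logs Y)^T = logs Y.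
Proof. exact: logm_sym. Qed.

Lemma logs_expm n (Y : 'M[R]_n) : PDs Y -> expm (logs Y) = symp Y.
Proof. exact: expmK. Qed.

(** Strong monotonicity of [expm], read on the logarithms, is a Lipschitz estimate for the inverse;
    [SymPD_near] makes its constant valid for all nearby [Z]. *)
Lemma logs_continuous n (Y : 'M[R]_n) : PDs Y -> {for Y, continuous (@logs n)}.
Proof.
move=> PY; have [c c0 cP] := SymPD_near PY.
have {}cP : \forall Z \near Y, forall x : 'cV[R]_n,
    c * (x^T *m x) 0 0 <= (x^T *m symp Z *m x) 0 0 by exact: symp_continuous cP.
apply: continuous_dist => e e0.
pose d := c * e / (n.+1%:R * n.+1%:R).
have d0 : 0 < d by rewrite divr_gt0 ?mulr_gt0.
near=> Z.
have PZ : PDs Z by near: Z; apply: open_nbhs_nbhs; split => //; exact: open_PDs.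
have Zd : `|Y - Z| <= d.
  near: Z; by apply: cvgr_dist_le d0; exact: cvg_id.
have cZ : forall x : 'cV[R]_n, c * (x^T *m x) 0 0 <= (x^T *m symp Z *m x) 0 0.
  by near: Z.
have cY := nbhs_singleton cP.
rewrite -(logs_expm PZ) in cZ; rewrite -(logs_expm PY) in cY.
have := expm_strong_mono (logs_sym PY) (logs_sym PZ) cY cZ.
rewrite !logs_expm // -linearB /= => h.
have sD : (logs Y - logs Z)^T = logs Y - logs Z by rewrite linearB /= !logs_sym.
have := coercive_bound sD h c0 => {}h.
rewrite -(ler_pM2l c0) (le_trans h) //.
rewrite (le_trans (y := n.+1%:R * n.+1%:R * d)) //.
  rewrite ler_pM // ?mulr_ge0 //; last exact: le_trans (symp_norm _) Zd.
  by rewrite ler_pM // ler_nat.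
by rewrite /d mulrC divfK // mulf_neq0.
Unshelve. all: by end_near. Qed.

Lemma cvg_bounded_near n (E : normedModType R) (g : E -> 'M[R]_n) (p : E) :
  {for p, continuous g} -> \forall q \near p, `|g q| <= `|g p| + 1.
Proof.
move=> cg; near=> q.
have h : `|g p - g q| <= 1.
  by near: q; exact: (cvgr_dist_le _ _ cg _ ltr01).
rewrite -[g q](subrK (g p)) addrC (le_trans (ler_normD _ _)) // lerD2l.
by rewrite distrC.
Unshelve. all: by end_near. Qed.

(* logs Y is the only zero of logs_eq (Y, .). *)
Definition logs_eq n (p : 'M[R]_n * 'M[R]_n) : 'M[R]_n :=
  expm (symp p.2) + (p.2 - symp p.2) - symp p.1.

(** The derivative acts through that of [expm] on the symmetric part of [V] and as the identity on
    the antisymmetric part. The term [p.2 - symp p.2] of [logs_eq] is there for the latter: without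
    it antisymmetric directions would be killed. *)
Lemma derive_logs_eq n (Y X V : 'M[R]_n) :
  'D_(0, V) (@logs_eq n) (Y, X) = 'D_(symp V) (@expm R n) (symp X) + (V - symp V).
Proof.
have ddA : derivable (@expm R n) (symp X) (symp V).
  by apply: diff_derivable; case: (expm_diff (symp X)).
have h : (fun h : R => h^-1 *: (expm (h *: symp V + symp X) - expm (symp X))) @ 0^'
  --> 'D_(symp V) (@expm R n) (symp X) by exact: ddA.
apply: cvg_lim => //.
have h2 : (fun _ : R => V - symp V) @ 0^' --> V - symp V by exact: cvg_cst.
apply: cvg_trans (cvgD h h2); apply: near_eq_cvg; near=> t.
have t0 : t != 0 by near: t; exact: nbhs_dnbhs_neq.
rewrite /logs_eq /= scaler0 add0r linearP /=.
rewrite !fctE /=; set N := expm (_ + _); set M := expm _.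
set sV := symp V; set sX := symp X; set sY := symp Y.
by apply/matrixP => i j; rewrite !mxE; field.
Unshelve. all: by end_near. Qed.

Lemma Ck_logs k n : Ck k (@PDs n) (@logs n).
Proof.
have oP := @open_PDs n.
have oT : open (@PDs n `*` [set: 'M[R]_n]) by exact: open_prodT.
(* Write the derivative as [S + K], symmetric plus antisymmetric. Then [|S| <= |S + K|],
   [|K| <= 2 * |S + K|] and [c * |symp V| <= n * n * |S|] add up to the constant [n * n + 2 * c]. *)
have bound p (V : 'M[R]_n) c : 0 < c -> PDs p ->
    (forall V : 'M[R]_n, V^T = V ->
      c * \tr (V *m V) <= \tr ('D_V (@expm R n) (logs p) *m V)) ->
    c / (n%:R * n%:R + 2 * c) * `|V| <= `|'D_(0, V) (@logs_eq n) (p, logs p)|.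
  move=> c0 Pp cP; rewrite derive_logs_eq (symp_id (logs_sym Pp)).
  set S := 'D_ _ _ _; set K := V - symp V.
  have sS : S^T = S by apply: dexpm_sym; [exact: logs_sym|exact: symp_sym].
  have K0 : symp K = 0 by rewrite /K linearB /= (symp_id (symp_sym V)) subrr.
  have nS : `|S| <= `|S + K|.
    by rewrite -[X in `|X| <= _](_ : symp (S + K) = S) ?symp_norm // linearD /= K0 addr0 symp_id.
  have nK : `|K| <= `|S| + `|S + K|.
    by rewrite -[X in `|X| <= _](addKr S) (le_trans (ler_normD _ _)) // normrN.
  have hV := coercive_bound (symp_sym V) (cP _ (symp_sym V)) c0.
  rewrite -/S in hV.
  have nn : 0 <= n%:R * n%:R :> R by rewrite mulr_ge0.
  have hS := ler_wpM2l nn nS.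
  have dd : 0 < n%:R * n%:R + 2 * c by rewrite ltr_wpDl // mulr_gt0.
  rewrite mulrAC ler_pdivrMr // -[X in c * `|X|](subrK (symp V)) -/K.
  have := ler_wpM2l (ltW c0) (ler_normD K (symp V)); rewrite mulrDr.
  have := ler_wpM2l (ltW c0) nK; have := ler_wpM2l (ltW c0) nS; rewrite mulrDr mulrDr.
  lra.
have Ceq j : Ck j (@PDs n `*` [set: 'M[R]_n]) (@logs_eq n).
  have ls : linear (@symp n) by exact: symp_linear.
  have cs := @symp_continuous n.
  have Cs2 : Ck j (@PDs n `*` [set: 'M[R]_n]) (fun p : 'M[R]_n * 'M[R]_n => symp p.2).
    by apply: (@Ck_comp_lin _ _ _ _ _ _ snd) => //; exact: Ck_snd.
  apply: CkB => //; last first.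
    by apply: (@Ck_comp_lin _ _ _ _ _ _ fst) => //; exact: Ck_fst.
  apply: CkD => //; last by apply: CkB => //; exact: Ck_snd.
  by apply: Ck_compT Cs2 _ => //; exact: Ck_expm.
apply: (@Ck_implicit _ _ _ _ _ _ (@logs_eq n)) => //.
- move=> p Pp; rewrite /logs_eq /= (symp_id (logs_sym Pp)) logs_expm //.
  by rewrite subrr addr0 subrr.
- by move=> p; exact: logs_continuous.
- move=> p Pp.
  have [c c0 cP] := dexpm_mono n (`|logs p| + 1).
  exists (c / (n%:R * n%:R + 2 * c)); first by rewrite divr_gt0 // ltr_wpDl ?mulr_ge0 // mulr_gt0.
  have := cvg_bounded_near (logs_continuous Pp) => nb.
  near=> q => V; apply: bound => //.
    by near: q; apply: open_nbhs_nbhs.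
  move=> W sW; apply: cP => //; last by near: q.
  apply: logs_sym; by near: q; apply: open_nbhs_nbhs.
- move=> p W Pp; have [c c0 cP] := dexpm_mono n `|logs p|.
  have df : differentiable (@logs_eq n) (p, logs p) by case: (Ceq 1%N) => + _; apply.
  have lD : linear (fun V => 'd (@logs_eq n) (p, logs p) (0, V)).
    move=> a X Y; rewrite -linearP; congr ('d _ _ _).
    by congr pair; rewrite /= ?scaler0 ?addr0.
  pose M := GRing.isLinear.Build _ _ _ _ _ lD.
  pose L : {linear 'M[R]_n -> 'M[R]_n} :=
    HB.pack (fun V => 'd (@logs_eq n) (p, logs p) (0, V)) M.
  have [|V LV] := mx_inj_surj (L := L) _ W; last by exists V; rewrite deriveE.
  move=> V LV0.
  have := bound p V c c0 Pp (fun V sV => cP _ V (logs_sym Pp) sV (lexx _)).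
  rewrite deriveE // -[X in _ <= `|X|]/(L V) LV0 normr0 pmulr_rle0.
    by rewrite normr_le0 => /eqP.
  by rewrite divr_gt0 // ltr_wpDl ?mulr_ge0 // mulr_gt0.
Unshelve. all: by end_near. Qed.

End SmoothLog.

(** * The correction D(S) *)

Section DiagonalCorrection.
Context {R : realType}.

Lemma off_linear n : linear (@off R n).
Proof.
move=> a X Y; apply/matrixP => i j; rewrite !mxE.
by case: ifP => _; rewrite ?mulr0 ?addr0.
Qed.

Definition holp n (S : 'M[R]_n) : 'M[R]_n := off (symp S).

Lemma holp_linear n : linear (@holp n).
Proof. by move=> a X Y; rewrite /holp symp_linear off_linear. Qed.

Lemma holp_Hol n (S : 'M[R]_n) : Hol n (holp S).
Proof.
split; last by move=> i; rewrite mxE eqxx.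
rewrite /Sym /= /holp; move: (symp S) (symp_sym S) => M sM.
apply/matrixP => i j; rewrite !mxE eq_sym; case: ifP => // _.
by rewrite -[in LHS]sM mxE.
Qed.

Lemma off_id n (S : 'M[R]_n) : Hol n S -> off S = S.
Proof.
by move=> [_ S0]; apply/matrixP => i j; rewrite mxE; case: eqP => // ->.
Qed.

Lemma holp_id n (S : 'M[R]_n) : Hol n S -> holp S = S.
Proof. by move=> HS; rewrite /holp symp_id ?off_id //; case: HS. Qed.

Lemma holp_norm n (S : 'M[R]_n) : `|holp S| <= `|S|.
Proof.
apply: mxnorm_le => // i j; rewrite mxE; case: ifP => _; first by rewrite normr0.
by rewrite (le_trans (mxnorm_ge _ _ _)) // symp_norm.
Qed.

Definition drow n (M : 'M[R]_n) : 'rV[R]_n := \row_i M i i.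

Lemma drow_linear n : linear (@drow n).
Proof. by move=> a X Y; apply/rowP => i; rewrite !mxE. Qed.

Lemma diag_mx_linear n : linear (@diag_mx R n).
Proof. by move=> a X Y; rewrite linearP. Qed.

Lemma tr_mul_diag n (M : 'M[R]_n) d : \tr (M *m diag_mx d) = \sum_i M i i * d 0 i.
Proof. by apply: eq_bigr => i _; rewrite mul_mx_diag mxE. Qed.

Lemma tr_mul_drow n (M : 'M[R]_n) d :
  \tr (M *m diag_mx d) = \tr (diag_mx (drow M) *m diag_mx d).
Proof. by rewrite !tr_mul_diag; apply: eq_bigr => i _; rewrite !mxE eqxx mulr1n. Qed.

Lemma diag_mx_norm n (d : 'rV[R]_n) : `|diag_mx d| = `|d|.
Proof.
apply/eqP; rewrite eq_le; apply/andP; split; apply: mxnorm_le => // i j.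
  by rewrite mxE; case: eqP => _; rewrite ?mulr1n ?mulr0n ?normr0 // mxnorm_ge.
by have := mxnorm_ge (diag_mx d) j j; rewrite mxE eqxx mulr1n ord1.
Qed.

(** For [x >= 0] the claim is [2 * x <= expR x], and [expR x] is at least [(1 + x / 2) ^+ 2], which
    exceeds [2 * x] by [(1 - x / 2) ^+ 2]. Summed over the entries of [d], it gives coercivity. *)
Lemma expR_sub_ge (x : R) : `|x| <= expR x - x.
Proof.
have [x0|x0] := leP 0 x; last by rewrite ltr0_norm // lerDr expR_ge0.
rewrite ger0_norm // lerBrDr.
have -> : expR x = expR (x / 2) ^+ 2 by rewrite expr2 -expRD; congr expR; field.
have h : 1 + x / 2 <= expR (x / 2) by exact: expR_ge1Dx.
have h0 : 0 <= 1 + x / 2 by lra.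
apply: le_trans (_ : (1 + x / 2) ^+ 2 <= _); last by rewrite ler_pXn2r ?nnegrE ?expR_ge0.
by have := sqr_ge0 (1 - x / 2); rewrite !expr2; lra.
Qed.

(* Klein's inequality at [diag_mx d] *)
Lemma tr_expm_diag_ge n (S : 'M[R]_n) (d : 'rV[R]_n) : Hol n S ->
  \sum_i expR (d 0 i) <= \tr (expm (S + diag_mx d)).
Proof.
move=> [sS S0]; have sD : (diag_mx d)^T = diag_mx d by rewrite tr_diag_mx.
have sA : (S + diag_mx d)^T = S + diag_mx d by rewrite linearD /= sD sS.
have := expm_klein sD sA; rewrite addrK expm_diag mxtrace_mulC tr_mul_diag big1.
  rewrite subr_ge0; apply: le_trans; rewrite /mxtrace le_eqVlt; apply/orP; left.
  by apply/eqP/eq_bigr => i _; rewrite !mxE eqxx mulr1n.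
by move=> i _; rewrite S0 mul0r.
Qed.

Lemma rV_norm_le_sum n (d : 'rV[R]_n) : `|d| <= \sum_i `|d 0 i|.
Proof.
apply: mxnorm_le => [|i j]; first by rewrite sumr_ge0.
by rewrite ord1 (bigD1 j) //= lerDl sumr_ge0.
Qed.

(** A first order condition obtained without differentiating. Klein's inequality at [d + h *: e] and
    minimality at [d] give [0 <= h * (b h - 1)] for both signs of [h]; continuity of [b] then forces
    [b 0 = 1]. *)
Lemma drow_expm_critical n (S : 'M[R]_n) (d : 'rV[R]_n) : Sym n S ->
  (forall d' : 'rV[R]_n, \tr (expm (S + diag_mx d)) - \sum_i d 0 i <=
              \tr (expm (S + diag_mx d')) - \sum_i d' 0 i) ->
  forall i, expm (S + diag_mx d) i i = 1.
Proof.
move=> sS dmin i; pose e : 'rV[R]_n := delta_mx 0 i.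
pose b (h : R) := expm (S + diag_mx (d + h *: e)) i i.
have sA d' : (S + diag_mx d')^T = S + diag_mx d' by rewrite linearD /= tr_diag_mx sS.
have hb h : 0 <= h * (b h - 1).
  have := expm_klein (sA (d + h *: e)) (sA d).
  have := dmin (d + h *: e).
  have -> : \sum_j (d + h *: e) 0 j = \sum_j d 0 j + h.
    transitivity (\sum_j (d 0 j + h * (j == i)%:R)).
      by apply: eq_bigr => j _; rewrite !mxE eqxx.
    rewrite big_split /=; congr (_ + _).
    rewrite (bigD1 i) //= eqxx mulr1 big1 ?addr0 // => j ji.
    by rewrite (negbTE ji) mulr0.
  have -> : S + diag_mx d - (S + diag_mx (d + h *: e)) = diag_mx (- (h *: e)).
    by rewrite opprD addrACA subrr add0r -linearB /= opprD addrA subrr add0r.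
  have -> M : \tr (M *m diag_mx (- (h *: e))) = - h * M i i.
    rewrite tr_mul_diag (bigD1 i) //= big1 ?addr0.
      by rewrite !mxE !eqxx mulr1 mulrC.
    by move=> j ji; rewrite !mxE (negbTE ji) andbF mulr0 oppr0 mulr0.
  rewrite -/(b h); lra.
have cb : b h @[h --> (0 : R)] --> b 0.
  apply: (@continuous_comp _ _ _ (fun h : R => S + diag_mx (d + h *: e))
    (fun M => expm M i i)).
    have -> : (fun h : R => S + diag_mx (d + h *: e)) =
        (fun h => (S + diag_mx d) + h *: diag_mx e).
      by apply/funext => h; rewrite linearD linearZ /= addrA.
    apply: cvgD; [exact: cvg_cst|exact: scalel_continuous].
  apply: (@continuous_comp _ _ _ (@expm R n) (fun M => M i i)).
    exact: (Ck_continuous (@Ck_expm R 0 n)).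
  exact: coord_continuous.
have b0E : b 0 = expm (S + diag_mx d) i i by rewrite /b scale0r addr0.
rewrite -b0E; have [b1|b1|//] := ltgtP (b 0) 1.
  have /nbhs_ballP[e' /= e0 he] : \forall h \near (0 : R), b h < 1 by exact: cvgr_lt cb _ b1.
  have e2 : 0 < e' / 2 by exact: divr_gt0.
  have := hb (e' / 2); rewrite pmulr_rge0 // subr_ge0 leNgt he //.
  by rewrite /ball /= sub0r normrN gtr0_norm // gtr_pMr // invf_lt1 // ltr1n.
have /nbhs_ballP[e' /= e0 he] : \forall h \near (0 : R), 1 < b h by exact: cvgr_gt cb _ b1.
have e2 : 0 < e' / 2 by exact: divr_gt0.
have := hb (- (e' / 2)); rewrite mulNr oppr_ge0 pmulr_rle0 // subr_le0 leNgt he //.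
by rewrite /ball /= sub0r opprK gtr0_norm // gtr_pMr // invf_lt1 // ltr1n.
Qed.

(* D(S) is the minimum point of d |-> tr exp(S + diag d) - sum d, which is coercive
   by tr_expm_diag_ge. *)
Lemma Dcor_exists n (S : 'M[R]_n) : Hol n S ->
  exists d : 'rV[R]_n, forall i, expm (S + diag_mx d) i i = 1.
Proof.
move=> HS; have [sS _] := HS.
pose F (d : 'rV[R]_n) := \tr (expm (S + diag_mx d)) - \sum_i d 0 i.
have Fd d : `|d| <= F d.
  rewrite (le_trans (rV_norm_le_sum d)) // /F.
  apply: le_trans (_ : \sum_i (expR (d 0 i) - d 0 i) <= _).
    by apply: ler_sum => i _; exact: expR_sub_ge.
  by rewrite sumrB lerD2r tr_expm_diag_ge.
have cF : continuous F.
  have c2 : continuous (fun d : 'rV[R]_n => \sum_i d 0 i : R^o).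
    apply: mx_linear_continuous => a x y; rewrite scaler_sumr -big_split.
    by apply: eq_bigr => i _; rewrite !mxE.
  have c3 : continuous (fun d : 'rV[R]_n => S + diag_mx d).
    have cd := mx_linear_continuous (@diag_mx_linear n).
    by move=> d; apply: (continuousD (@cst_continuous _ _ S d) (cd d)).
  have ctr : continuous (fun M : 'M[R]_n => \tr M : R^o).
    by apply: mx_linear_continuous => a X Y; rewrite linearP.
  have ce : continuous (@expm R n).
    by move=> M; exact: (Ck_continuous (@Ck_expm R 0 n)).
  have c1 : continuous (fun d : 'rV[R]_n => \tr (expm (S + diag_mx d)) : R^o).
    move=> d; apply: (@continuous_comp _ _ _ (fun d : 'rV[R]_n => S + diag_mx d)
      (fun M => \tr (expm M))); first exact: c3.
    by apply: (@continuous_comp _ _ _ (@expm R n) (fun M => \tr M)); [exact: ce|exact: ctr].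
  by move=> d; apply: (continuousB (c1 d) (c2 d)).
(* Outside [B] the function satisfies [F 0 < |d| <= F d], so a minimum over this compact ball is
   global. *)
pose B := [set d : 'rV[R]_n | `|d| <= F 0].
have B0 : B 0 by exact: Fd.
have cB : compact B.
  apply: bounded_closed_compact.
    exists (F 0); split; first exact: num_real.
    by move=> x xF d /= /le_trans; apply; exact: ltW.
  have := @closed_comp _ _ (fun d : 'rV[R]_n => `|d|) [set x : R | x <= F 0].
  apply; last exact: closed_le.
  by move=> d _; exact: norm_continuous.
have [d /set_mem Bd dmin] := @EVT_min_rV R n F B (ex_intro _ 0 B0) cB
  (continuous_subspaceT cF).
exists d; apply: drow_expm_critical => // d'; rewrite -/(F d) -/(F d').
have [d'B|d'B] := leP `|d'| (F 0); first by apply: dmin; rewrite inE.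
apply: le_trans (dmin 0 (mem_set B0)) _.
exact: le_trans (ltW d'B) (Fd d').
Qed.

(** Against the diagonal matrix [D1 - D2] the trace sees only the diagonals of the two exponentials,
    which agree; strong monotonicity then forces [D1 - D2] to vanish. *)
Lemma Dcor_uniq n (S D1 D2 : 'M[R]_n) : Sym n S -> is_diag_mx D1 -> is_diag_mx D2 ->
  (forall i, expm (S + D1) i i = 1) -> (forall i, expm (S + D2) i i = 1) -> D1 = D2.
Proof.
move=> sS /is_diag_mxP d1 /is_diag_mxP d2 e1 e2.
have dE (D : 'M[R]_n) : (forall i j : 'I_n, i != j :> nat -> D i j = 0) -> D = diag_mx (drow D).
  move=> dD; apply/matrixP => i j; rewrite !mxE; case: eqVneq => [->|ij].
    by rewrite mulr1n.
  by rewrite mulr0n dD.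
have sD (D : 'M[R]_n) : (forall i j : 'I_n, i != j :> nat -> D i j = 0) -> (S + D)^T = S + D.
  by move=> /dE ->; rewrite linearD /= tr_diag_mx sS.
pose r := Num.max `|S + D1| `|S + D2|.
have [c c0 cP] := expm_lower n r.
have r1 : `|S + D1| <= r by rewrite le_max lexx.
have r2 : `|S + D2| <= r by rewrite le_max lexx orbT.
have := expm_strong_mono (sD _ d1) (sD _ d2) (cP _ (sD _ d1) r1) (cP _ (sD _ d2) r2).
have -> : S + D1 - (S + D2) = D1 - D2 by rewrite opprD addrACA subrr add0r.
rewrite {4}(dE _ d1) {4}(dE _ d2) -linearB /= tr_mul_diag big1; last first.
  by move=> i _; rewrite !mxE e1 e2 subrr mul0r.
rewrite pmulr_rle0 // => h; apply/subr0_eq/frobenius_eq0 => //.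
by rewrite (dE _ d1) (dE _ d2) -linearB /= tr_diag_mx.
Qed.

Lemma Dcor_spec n (S : 'M[R]_n) : Hol n S ->
  is_diag_mx (Dcor S) /\ Corp n (expm (S + Dcor S)).
Proof.
move=> HS; rewrite /Dcor; case: xgetP => [D -> //|].
have [d dP] := Dcor_exists HS; move=> /(_ (diag_mx d)); case; split.
  exact: diag_mx_is_diag.
split => //; apply: expm_SymPD; rewrite /Sym /= linearD /= tr_diag_mx.
by case: HS => ->.
Qed.

Lemma Dcor_eq n (S D : 'M[R]_n) : Hol n S -> is_diag_mx D -> Corp n (expm (S + D)) ->
  Dcor S = D.
Proof.
move=> HS dD [_ eD]; have [dD' [_ eD']] := Dcor_spec HS.
by apply: (Dcor_uniq (S := S)) => //; case: HS.
Qed.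

End DiagonalCorrection.

(** * Smoothness of the correction and of the off-log chart *)

Section SmoothCorrection.
Context {R : realType}.

Definition dcor n (S : 'M[R]_n) : 'rV[R]_n := drow (Dcor (holp S)).

Lemma dcorE n (S : 'M[R]_n) : diag_mx (dcor S) = Dcor (holp S).
Proof.
have [/is_diag_mxP dD _] := Dcor_spec (holp_Hol S).
apply/matrixP => i j; rewrite !mxE; case: eqVneq => [->|ij]; first by rewrite mulr1n.
by rewrite mulr0n dD.
Qed.

Lemma expm_dcor_diag n (S : 'M[R]_n) i : expm (holp S + diag_mx (dcor S)) i i = 1.
Proof. by rewrite dcorE; have [_ [_ ->]] := Dcor_spec (holp_Hol S). Qed.

Lemma sym_hol_diag n (S : 'M[R]_n) (d : 'rV[R]_n) :
  (holp S + diag_mx d)^T = holp S + diag_mx d.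
Proof. by rewrite linearD /= tr_diag_mx; case: (holp_Hol S) => ->. Qed.

(** Klein's inequality against the zero correction bounds the sum of [expR (d i) - d i] by
    [\tr (expm (holp S))]. This a priori bound keeps the exponents in a ball on which [expm_lower]
    and [dexpm_mono] are uniform. *)
Lemma dcor_norm n (S : 'M[R]_n) : `|dcor S| <= n%:R * expR (n.+1%:R * `|S|).
Proof.
rewrite (le_trans (rV_norm_le_sum _)) //.
apply: le_trans (_ : \sum_i (expR (dcor S 0 i) - dcor S 0 i) <= _).
  by apply: ler_sum => i _; exact: expR_sub_ge.
have h1 := tr_expm_diag_ge (dcor S) (holp_Hol S).
have sH : (holp S)^T = holp S by case: (holp_Hol S).
have := expm_klein (sym_hol_diag S (dcor S)) sH.
have -> : holp S - (holp S + diag_mx (dcor S)) = diag_mx (- dcor S).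
  by rewrite opprD addrA subrr add0r linearN.
rewrite tr_mul_diag.
have -> : \sum_i expm (holp S + diag_mx (dcor S)) i i * (- dcor S) 0 i = - \sum_i dcor S 0 i.
  by rewrite -sumrN; apply: eq_bigr => i _; rewrite expm_dcor_diag mul1r mxE.
move=> h2; have h3 : \tr (expm (holp S)) <= n%:R * expR (n.+1%:R * `|S|).
  rewrite (le_trans (ler_norm _)) // (le_trans (tr_norm _)) // ler_wpM2l //.
  by rewrite (le_trans (expm_norm _)) // ler_expR ler_wpM2l // holp_norm.
rewrite sumrB; lra.
Qed.

(** The unknown is the row of diagonal entries rather than a diagonal matrix, so that equation and
    unknown live in the same space, as [mx_inj_surj] requires. *)
Definition dcor_eq n (p : 'M[R]_n * 'rV[R]_n) : 'rV[R]_n :=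
  drow (expm (holp p.1 + diag_mx p.2)) - const_mx 1.

Lemma subr_mxE m n (M N : 'M[R]_(m, n)) i j : (M - N) i j = M i j - N i j.
Proof. by rewrite !mxE. Qed.

Lemma drowE n (M : 'M[R]_n) i : drow M 0 i = M i i.
Proof. by rewrite mxE. Qed.

Lemma dcor_eqE n S (d : 'rV[R]_n) i :
  dcor_eq (S, d) 0 i = expm (holp S + diag_mx d) i i - 1.
Proof.
rewrite /dcor_eq /=; move: (expm _) => M.
by rewrite !mxE.
Qed.

Lemma dcor_eq0 n (S : 'M[R]_n) : dcor_eq (S, dcor S) = 0.
Proof.
by apply/rowP => i; rewrite dcor_eqE expm_dcor_diag subrr [RHS]mxE.
Qed.

Lemma Ck_hol_diag k n (U : set ('M[R]_n * 'rV[R]_n)) : open U ->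
  Ck k U (fun p : 'M[R]_n * 'rV[R]_n => holp p.1 + diag_mx p.2).
Proof.
move=> oU; apply: CkD => //.
  apply: (@Ck_comp_lin _ _ _ _ _ _ fst _ oU (@holp_linear R n)); last exact: Ck_fst.
  exact: mx_linear_continuous (@holp_linear R n).
apply: (@Ck_comp_lin _ _ _ _ _ _ snd _ oU (@diag_mx_linear R n)); last exact: Ck_snd.
exact: mx_linear_continuous (@diag_mx_linear R n).
Qed.

Lemma Ck_dcor_eq k n (U : set ('M[R]_n * 'rV[R]_n)) : open U -> Ck k U (@dcor_eq n).
Proof.
move=> oU; apply: CkB => //; last exact: Ck_cst.
apply: (@Ck_comp_lin _ _ _ _ _ _ (fun p : 'M[R]_n * 'rV[R]_n =>
  expm (holp p.1 + diag_mx p.2)) _ oU (@drow_linear R n)).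
  exact: mx_linear_continuous (@drow_linear R n).
by apply: Ck_compT (Ck_hol_diag k oU) _ => //; exact: Ck_expm.
Qed.

Lemma derive_dcor_eq n (S : 'M[R]_n) (d v : 'rV[R]_n) :
  'D_(0, v) (@dcor_eq n) (S, d) = drow ('D_(diag_mx v) (@expm R n) (holp S + diag_mx d)).
Proof.
set A := holp S + _; pose V := diag_mx v.
have ddA : derivable (@expm R n) A V.
  by apply: diff_derivable; case: (expm_diff A).
have [dd <-] := derive_linear (@drow_linear R n)
  (mx_linear_continuous (@drow_linear R n)) ddA.
apply: (congr1 (fun F : R -> 'rV[R]_n => lim (F @ 0^'))); apply/funext => h /=.
rewrite /dcor_eq /= scaler0 add0r opprD addrACA opprK addNr addr0.
have -> : holp S + diag_mx (h *: v + d) = h *: V + A by rewrite linearP /= addrCA.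
by [].
Qed.

(** The trace against a diagonal matrix ignores the entries of [M] off the diagonal, so coercivity
    in diagonal directions already bounds [v] by [drow M]. *)
Lemma tr_diag_drow n (M : 'M[R]_n) (v : 'rV[R]_n) c :
  c * \tr (diag_mx v *m diag_mx v) <= \tr (M *m diag_mx v) -> 0 < c ->
  c * `|v| <= n%:R * n%:R * `|drow M|.
Proof.
rewrite [\tr (M *m _)]tr_mul_drow => h c0.
by have := coercive_bound (tr_diag_mx v) h c0; rewrite !diag_mx_norm.
Qed.

Lemma near_norm_le n (p : 'M[R]_n) : \forall q \near p, `|q| <= `|p| + 1.
Proof. by apply: (@cvg_bounded_near R n _ id p); exact: cvg_id. Qed.

Definition dbound n (r : R) : R := r + n%:R * expR (n.+1%:R * r).

Lemma hol_dcor_norm n (S : 'M[R]_n) (r : R) : `|S| <= r ->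
  `|holp S + diag_mx (dcor S)| <= dbound n r.
Proof.
move=> Sr; rewrite (le_trans (ler_normD _ _)) // lerD //.
  exact: le_trans (holp_norm _) Sr.
rewrite diag_mx_norm (le_trans (dcor_norm _)) // ler_wpM2l // ler_expR.
by rewrite ler_wpM2l.
Qed.

Lemma dcor_continuous n (S0 : 'M[R]_n) : {for S0, continuous (@dcor n)}.
Proof.
have NN : n%:R * n%:R <= n.+1%:R * n.+1%:R :> R by rewrite ler_pM // ler_nat.
pose d0 := dcor S0.
pose r := `|S0| + 1; pose r' := Num.max (dbound n r) (r + `|d0|).
have [c c0 cP] := expm_lower n r'.
apply: continuous_dist => e e0.
pose w := c * e / (n.+1%:R * n.+1%:R).
have w0 : 0 < w by rewrite divr_gt0 ?mulr_gt0.
have cf : {for S0, continuous (fun S => dcor_eq (S, d0))}.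
  apply: (@continuous_comp _ _ _ (fun S => (S, d0)) (@dcor_eq n)).
    by apply: continuous_pair; [exact: cvg_id|exact: cst_continuous].
  by apply: (Ck_continuous (Ck_dcor_eq 0 openT)).
have f0 : dcor_eq (S0, d0) = 0 by exact: dcor_eq0.
near=> S.
have Sr : `|S| <= r by near: S; exact: near_norm_le.
have fw : `|dcor_eq (S0, d0) - dcor_eq (S, d0)| <= w.
  by near: S; exact: (cvgr_dist_le _ _ cf _ w0).
rewrite f0 sub0r normrN in fw.
have sA := sym_hol_diag S (dcor S); have sB := sym_hol_diag S d0.
have nA : `|holp S + diag_mx (dcor S)| <= r' by rewrite le_max hol_dcor_norm.
have nB : `|holp S + diag_mx d0| <= r'.
  rewrite le_max; apply/orP; right; rewrite (le_trans (ler_normD _ _)) // diag_mx_norm.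
  by rewrite lerD2r (le_trans (holp_norm _)).
have := expm_strong_mono sA sB (cP _ sA nA) (cP _ sB nB).
have -> : holp S + diag_mx (dcor S) - (holp S + diag_mx d0) = diag_mx (dcor S - d0).
  by rewrite opprD addrACA subrr add0r linearB.
move=> h; have h1 := tr_diag_drow h c0.
have E : drow (expm (holp S + diag_mx (dcor S)) - expm (holp S + diag_mx d0)) =
    - dcor_eq (S, d0).
  apply/rowP => i; rewrite drowE.
  have -> : (- dcor_eq (S, d0)) 0 i = - dcor_eq (S, d0) 0 i by rewrite [LHS]mxE.
  rewrite dcor_eqE -(expm_dcor_diag S i) opprB.
  exact: subr_mxE.
have nE : `|- dcor_eq (S, d0)| <= w.
  by rewrite normrN.
have nn : 0 <= n%:R * n%:R :> R by exact: mulr_ge0.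
have {h1} h1 : c * `|dcor S - d0| <= n%:R * n%:R * w.
  by apply: (le_trans h1); apply: ler_wpM2l => //; apply: le_trans nE; rewrite E.
have dE : `|d0 - dcor S| = `|dcor S - d0| by exact: distrC.
rewrite -(ler_pM2l c0) dE; apply: (le_trans h1).
have -> : c * e = n.+1%:R * n.+1%:R * w by rewrite /w [RHS]mulrC divfK // mulf_neq0.
exact: ler_wpM2r (ltW w0) _ _ NN.
Unshelve. all: by end_near. Qed.

Lemma Ck_dcor k n : Ck k [set: 'M[R]_n] (@dcor n).
Proof.
have oT : open ([set: 'M[R]_n] `*` [set: 'rV[R]_n]) by apply: open_prodT; exact: openT.
have bound p (v : 'rV[R]_n) c : 0 < c ->
    (forall V : 'M[R]_n, V^T = V -> c * \tr (V *m V) <=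
      \tr ('D_V (@expm R n) (holp p + diag_mx (dcor p)) *m V)) ->
    c / (n.+1%:R * n.+1%:R) * `|v| <= `|'D_(0, v) (@dcor_eq n) (p, dcor p)|.
  move=> c0 cP; rewrite derive_dcor_eq mulrAC ler_pdivrMr ?mulr_gt0 //.
  rewrite (le_trans (tr_diag_drow (cP _ (tr_diag_mx v)) c0)) // mulrC ler_wpM2l //.
  by rewrite ler_pM // ler_nat.
apply: (@Ck_implicit _ _ _ _ _ _ (@dcor_eq n)) => //.
- exact: openT.
- exact: Ck_dcor_eq.
- by move=> S _; exact: dcor_eq0.
- by move=> S _; exact: dcor_continuous.
- move=> p _; have [c c0 cP] := dexpm_mono n (dbound n (`|p| + 1)).
  exists (c / (n.+1%:R * n.+1%:R)); first by rewrite divr_gt0 // mulr_gt0.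
  near=> q => v; apply: bound => // V sV; apply: cP => //; first exact: sym_hol_diag.
  by apply: hol_dcor_norm; near: q; exact: near_norm_le.
- move=> p W _; have [c c0 cP] := dexpm_mono n (dbound n `|p|).
  have df : differentiable (@dcor_eq n) (p, dcor p).
    by case: (Ck_dcor_eq 1 oT) => + _; apply.
  have lD : linear (fun v => 'd (@dcor_eq n) (p, dcor p) (0, v)).
    move=> a X Y; rewrite -linearP; congr ('d _ _ _).
    by congr pair; rewrite /= ?scaler0 ?addr0.
  pose M := GRing.isLinear.Build _ _ _ _ _ lD.
  pose L : {linear 'rV[R]_n -> 'rV[R]_n} :=
    HB.pack (fun v => 'd (@dcor_eq n) (p, dcor p) (0, v)) M.
  have [|v Lv] := mx_inj_surj (L := L) _ W; last by exists v; rewrite deriveE.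
  move=> v Lv0.
  have := bound p v c c0 (fun V sV =>
    cP _ V (sym_hol_diag p (dcor p)) sV (hol_dcor_norm (lexx _))).
  rewrite deriveE // -[X in _ <= `|X|]/(L v) Lv0 normr0 pmulr_rle0.
    by rewrite normr_le0 => /eqP.
  by rewrite divr_gt0 // mulr_gt0.
Unshelve. all: by end_near. Qed.

(* Smooth extensions of ExpOL (by Xp) and of LogOL (by Lg) *)
Definition Xp n (S : 'M[R]_n) : 'M[R]_n := expm (holp S + diag_mx (dcor S)).
Definition Lg n (Y : 'M[R]_n) : 'M[R]_n := off (logs Y).

Lemma Ck_Xp k n : Ck k [set: 'M[R]_n] (@Xp n).
Proof.
apply: (@Ck_compT _ _ _ _ _ _ (fun S => holp S + diag_mx (dcor S))).
- exact: openT.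
- apply: (@Ck_compT _ _ _ _ _ _ (fun S => (S, dcor S))
    (fun p : 'M[R]_n * 'rV[R]_n => holp p.1 + diag_mx p.2)); first exact: openT.
    by apply: Ck_pair; [exact: openT|apply: Ck_id; exact: openT|exact: Ck_dcor].
  by apply: Ck_hol_diag; exact: openT.
- exact: Ck_expm.
Qed.

Lemma Ck_Lg k n : Ck k (@PDs R n) (@Lg n).
Proof.
apply: (@Ck_comp_lin _ _ _ _ _ _ (@logs R n)).
- exact: open_PDs.
- exact: off_linear.
- exact: mx_linear_continuous (@off_linear R n).
- exact: Ck_logs.
Qed.

Lemma Corp_PDs n (C : 'M[R]_n) : Corp n C -> PDs C.
Proof. by move=> [[sC pC] _]; rewrite /PDs /= symp_id. Qed.

Lemma Lg_LogOL n (C : 'M[R]_n) : Corp n C -> Lg C = LogOL C.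
Proof. by move=> [[sC pC] _]; rewrite /Lg /logs symp_id. Qed.

Lemma Xp_ExpOL n (S : 'M[R]_n) : Hol n S -> Xp S = ExpOL S.
Proof. by move=> HS; rewrite /Xp /ExpOL dcorE holp_id. Qed.

Lemma Xp_Corp n (S : 'M[R]_n) : Corp n (Xp S).
Proof. by rewrite /Xp dcorE; case: (Dcor_spec (holp_Hol S)). Qed.

Lemma Lg_Hol n (C : 'M[R]_n) : PDs C -> Hol n (Lg C).
Proof.
move=> PC; have := holp_Hol (logs C); rewrite /holp symp_id //.
exact: logs_sym.
Qed.

Lemma off_diag n (D : 'M[R]_n) : is_diag_mx D -> off D = 0.
Proof.
move=> /is_diag_mxP dD; apply/matrixP => i j; rewrite !mxE; case: eqVneq => // ij.
by rewrite dD.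
Qed.

Lemma XpK n (S : 'M[R]_n) : Hol n S -> Lg (Xp S) = S.
Proof.
move=> HS; have PX := Xp_Corp S.
rewrite /Lg /logs symp_id; last by case: PX => -[].
have [dD _] := Dcor_spec (holp_Hol S).
rewrite /Xp logmK; last exact: sym_hol_diag.
rewrite dcorE; have := @off_linear R n 1 (holp S) (Dcor (holp S)).
by rewrite !scale1r => ->; rewrite (off_diag dD) addr0 off_id holp_id.
Qed.

Lemma LgK n (C : 'M[R]_n) : Corp n C -> Xp (Lg C) = C.
Proof.
move=> CC; have PC := Corp_PDs CC; have [[sC pC] dC] := CC.
have HL := Lg_Hol PC.
have eC : expm (logs C) = C by rewrite logs_expm // symp_id.
(* The diagonal part of [logs C] is a valid correction for [Lg C], since adding it back
   exponentiates to [C]; uniqueness makes it [Dcor]. *)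
rewrite Xp_ExpOL // /ExpOL (@Dcor_eq _ _ (Lg C) (logs C - Lg C)) //.
- by rewrite addrC subrK.
- apply/is_diag_mxP => i j ij; rewrite !mxE ifN ?subrr //.
- by rewrite addrC subrK eC.
Qed.

End SmoothCorrection.

(** * Slices, second derivatives and curves *)

Section SliceSmoothness.
Context {R : realType}.
Implicit Types E F W : normedModType R.

Lemma Ck_diffl k E W (U : set E) (f : E -> W) v :
  open U -> Ck k.+1 U f -> Ck k U (fun x => 'd f x v).
Proof.
move=> oU [_ Cf]; apply: (@Ck_comp _ _ _ _ _ _ _ (fun x => (x, v))
  (fun p : E * E => 'd f (p.1 : E) p.2)) Cf => //.
- exact: open_prodT.
- by apply: Ck_pair => //; [exact: Ck_id|exact: Ck_cst].
Qed.

Lemma within_eq E W (M : set E) (f g : E -> W) :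
  (forall x, M x -> f x = g x) -> {within M, continuous g} -> {within M, continuous f}.
Proof.
move=> fg; apply: (@subspace_eq_continuous _ M _ g f) => x /set_mem Mx.
by rewrite fg.
Qed.

(** The passage from open sets to slices: short segments in tangent directions stay in [M], so the
    derivatives of [f] there are those of the extension [g], at every order. *)
Lemma Ck_on_of_Ck k E W (M T U : set E) (f g : E -> W) :
  open U -> M `<=` U ->
  (forall x v, M x -> T v -> \forall h \near (0 : R), M (h *: v + x)) ->
  (forall x, M x -> f x = g x) -> Ck k U g -> Ck_on M T k f.
Proof.
move=> oU MU MT; elim: k f g => [|k IH] f g fg Cg.
  split => //; apply: (within_eq fg).
  by apply: continuous_in_subspaceT => x /set_mem /MU /(Ck_continuous Cg).
have [dg Cdg] := Cg; split.
  apply: (within_eq fg).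
  by apply: continuous_in_subspaceT => x /set_mem /MU /(Ck_continuous Cg).
move=> V TV.
have h x : M x -> derivable f x V /\ 'D_V f x = 'D_V g x.
  move=> Mx; apply: near_line_derive; last by apply/diff_derivable/dg/MU.
  by apply: filterS (MT _ _ Mx TV) => t /fg.
split; first by move=> x /h [].
apply: IH (Ck_diffl V oU Cg) => x Mx; have [_ ->] := h _ Mx.
by rewrite deriveE //; apply/dg/MU.
Qed.

(** On the line a differential is determined by its value at 1, so derivatives along this single
    direction recover the tangent map. It brings the smoothness of a geodesic into the calculus of
    [Ck]. *)
Lemma Ck_of_Ck_on W (I : set R^o) k (f : R^o -> W) :
  open I -> Ck_on I setT k f -> Ck k I f.
Proof.
move=> oI; elim: k f => [|k IH] f [cf].
  by move=> _ x Ix; move: cf; rewrite continuous_open_subspace // => /(_ x); apply; rewrite inE.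
move=> /(_ 1 Logic.I)[df /IH Cf].
have df' x : I x -> differentiable f x by move=> /df/derivable1_diffP.
split => //.
have oIT : open (I `*` [set: R^o]) by exact: open_prodT.
apply: (@Ck_eq _ _ _ _ _ (fun p : R^o * R^o => (p.2 : R) *: 'D_1 f p.1)) => //.
  by move=> [x v] [/= /df'/diff1E -> _]; rewrite derive1E.
apply: (@Ck_comp _ _ _ _ _ _ setT (fun p : R^o * R^o => (p.2, 'D_1 f p.1))
  (fun p : R^o * W => (p.1 : R) *: p.2)) => //.
- exact: openT.
- apply: Ck_pair => //; first exact: Ck_snd.
  apply: (@Ck_comp _ _ _ _ _ _ I fst ('D_1 f)) => //; last exact: Ck_fst.
  by move=> [x v] [].
- by apply: Ck_scale; exact: openT.
Qed.

End SliceSmoothness.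

(** * Symmetry of second derivatives *)

Section Schwarz.
Context {R : realType}.
Implicit Types E : normedModType R.

Lemma MVT_line E (f : E -> R^o) (x v : E) (h : R) : 0 < h ->
  (forall s, 0 <= s <= h -> differentiable f (s *: v + x)) ->
  exists2 s, 0 <= s <= h & f (h *: v + x) - f x = h * 'd f (s *: v + x) v.
Proof.
move=> h0 df; pose g (s : R) := f (s *: v + x).
have Hline s : is_diff s (fun s : R => s *: v + x) (fun s => s *: v).
  have h1 : is_diff s (( *:%R^~ v : R -> E) + cst x) (( *:%R^~ v) + 0) by exact: is_diffD.
  by apply: is_diff_eq h1 _; apply/funext => t; rewrite !fctE /= addr0.
have dline s : differentiable (fun s : R => s *: v + x) s by [].
have vline s t : 'd (fun s : R => s *: v + x) s t = t *: v by rewrite diff_val.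
have dg s : 0 <= s <= h -> is_derive s 1 g ('d f (s *: v + x) v).
  move=> /df dfs; apply: DeriveDef.
    apply/derivable1_diffP; apply: (@differentiable_comp _ _ _ _ (fun s : R => s *: v + x) f).
      exact: dline.
    exact: dfs.
  rewrite -derive1E derive1E' //; last first.
    by apply: (@differentiable_comp _ _ _ _ (fun s : R => s *: v + x) f).
  rewrite (@diff_comp _ _ _ _ (fun s : R => s *: v + x) f) //= vline.
  by rewrite scale1r.
have [||s sh gE] := @MVT_segment R g (fun s => 'd f (s *: v + x) v) 0 h (ltW h0).
- by move=> s; rewrite in_itv /= => /andP[s0 sh]; apply: dg; rewrite !ltW.
- apply: continuous_in_subspaceT => s; rewrite inE /= in_itv /= => sh.
  by apply: differentiable_continuous; apply/derivable1_diffP; case: (dg s sh).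
exists s; first by move: sh; rewrite in_itv.
by move: gE; rewrite /g scale0r add0r subr0 mulrC.
Qed.

(* The second difference of f over a parallelogram, computed by applying the mean
   value theorem in the direction v and then in the direction w *)
Lemma second_difference E (U : set E) (f : E -> R^o) (x v w : E) (h : R) :
  0 < h -> open U -> Ck 2 U f ->
  (forall s t, 0 <= s <= h -> 0 <= t <= h -> U (t *: w + (s *: v + x))) ->
  exists s t, [/\ 0 <= s <= h, 0 <= t <= h &
    f (h *: w + (h *: v + x)) - f (h *: v + x) - (f (h *: w + x) - f x) =
    h * (h * 'd (fun y => 'd f y v : R^o) (t *: w + (s *: v + x)) w)].
Proof.
move=> h0 oU Cf hU; have [df _] := Cf; have [dfv _] := Ck_diffl v oU Cf.
have h00 : 0 <= h <= h by rewrite lexx ltW.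
have h01 : (0 : R) <= 0 <= h by rewrite lexx ltW.
pose g y := f (h *: w + y) - f y.
have U0 s : 0 <= s <= h -> U (s *: v + x).
  by move=> sh; have := hU s 0 sh h01; rewrite scale0r add0r.
have dsh y : U (h *: w + y) -> differentiable (fun y => f (h *: w + y)) y /\
   'd (fun y => f (h *: w + y)) y = 'd f (h *: w + y) :> (E -> R^o).
  move=> Uy; have dsh : is_diff y (fun y : E => h *: w + y) id.
    have h1 : is_diff y (cst (h *: w) + id) (0 + id) by exact: is_diffD.
    by apply: is_diff_eq h1 _; apply/funext => t; rewrite !fctE /= add0r.
  have dfy : differentiable f (h *: w + y) by exact: df.
  split; first by apply: (@differentiable_comp _ _ _ _ (fun y => h *: w + y) f).
  by rewrite (@diff_comp _ _ _ _ (fun y => h *: w + y) f) // diff_val.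
have [s sh gE] : exists2 s, 0 <= s <= h &
    g (h *: v + x) - g x = h * 'd (g : E -> R^o) (s *: v + x) v.
  apply: MVT_line => // s sh; apply: differentiableB; last exact/df/U0.
  by case: (dsh _ (hU _ _ sh h00)).
have [t th kE] : exists2 t, 0 <= t <= h &
    'd f (h *: w + (s *: v + x)) v - 'd f (s *: v + x) v =
    h * 'd (fun y => 'd f y v : R^o) (t *: w + (s *: v + x)) w.
  by apply: (@MVT_line _ (fun y => 'd f y v)) => // t th; exact/dfv/hU.
exists s, t; split => //; rewrite -kE.
have -> : 'd f (h *: w + (s *: v + x)) v - 'd f (s *: v + x) v =
    'd (g : E -> R^o) (s *: v + x) v.
  have [d1 d2] := dsh _ (hU _ _ sh h00); have d3 := df _ (U0 s sh).
  have e1 := congr1 (fun F : E -> R^o => F v) (diffB d1 d3).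
  have e2 := congr1 (fun F : E -> R^o => F v) d2.
  exact: esym (etrans e1 (congr1 (fun z : R => z - 'd f (s *: v + x) v) e2)).
by rewrite -gE /g.
Qed.

(** The second difference is symmetric in [v] and [w]. Evaluated in either order it is [h ^+ 2]
    times a mixed derivative at some point of the parallelogram, so [a] and [b] share a value near
    [x], and both are continuous at [x]. *)
Lemma schwarz_scalar E (U : set E) (f : E -> R^o) (x v w : E) :
  open U -> Ck 2 U f -> U x ->
  'd (fun y => 'd f y v : R^o) x w = 'd (fun y => 'd f y w : R^o) x v.
Proof.
move=> oU Cf Ux.
pose a y := 'd (fun y => 'd f y v : R^o) y w.
pose b y := 'd (fun y => 'd f y w : R^o) y v.
have ca : {for x, continuous a}.
  exact: (Ck_continuous (Ck_diffl w oU (Ck_diffl v oU Cf))).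
have cb : {for x, continuous b}.
  exact: (Ck_continuous (Ck_diffl v oU (Ck_diffl w oU Cf))).
rewrite -/(a x) -/(b x).
apply/eqP; rewrite -subr_eq0 -normr_le0; apply/ler_addgt0Pl => e e0.
have e2 : 0 < e / 2 by exact: divr_gt0.
have : \forall y \near x, [/\ U y, `|a x - a y| <= e / 2 & `|b x - b y| <= e / 2].
  near=> y; split; near: y.
  - exact: open_nbhs_nbhs.
  - exact: (cvgr_dist_le _ _ ca _ e2).
  - exact: (cvgr_dist_le _ _ cb _ e2).
move=> /nbhs_ballP[r /= r0 rP].
(* The parallelogram stays within [h * (|v| + |w|) < r] of [x]; the summand 1 keeps the denominator
   positive when [v] and [w] vanish. *)
pose h := r / (2 * (`|v| + `|w| + 1)).
have k0 : 0 < `|v| + `|w| + 1 by rewrite ltr_wpDl // addr_ge0.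
have h0 : 0 < h by rewrite divr_gt0 // mulr_gt0.
have hP s t u z : 0 <= s <= h -> 0 <= t <= h -> `|u| + `|z| <= `|v| + `|w| ->
    ball x r (t *: z + (s *: u + x)).
  move=> /andP[s0 sh] /andP[t0 th] uz.
  rewrite -ball_normE /= addrA opprD addrCA subrr addr0 normrN.
  rewrite (le_lt_trans (ler_normD _ _)) // !normrZ !ger0_norm //.
  rewrite (@le_lt_trans _ _ (h * (`|v| + `|w|))) //.
    rewrite (le_trans _ (ler_wpM2l (ltW h0) uz)) // mulrDr addrC.
    by rewrite lerD // ler_wpM2r.
  have -> : r = h * (2 * (`|v| + `|w| + 1)).
    by rewrite /h divfK // gt_eqF // mulr_gt0.
  rewrite ltr_pM2l //; have : 0 <= `|v| + `|w| by rewrite addr_ge0.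
  lra.
have [s [t [sh th h1]]] := second_difference (v := v) (w := w) h0 oU Cf
  (fun s t sh th => let: And3 Uy _ _ := rP _ (hP s t v w sh th (lexx _)) in Uy).
have wv : `|w| + `|v| <= `|v| + `|w| by rewrite addrC.
have [s' [t' [sh' th' h2]]] := second_difference (v := w) (w := v) h0 oU Cf
  (fun s t sh th => let: And3 Uy _ _ := rP _ (hP s t w v sh th wv) in Uy).
have {h1 h2} ab : a (t *: w + (s *: v + x)) = b (t' *: v + (s' *: w + x)).
  apply: (mulfI (lt0r_neq0 h0)); apply: (mulfI (lt0r_neq0 h0)).
  rewrite -h1 -h2 [h *: w + (h *: v + x)]addrCA; ring.
have [_ ha _] := rP _ (hP s t v w sh th (lexx _)).
have [_ _ hb] := rP _ (hP s' t' w v sh' th' wv).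
rewrite -ab in hb; set D := a (_ + _) in ha hb.
rewrite addr0 -[a x - b x](subrKA D) (le_trans (ler_normD _ _)) // [leRHS]splitr lerD //.
by rewrite distrC.
Unshelve. all: by end_near. Qed.

Lemma schwarz E m n (U : set E) (f : E -> 'M[R]_(m, n)) (x v w : E) :
  open U -> Ck 2 U f -> U x ->
  'd (fun y => 'd f y v) x w = 'd (fun y => 'd f y w) x v.
Proof.
move=> oU Cf Ux; apply/matrixP => i j.
pose L (M : 'M[R]_(m, n)) : R^o := M i j.
have lL : linear L by move=> a X Y; rewrite /L !mxE.
have cL : continuous L by exact: mx_linear_continuous.
pose LL := GRing.isLinear.Build _ _ _ _ _ lL.
pose L' : {linear 'M[R]_(m, n) -> R^o} := HB.pack L LL.
have dL (g : E -> 'M[R]_(m, n)) y u : differentiable g y ->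
    'd (L \o g) y u = L ('d g y u).
  move=> dg; rewrite diff_comp //; first by rewrite /= (@diff_lin _ _ _ L').
  exact: (@linear_differentiable _ _ _ L').
have [df _] := Cf.
have CLf : Ck 2 U (L \o f) by exact: Ck_comp_lin.
have E2 u z : 'd (fun y => 'd (L \o f) y u : R^o) x z = L ('d (fun y => 'd f y u) x z).
  have [du _] := Ck_diffl u oU Cf.
  have [||_ ->] := @near_eq_diff R _ _ (L \o (fun y => 'd f y u))
      (fun y => 'd (L \o f) y u : R^o) x.
  - have : nbhs x U by exact: open_nbhs_nbhs.
    by apply: filterS => y Uy; rewrite dL //; exact: df.
  - apply: differentiable_comp; first exact: du.
    exact: (@linear_differentiable _ _ _ L').
  - by rewrite dL //; exact: du.
by rewrite -[LHS]/(L _) -[RHS]/(L _) -!E2; exact: schwarz_scalar CLf Ux.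
Qed.

End Schwarz.

(** * The off-log metric *)

Section OffLogGeometry.
Context {R : realType}.
Local Opaque Xp Lg.

Lemma HolP n (A : 'M[R]_n) : Hol n A <-> holp A = A.
Proof. by split => [/holp_id//|<-]; exact: holp_Hol. Qed.

Lemma HolD n (A B : 'M[R]_n) : Hol n A -> Hol n B -> Hol n (A + B).
Proof.
move=> [sA A0] [sB B0]; split; first by rewrite /Sym /= linearD /= sA sB.
by move=> i; rewrite mxE A0 B0 addr0.
Qed.

Lemma HolZ n (a : R) (A : 'M[R]_n) : Hol n A -> Hol n (a *: A).
Proof.
move=> [sA A0]; split; first by rewrite /Sym /= linearZ /= sA.
by move=> i; rewrite mxE A0 mulr0.
Qed.

Lemma HolB n (A B : 'M[R]_n) : Hol n A -> Hol n B -> Hol n (A - B).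
Proof. by move=> HA HB; rewrite -scaleN1r; apply: HolD => //; exact: HolZ. Qed.

Lemma Corp_sub n (A B : 'M[R]_n) : Corp n A -> Corp n B -> Hol n (A - B).
Proof.
move=> [[sA _] A1] [[sB _] B1]; split; first by rewrite /Sym /= linearB /= sA sB.
by move=> i; rewrite !mxE A1 B1 subrr.
Qed.

Lemma Corp_line n (C V : 'M[R]_n) : Corp n C -> Hol n V ->
  \forall h \near (0 : R), Corp n (h *: V + C).
Proof.
move=> CC [sV V0]; have [[sC _] C1] := CC.
have : nbhs C (@PDs R n).
  by apply: open_nbhs_nbhs; split; [exact: open_PDs|exact: Corp_PDs].
move=> /(near0_line V); apply: filterS => h; rewrite /PDs /= symp_id.
  by move=> ?; split => // i; rewrite !mxE V0 C1 mulr0 add0r.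
by rewrite linearD linearZ /= sV sC.
Qed.

(** [Hol] is the kernel of the linear map [L], so [L \o f] is constant along the line and its
    derivative, which is [L] of the derivative of [f], is 0. *)
Lemma derive_Hol n (E : normedModType R) (f : E -> 'M[R]_n) x v : derivable f x v ->
  (\forall h \near (0 : R), Hol n (f (h *: v + x) - f x)) -> Hol n ('D_v f x).
Proof.
move=> df Hf; apply/HolP/subr0_eq.
pose L (M : 'M[R]_n) := holp M - M.
have lL : linear L.
  by move=> a X Y; rewrite /L holp_linear scalerBr opprD addrACA.
have [_ h] := derive_linear lL (mx_linear_continuous lL) df.
have [|_ E0] := @near_line_derive R _ _ (cst (L (f x))) (L \o f) x v _ (derivable_cst _ _ _).
  apply: filterS Hf => t /HolP e; apply/eqP; rewrite eq_sym -subr_eq0 /=.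
  have := lL (-1) (f x) (f (t *: v + x)); rewrite !scaleN1r [- _ + _]addrC.
  by rewrite {1}/L e subrr [- _ + _]addrC => <-.
by rewrite -/(L _) -h E0; exact: derive_cst.
Qed.

Lemma diff_Lg n (C : 'M[R]_n) : Corp n C -> differentiable (@Lg R n) C.
Proof. by move=> CC; case: (@Ck_Lg R 1 n) => + _; apply; exact: Corp_PDs. Qed.

Lemma diff_Xp n (S : 'M[R]_n) : differentiable (@Xp R n) S.
Proof. by case: (@Ck_Xp R 1 n) => + _; apply. Qed.

Definition dLg n (C V : 'M[R]_n) : 'M[R]_n := 'd (@Lg R n) C V.

Definition ddLg n (C U V : 'M[R]_n) : 'M[R]_n := 'd (fun c => dLg c V) C U.

Lemma dLgD n (C U V : 'M[R]_n) : dLg C (U + V) = dLg C U + dLg C V.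
Proof. exact: linearD. Qed.

Lemma dLg0 n (C : 'M[R]_n) : dLg C 0 = 0.
Proof. exact: linear0. Qed.

Lemma derive_LogOL n (C V : 'M[R]_n) : Corp n C -> Hol n V ->
  'D_V (@LogOL R n) C = dLg C V.
Proof.
move=> CC HV; rewrite /dLg -deriveE; last exact: diff_Lg.
have [||//] := @near_line_derive R _ _ (@Lg R n) (@LogOL R n) C V.
- by apply: filterS (Corp_line CC HV) => h /Lg_LogOL.
- by apply: diff_derivable; exact: diff_Lg.
Qed.

Lemma dLg_Hol n (C V : 'M[R]_n) : Corp n C -> Hol n V -> Hol n (dLg C V).
Proof.
move=> CC HV; rewrite /dLg -deriveE; last exact: diff_Lg.
apply: derive_Hol; first by apply: diff_derivable; exact: diff_Lg.
apply: filterS (Corp_line CC HV) => h Ch.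
by apply: HolB; apply: Lg_Hol; exact: Corp_PDs.
Qed.

Lemma dXp_Hol n (S V : 'M[R]_n) : Hol n ('d (@Xp R n) S V).
Proof.
rewrite -deriveE; last exact: diff_Xp.
apply: derive_Hol; first by apply: diff_derivable; exact: diff_Xp.
by near=> h; apply: Corp_sub; exact: Xp_Corp.
Unshelve. all: by end_near. Qed.

Lemma diff_line_id n (f : 'M[R]_n -> 'M[R]_n) x v : differentiable f x ->
  (\forall h \near (0 : R), f (h *: v + x) = h *: v + x) -> 'd f x v = v.
Proof.
move=> df fid; rewrite -deriveE // -[RHS](derive_id x v).
have [||_ //] := @near_line_derive R _ _ f id x v; first exact: fid.
exact: diff_derivable.
Qed.

Lemma diff_comp_val (E F W : normedModType R) (f : E -> F) (g : F -> W) x v :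
  differentiable f x -> differentiable g (f x) ->
  'd (g \o f) x v = 'd g (f x) ('d f x v).
Proof. by move=> df dg; rewrite diff_comp. Qed.

(** The identity [Xp (Lg C) = C] is available on [Corp], so it is differentiated only along [Hol],
    where the line stays in [Corp]. *)
Lemma dXp_dLg n (C V : 'M[R]_n) : Corp n C -> Hol n V ->
  'd (@Xp R n) (Lg C) (dLg C V) = V.
Proof.
move=> CC HV.
have dL := diff_Lg CC; have dX := diff_Xp (Lg C).
have : 'd (@Xp R n \o @Lg R n) C V = V.
  apply: diff_line_id; first exact: differentiable_comp.
  by apply: filterS (Corp_line CC HV) => h /LgK.
exact: etrans (esym (diff_comp_val V dL dX)).
Qed.

Lemma dLg_dXp n (S V : 'M[R]_n) : Hol n S -> Hol n V ->
  dLg (Xp S) ('d (@Xp R n) S V) = V.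
Proof.
move=> HS HV.
have dX := diff_Xp S; have dL := diff_Lg (Xp_Corp S).
have : 'd (@Lg R n \o @Xp R n) S V = V.
  apply: diff_line_id; first exact: differentiable_comp.
  by near=> h; apply: XpK; apply: HolD => //; exact: HolZ.
exact: etrans (esym (diff_comp_val V dX dL)).
Unshelve. all: by end_near. Qed.

Lemma dLg_inj n (C V : 'M[R]_n) : Corp n C -> Hol n V -> dLg C V = 0 -> V = 0.
Proof. by move=> CC HV h; rewrite -(dXp_dLg CC HV) h linear0. Qed.

Lemma dLg_surj n (C V : 'M[R]_n) : Corp n C -> Hol n V ->
  exists2 Z, Hol n Z & dLg C Z = V.
Proof.
move=> CC HV; exists ('d (@Xp R n) (Lg C) V); first exact: dXp_Hol.
by rewrite -{1}(LgK CC) dLg_dXp //; apply: Lg_Hol; exact: Corp_PDs.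
Qed.

Lemma frobeniusC n (A B : 'M[R]_n) : frobenius A B = frobenius B A.
Proof. exact: mxtrace_mulC. Qed.

Lemma derive_frobenius n (E : normedModType R) (a b : E -> 'M[R]_n) x v :
  differentiable a x -> differentiable b x ->
  derivable (fun y => frobenius (a y) (b y) : R^o) x v /\
  'D_v (fun y => frobenius (a y) (b y) : R^o) x =
    frobenius ('d a x v) (b x) + frobenius (a x) ('d b x v).
Proof.
move=> da db.
have bl : bilinear_for
    (GRing.Scale.Law.clone _ _ *:%R _) (GRing.Scale.Law.clone _ _ *:%R _)
    (@frobenius R n : 'M[R]_n -> 'M[R]_n -> R^o).
  split=> [u'|u] k X Y; rewrite /frobenius.
    by rewrite mulmxDl -scalemxAl linearP.
  by rewrite mulmxDr -scalemxAr linearP.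
pose M := bilinear_isBilinear.Build _ _ _ _ _ _ _ bl.
pose B : {bilinear 'M[R]_n -> 'M[R]_n -> R^o} :=
  HB.pack (@frobenius R n : 'M[R]_n -> 'M[R]_n -> R^o) M.
have cB : continuous (fun p : 'M[R]_n * 'M[R]_n => B p.1 p.2).
  have -> : (fun p : 'M[R]_n * 'M[R]_n => B p.1 p.2) =
      (fun p => \sum_i \sum_j p.1 i j * p.2 j i).
    by apply/funext => p; apply: eq_bigr => i _; rewrite mxE.
  have cadd : continuous (fun z : R * R => z.1 + z.2) by exact: add_continuous.
  apply: continuous_big => [|i _]; first exact: cadd.
  apply: continuous_big => [|j _]; first exact: cadd.
  move=> p; apply: continuousM.
    apply: (@continuous_comp _ _ _ fst (fun M : 'M[R]_n => M i j)); first exact: cvg_fst.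
    exact: coord_continuous.
  apply: (@continuous_comp _ _ _ snd (fun M : 'M[R]_n => M j i)); first exact: cvg_snd.
  exact: coord_continuous.
have dab : differentiable (fun y => (a y, b y)) x by exact: differentiable_pair.
have dB := differentiable_bilin (a x, b x) cB.
have dF : differentiable (fun y => frobenius (a y) (b y) : R^o) x.
  exact: (@differentiable_comp _ _ _ _ (fun y => (a y, b y))
    (fun p : 'M[R]_n * 'M[R]_n => B p.1 p.2)).
split; first exact: diff_derivable.
have e1 := @diff_comp_val _ _ _ (fun y => (a y, b y)) (fun p => B p.1 p.2) x v dab dB.
have e2 : 'd (fun p => B p.1 p.2) (a x, b x) ('d a x v, 'd b x v) =
    B (a x) ('d b x v) + B ('d a x v) (b x) by rewrite diff_bilin.
have e3 : 'd (fun y => (a y, b y)) x v = ('d a x v, 'd b x v) by rewrite diff_pair.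
rewrite deriveE //; rewrite e3 e2 in e1.
by apply: (etrans e1); rewrite addrC.
Qed.

Lemma diff_dLg n (C V : 'M[R]_n) : Corp n C -> differentiable (fun c => dLg c V) C.
Proof.
move=> CC; have [+ _] := Ck_diffl V (@open_PDs R n) (@Ck_Lg R 2 n).
by apply; exact: Corp_PDs.
Qed.

Lemma ddLg_Hol n (C U V : 'M[R]_n) : Corp n C -> Hol n U -> Hol n V ->
  Hol n (ddLg C U V).
Proof.
move=> CC HU HV; rewrite /ddLg -deriveE; last exact: diff_dLg.
apply: derive_Hol; first by apply: diff_derivable; exact: diff_dLg.
apply: filterS (Corp_line CC HU) => h Ch.
by apply: HolB; exact: dLg_Hol.
Qed.

Lemma ddLgC n (C U V : 'M[R]_n) : Corp n C -> ddLg C U V = ddLg C V U.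
Proof.
by move=> CC; apply: (schwarz _ _ (@open_PDs R n) (@Ck_Lg R 2 n)); exact: Corp_PDs.
Qed.

Lemma gOLE n (C V W : 'M[R]_n) : Corp n C -> Hol n V -> Hol n W ->
  gOL C V W = frobenius (dLg C V) (dLg C W).
Proof. by move=> CC HV HW; rewrite /gOL !derive_LogOL. Qed.

Lemma derive_gOL n (C U V W : 'M[R]_n) : Corp n C -> Hol n U -> Hol n V -> Hol n W ->
  'D_U (fun c => gOL c V W : R^o) C =
    frobenius (ddLg C U V) (dLg C W) + frobenius (dLg C V) (ddLg C U W).
Proof.
move=> CC HU HV HW.
have [d1 <-] := derive_frobenius U (diff_dLg V CC) (diff_dLg W CC).
have [||_ //] := @near_line_derive R _ _ (fun c => frobenius (dLg c V) (dLg c W) : R^o)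
  (fun c => gOL c V W : R^o) C U; last exact: d1.
by apply: filterS (Corp_line CC HU) => h Ch; rewrite gOLE.
Qed.

Lemma frobeniusBl n (A B C : 'M[R]_n) :
  frobenius (A - B) C = frobenius A C - frobenius B C.
Proof. by rewrite /frobenius mulmxBl linearB. Qed.

Local Opaque dLg ddLg frobenius.

Lemma frobenius_nondeg n (A : 'M[R]_n) : Hol n A ->
  (forall B, Hol n B -> frobenius A B = 0) -> A = 0.
Proof.
move=> HA /(_ A HA) h; have [sA _] := HA.
by apply: frobenius_eq0 => //; rewrite le_eqVlt; apply/orP; left; apply/eqP.
Qed.

(* In the coordinate Lg the metric is constant; transporting the vanishing
   Christoffel symbols back gives Z with dLg C Z = ddLg C U U. *)
Lemma christoffel_corOL n (C U : 'M[R]_n) : Corp n C -> Hol n U ->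
  Hol n (christoffel (corOL R n) C U U) /\
  dLg C (christoffel (corOL R n) C U U) = ddLg C U U.
Proof.
move=> CC HU.
(* Each derivative of the metric is a sum of two products. The terms pairing [dLg C U] with a mixed
   second derivative of [Lg] cancel by [ddLgC]. *)
have koszul W : Hol n W -> 2^-1 * ('D_U (fun c => gOL c U W : R^o) C
    + 'D_U (fun c => gOL c U W : R^o) C - 'D_W (fun c => gOL c U U : R^o) C) =
    frobenius (ddLg C U U) (dLg C W).
  move=> HW.
  have alg (a b x z : R) : x = a + b -> z = b + b -> 2^-1 * (x + x - z) = a.
    by move=> -> ->; field.
  apply: alg (derive_gOL CC HU HU HW) _.
  rewrite (derive_gOL CC HW HU HU) (ddLgC W U CC).
  exact: (congr1 (fun z => z + frobenius (dLg C U) (ddLg C U W))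
    (frobeniusC (ddLg C U W) (dLg C U))).
rewrite /christoffel; case: xgetP => [Z _|h]; last first.
  (* The default value of [xget] is excluded: surjectivity of [dLg C] on [Hol] supplies a tangent
     vector with the Koszul property. *)
  have [Z HZ dZ] := dLg_surj CC (ddLg_Hol CC HU HU).
  case: (h Z); split => // W HW /=; rewrite koszul // gOLE // dZ.
  by [].
move=> [/= HZ ZP]; split => //; apply/subr0_eq/frobenius_nondeg.
  by apply: HolB; [exact: dLg_Hol|exact: ddLg_Hol].
move=> B HB; have [W HW <-] := dLg_surj CC HB.
have := ZP W HW; rewrite koszul // gOLE // => e.
by rewrite frobeniusBl e subrr.
Qed.

End OffLogGeometry.

(** * Chain rules along curves *)

Section CurveDerivatives.
Context {R : realType}.
Implicit Types E W : normedModType R.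

Lemma derive1_near_eq W (f g : R -> W) (I : set R) (t : R) : open I -> I t ->
  (forall s, I s -> f s = g s) -> derive1 f t = derive1 g t.
Proof.
move=> oI It fg; rewrite !derive1E; apply: near_eq_derive.
have : nbhs t I by exact: open_nbhs_nbhs.
by apply: filterS => s /fg.
Qed.

Lemma derive1_diff W (f : R^o -> W) (t : R) : differentiable f t ->
  derive1 (f : R -> W) t = 'd f t 1.
Proof. by move=> df; rewrite derive1E'. Qed.

Lemma derive1_comp_curve E W (U : set E) (I : set R^o) (L : E -> W) (c : R^o -> E) t :
  open U -> open I -> Ck 1 U L -> Ck 1 I c -> (forall s, I s -> U (c s)) -> I t ->
  derive1 (L \o c : R -> W) t = 'd L (c t) (derive1 (c : R -> E) t).
Proof.
move=> oU oI [dL _] [dc _] cU It.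
have d1 : differentiable c t by exact: dc.
have d2 : differentiable L (c t) by exact/dL/cU.
rewrite (derive1_diff d1) derive1_diff; last exact: differentiable_comp.
exact: diff_comp_val.
Qed.

Lemma diff_pairl E W (w : W) (x : E) :
  differentiable (fun y => (y, w)) x /\ forall u, 'd (fun y => (y, w)) x u = (u, 0).
Proof.
have h : is_diff x (fun y : E => (y, w)) (fun y => (y, 0)).
  exact: is_diff_pair (is_diff_id x) (is_diff_cst w x).
by split => [|u]; [exact: ex_diff|rewrite diff_val].
Qed.

Lemma diff_pairr E W (x : E) (w : W) :
  differentiable (fun y => (x, y)) w /\ forall u, 'd (fun y => (x, y)) w u = (0, u).
Proof.
have h : is_diff w (fun y : W => (x, y)) (fun y => (0, y)).
  exact: is_diff_pair (is_diff_cst x w) (is_diff_id w).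
by split => [|u]; [exact: ex_diff|rewrite diff_val].
Qed.

(** The first order chain rule is applied twice, the second time to the tangent map [G] along the
    lifted curve [cv]; splitting the velocity as [(w, 0) + (0, a)] separates the two terms. *)
Lemma derive1_derive1_comp E W (U : set E) (I : set R^o) (L : E -> W) (c : R^o -> E) t :
  open U -> open I -> Ck 2 U L -> Ck 2 I c -> (forall s, I s -> U (c s)) -> I t ->
  let u := derive1 (c : R -> E) t in
  derive1 (derive1 (L \o c : R -> W)) t =
    'd (fun x => 'd L x u) (c t) u + 'd L (c t) (derive1 (derive1 (c : R -> E)) t).
Proof.
move=> oU oI CL Cc cU It u.
pose v (s : R^o) : E := 'd c s 1.
have Cv : Ck 1 I v by exact: Ck_diffl.
have [dc _] := Cc; have [dv _] := Cv; have [dL CTL] := CL.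
have vE s : I s -> derive1 (c : R -> E) s = v s by move=> Is; apply/derive1_diff/dc.
pose G (p : E * E) := 'd L (p.1 : E) p.2.
pose cv (s : R^o) := (c s, v s).
have Ccv : Ck 1 I cv by exact: (Ck_pair oI (CkW Cc) Cv).
have -> : derive1 (derive1 (L \o c : R -> W)) t = derive1 (G \o cv : R -> W) t.
  apply: derive1_near_eq It _ => // s Is.
  by rewrite (derive1_comp_curve oU oI (CkW CL) (CkW Cc) cU Is) vE.
rewrite (derive1_comp_curve (open_prodT oU) oI CTL Ccv) //; last first.
  by move=> s Is; split => //; exact: cU.
have -> : derive1 (derive1 (c : R -> E)) t = derive1 (v : R -> E) t.
  exact: derive1_near_eq It vE.
have dcv : differentiable cv t by case: Ccv => + _; apply.
have dct := dc t It; have dvt := dv t It.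
have -> : u = v t by exact: vE.
have dcvE : 'd cv t 1 = (v t, 'd v t 1).
  exact: (congr1 (fun F : R^o -> E * E => F 1) (diff_pair dct dvt)).
rewrite (derive1_diff dcv) (derive1_diff dvt) dcvE.
have -> : cv t = (c t, v t) by [].
move: (c t) (v t) ('d v t 1) (cU t It) => x w a Ux.

have dG : differentiable G (x, w).
  by case: CTL => + _; apply.
have -> : (w, a) = (w, 0) + (0, a) by congr pair; rewrite /= ?addr0 ?add0r.
rewrite linearD; congr (_ + _).
  have [d1 e1] := diff_pairl w x.
  by have := diff_comp_val w d1 dG; rewrite e1.
have [d1 e1] := diff_pairr x w.
have h := diff_comp_val a d1 dG; rewrite e1 in h; rewrite -h.
have cL : continuous ('d L x) by apply/diff_continuous/dL.
exact: (congr1 (fun F : E -> W => F a) (diff_lin w cL)).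
Qed.

End CurveDerivatives.

(** * Geodesics, and maps that are linear isometries in off-log coordinates *)

Section OffLogGeodesics.
Context {R : realType}.

Lemma derive1_curve_Hol n (I : set R^o) (c : R^o -> 'M[R]_n) t :
  open I -> Ck 2 I c -> (forall s, I s -> Corp n (c s)) -> I t ->
  Hol n (derive1 (c : R -> 'M[R]_n) t) /\
  Hol n (derive1 (derive1 (c : R -> 'M[R]_n)) t).
Proof.
move=> oI Cc cC It; have [dc _] := Cc.
have nI s : I s -> \forall h \near (0 : R), I (h *: (1 : R^o) + s).
  by move=> Is; apply: near0_line; exact: open_nbhs_nbhs.
have H1 s : I s -> Hol n (derive1 (c : R -> 'M[R]_n) s).
  move=> Is; rewrite derive1E; apply: derive_Hol.
    by apply/derivable1_diffP/dc.
  by apply: filterS (nI s Is) => h Ih; apply: Corp_sub; exact: cC.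
split; first exact: H1.
have [dv _] := Ck_diffl (1 : R^o) oI Cc.
have vE s : I s -> derive1 (c : R -> 'M[R]_n) s = 'd c s 1.
  by move=> Is; apply/derive1_diff/dc.
rewrite (derive1_near_eq oI It vE) derive1E; apply: derive_Hol.
  by apply/derivable1_diffP/dv.
have sub x x' y y' : x = x' -> y = y' -> Hol n (x - y) -> Hol n (x' - y').
  by move=> -> ->.
apply: filterS (nI t It) => h Ih.
exact: sub (vE _ Ih) (vE _ It) (HolB (H1 _ Ih) (H1 _ It)).
Qed.

(** The second derivative of [Lg \o c] is [ddLg] at the velocity plus [dLg] of the acceleration,
    that is, [dLg] of the left side of the geodesic equation; [dLg] is injective on [Hol]. *)
Lemma geodesic_eq_iff n (I : set R^o) (c : R^o -> 'M[R]_n) t :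
  open I -> Ck 2 I c -> (forall s, I s -> Corp n (c s)) -> I t ->
  let u := derive1 (c : R -> 'M[R]_n) t in
  derive1 (derive1 (c : R -> 'M[R]_n)) t + christoffel (corOL R n) (c t) u u = 0 <->
  derive1 (derive1 (@Lg R n \o c : R -> 'M[R]_n)) t = 0.
Proof.
move=> oI Cc cC It u.
have cU s : I s -> PDs (c s) by move=> /cC/Corp_PDs.
have [Hu Ha] := derive1_curve_Hol oI Cc cC It.
pose a := derive1 (derive1 (c : R -> 'M[R]_n)) t.
have E : derive1 (derive1 (@Lg R n \o c : R -> 'M[R]_n)) t =
    ddLg (c t) u u + dLg (c t) a.
  exact: (derive1_derive1_comp (@open_PDs R n) oI (@Ck_Lg R 2 n) Cc cU It).
have [HZ ZE] := christoffel_corOL (cC t It) Hu.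
rewrite -/a E -ZE -dLgD addrC; split=> [-> |h]; first exact: dLg0.
exact: dLg_inj (cC t It) (HolD HZ Ha) h.
Qed.

Context (m n : nat) (lam : 'M[R]_m -> 'M[R]_n) (rho : 'M[R]_n -> 'M[R]_m)
  (f : 'M[R]_m -> 'M[R]_n).
Context (lam_lin : linear lam) (rho_lin : linear rho).
Context (lam_Hol : forall S, Hol m S -> Hol n (lam S))
  (lam_iso : forall S T, Hol m S -> Hol m T ->
     frobenius (lam S) (lam T) = frobenius S T)
  (lamK : forall S, Hol m S -> rho (lam S) = S)
  (fE : forall C, Corp m C -> f C = Xp (lam (Lg C))).

(** Nothing is known of [f] off [Corp], so differentials are taken of [F], which is smooth on the
    open set [PDs] and agrees with [f] on [Corp]. *)
Let F (C : 'M[R]_m) : 'M[R]_n := Xp (lam (Lg C)).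

Let Ck_F k : Ck k (@PDs R m) F.
Proof.
apply: (@Ck_compT _ _ _ _ _ _ (fun C => lam (Lg C))) (@Ck_Xp R k n).
  exact: open_PDs.
apply: (Ck_comp_lin (@open_PDs R m) lam_lin _ (@Ck_Lg R k m)).
exact: mx_linear_continuous.
Qed.

Let diff_F C : Corp m C -> differentiable F C.
Proof. by move=> /Corp_PDs PC; case: (Ck_F 1) => + _; apply. Qed.

Let F_Corp C : Corp n (F C). Proof. exact: Xp_Corp. Qed.

Let LgF C : PDs C -> Lg (F C) = lam (Lg C).
Proof. by move=> PC; apply/XpK/lam_Hol/Lg_Hol. Qed.

Let dF_Hol C V : Corp m C -> Hol n ('d F C V).
Proof.
move=> CC; rewrite -deriveE; last exact: diff_F.
apply: derive_Hol; first by apply: diff_derivable; exact: diff_F.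
by near=> h; apply: Corp_sub; exact: F_Corp.
Unshelve. all: by end_near. Qed.

Let dLgF C V : Corp m C -> dLg (F C) ('d F C V) = lam (dLg C V).
Proof.
move=> CC.
have e1 := diff_comp_val V (diff_F CC) (diff_Lg (F_Corp C)).
pose ML := GRing.isLinear.Build _ _ _ _ _ lam_lin.
pose L : {linear 'M[R]_m -> 'M[R]_n} := HB.pack lam ML.
have cL : continuous L by exact: mx_linear_continuous.
have dL : differentiable L (Lg C) by exact: linear_differentiable.
have e2 := diff_comp_val V (diff_Lg CC) dL.
have e3 : 'd L (Lg C) ('d (@Lg R m) C V) = lam (dLg C V).
  exact: (congr1 (fun G : 'M[R]_m -> 'M[R]_n => G ('d (@Lg R m) C V)) (diff_lin (Lg C) cL)).
have nE : \near C, (L \o @Lg R m) C = (@Lg R n \o F) C.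
  have : nbhs C (@PDs R m).
    by apply: open_nbhs_nbhs; split; [exact: open_PDs|exact: Corp_PDs].
  by apply: filterS => D PD; exact/esym/LgF.
have [_ e4] := near_eq_diff nE (differentiable_comp (diff_Lg CC) dL).
have {}e4 := congr1 (fun G : 'M[R]_m -> 'M[R]_n => G V) e4.
exact: etrans (esym e1) (etrans e4 (etrans e2 e3)).
Qed.

Let derive_f C V : Corp m C -> Hol m V -> 'D_V f C = 'd F C V.
Proof.
move=> CC HV; rewrite -deriveE; last exact: diff_F.
have [||_ //] := @near_line_derive R _ _ F f C V.
- by apply: filterS (Corp_line CC HV) => h /fE.
- by apply: diff_derivable; exact: diff_F.
Qed.

Let f_smooth k : Ck_on (Corp m) (Hol m) k f.
Proof.
apply: (Ck_on_of_Ck (@open_PDs R m) _ _ fE (Ck_F k)) => [C|C V].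
  exact: Corp_PDs.
exact: Corp_line.
Qed.

Let f_inj : set_inj (Corp m) f.
Proof.
move=> C D /set_mem CC /set_mem CD; rewrite (fE CC) (fE CD) => e.
have PC := Corp_PDs CC; have PD := Corp_PDs CD.
have e1 : lam (Lg C) = lam (Lg D).
  exact: etrans (esym (LgF PC)) (etrans (congr1 (@Lg R n) e) (LgF PD)).
have e2 : Lg C = Lg D.
  exact: etrans (esym (lamK (Lg_Hol PC))) (etrans (congr1 rho e1) (lamK (Lg_Hol PD))).
exact: etrans (esym (LgK CC)) (etrans (congr1 (@Xp R m) e2) (LgK CD)).
Qed.

Let f_embedding : smooth_embedding (corOL R m) (corOL R n) f.
Proof.
split.
- by move=> C CC; rewrite /= (fE CC); exact: Xp_Corp.
- exact: f_smooth.
- move=> C V CC HV d0; rewrite (derive_f CC HV) in d0.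
  have HL := dLg_Hol CC HV.
  apply: (dLg_inj CC HV); rewrite -(lamK HL) -(dLgF V CC) d0.
  rewrite dLg0.
  have := rho_lin (-1) 0 0; rewrite !scaleN1r !oppr0 addr0 => ->.
  by rewrite addNr.
- exact: f_inj.
(* The left inverse [rho] extends the inverse of [f] from its image to the open set [PDs], where
   continuity is immediate. *)
- pose g y : 'M[R]_m := Xp (rho (Lg y)).
  apply: (@within_eq R _ _ _ _ g).
    move=> _ [C CC <-]; have PC := Corp_PDs CC.
    have pK : 'pinv_(fun=> 0) (Corp m) f (f C) = C.
      by apply: pinvKV; [exact: f_inj|rewrite inE].
    apply: (etrans pK); rewrite (fE CC) /g.
    have e : rho (Lg (F C)) = Lg C.
      exact: etrans (congr1 rho (LgF PC)) (lamK (Lg_Hol PC)).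
    by rewrite e LgK.
  apply: continuous_in_subspaceT => y /set_mem [C CC <-].
  have Cg : Ck 0 (@PDs R n) g.
    apply: (@Ck_compT _ _ _ _ _ _ (fun y => rho (Lg y))) (@Ck_Xp R 0 m).
      exact: open_PDs.
    apply: (Ck_comp_lin (@open_PDs R n) rho_lin _ (@Ck_Lg R 0 n)).
    exact: mx_linear_continuous.
  by apply: Cg; rewrite (fE CC); apply: Corp_PDs; exact: Xp_Corp.
Qed.

Let f_isometric : isometric (corOL R m) (corOL R n) f.
Proof.
move=> C V W CC HV HW.
change (gOL (f C) ('D_V f C) ('D_W f C) = gOL C V W).
rewrite (derive_f CC HV) (derive_f CC HW) (fE CC).
rewrite (gOLE (F_Corp C) (dF_Hol V CC) (dF_Hol W CC)) (gOLE CC HV HW).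
rewrite (dLgF V CC) (dLgF W CC).
by apply: lam_iso; exact: dLg_Hol.
Qed.

(** In off-log coordinates the image curve is [lam] of the original one, so its second derivative is
    [lam 0 = 0]. *)
Let f_totally_geodesic : totally_geodesic (corOL R m) (corOL R n) f.
Proof.
move=> I c [oI itvI sc cC geo].
have Cc k : Ck k (I : set R^o) (c : R^o -> 'M[R]_m) by apply: Ck_of_Ck_on.
have cU s : I s -> PDs (c s) by move=> /cC/Corp_PDs.
have fcE s : I s -> (f \o c) s = (F \o c) s by move=> Is; rewrite /= fE //; exact: cC.
have CFc k : Ck k (I : set R^o) (F \o c : R^o -> 'M[R]_n).
  exact: (Ck_comp oI (@open_PDs R m) cU (Cc k) (Ck_F k)).
have Cfc k : Ck k (I : set R^o) (f \o c : R^o -> 'M[R]_n).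
  by apply: Ck_eq oI _ (CFc k) => s Is; rewrite fcE.
have fcC s : I s -> Corp n ((f \o c) s) by move=> Is; rewrite fcE //; exact: F_Corp.
split => //.
- move=> k; apply: (Ck_on_of_Ck oI _ _ _ (Cfc k)) => // s v Is _.
  by apply: near0_line; exact: open_nbhs_nbhs.
- move=> t It; apply/(geodesic_eq_iff oI (Cfc 2%N) fcC It).
  have h : derive1 (derive1 (@Lg R m \o c : R -> 'M[R]_m)) t = 0.
    by apply/(geodesic_eq_iff oI (Cc 2%N) cC It); exact: geo.
  pose s := @Lg R m \o c.
  have Cs : Ck 2 (I : set R^o) (s : R^o -> 'M[R]_m).
    exact: (Ck_comp oI (@open_PDs R m) cU (Cc 2%N) (@Ck_Lg R 2 m)).
  have cl : continuous lam by exact: mx_linear_continuous.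
  have sE r : I r -> (@Lg R n \o (f \o c)) r = (lam \o s) r.
    by move=> Ir; rewrite [LHS]/= -/((f \o c) r) fcE //; exact: LgF (cU r Ir).
  have e1 r : I r -> derive1 (@Lg R n \o (f \o c) : R -> 'M[R]_n) r =
      lam (derive1 (s : R -> 'M[R]_m) r).
    move=> Ir; rewrite (derive1_near_eq oI Ir sE) !derive1E.
    have ds : derivable (s : R -> 'M[R]_m) r 1 by apply/derivable1_diffP; case: Cs => + _; apply.
    by have [_ ->] := derive_linear lam_lin cl ds.
  have dds : derivable (derive1 (s : R -> 'M[R]_m)) t 1.
    have [ds _] := Cs; have [dds _] := Ck_diffl (1 : R^o) oI Cs.
    have : derivable (fun r => 'd (s : R^o -> 'M[R]_m) r 1 : 'M[R]_m) t 1.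
      by apply/derivable1_diffP/dds.
    apply: near_eq_derivable.
    have : nbhs t I by exact: open_nbhs_nbhs.
    by apply: filterS => r Ir; apply/esym/derive1_diff/ds.
  rewrite (derive1_near_eq oI It e1) derive1E.
  have [_ ->] := derive_linear lam_lin cl dds.
  rewrite -derive1E [X in lam X]h.
  by have := lam_lin (-1) 0 0; rewrite !scaleN1r !oppr0 addr0 addNr.
Qed.

Lemma off_log_linear_TGIE :
  totally_geodesic_isometric_embedding (corOL R m) (corOL R n) f.
Proof. by split. Qed.

End OffLogGeodesics.

(** * The maps E_n *)

Section Extension.
Context {R : realType}.

Definition diag_lift n (S : 'M[R]_n) : 'cV[R]_n := (Num.sqrt 2)^-1 *: \col_i S i i.

(* [psiOL], with the size of its codomain kept in the form [1 + n] *)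
Definition psib n (S : 'M[R]_n) : 'M[R]_(1 + n) :=
  block_mx 0 (diag_lift S)^T (diag_lift S) (off S).

(** The inverse of [psiOL] between [Sym n] and [Hol n.+1]: the first column, rescaled by [sqrt 2],
    returns to the diagonal. *)
Definition psiOLV n (M : 'M[R]_(1 + n)) : 'M[R]_n :=
  off (drsubmx M) + diag_mx (Num.sqrt 2 *: (dlsubmx M)^T).

Lemma diag_lift_linear n : linear (@diag_lift n).
Proof. by move=> a X Y; apply/matrixP => i j; rewrite !mxE; ring. Qed.

Lemma psib_linear n : linear (@psib n).
Proof.
move=> a X Y; rewrite /psib diag_lift_linear off_linear.
rewrite scale_block_mx add_block_mx scaler0 addr0.
by congr (block_mx _ _ _ _); rewrite linearD linearZ.
Qed.

Lemma psiOL_linear n : linear (@psiOL R n).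
Proof. exact: psib_linear. Qed.

Lemma psiOLV_linear n : linear (@psiOLV n).
Proof.
move=> a X Y; apply/matrixP => i j; rewrite !mxE.
by case: eqVneq => _; rewrite ?mulr1n ?mulr0n; ring.
Qed.

Lemma sqrt2_neq0 : Num.sqrt 2 != 0 :> R.
Proof. by rewrite gt_eqF // sqrtr_gt0. Qed.

Lemma psiOLK n (S : 'M[R]_n) : psiOLV (psiOL S) = S.
Proof.
rewrite -[psiOL S]/(psib S) /psiOLV block_mxKdr block_mxKdl.
apply/matrixP => i j; rewrite !mxE; case: eqVneq => [->|_]; last first.
  by rewrite mulr0n addr0.
by rewrite mulr1n add0r mulrA mulfV ?mul1r // sqrt2_neq0.
Qed.

Lemma psib_Hol n (S : 'M[R]_n) : Sym n S -> Hol (1 + n) (psib S).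
Proof.
move=> sS; split.
  rewrite /Sym /= tr_block_mx trmx0 trmxK; congr (block_mx _ _ _ _).
  apply/matrixP => i j; rewrite !mxE eq_sym; case: ifP => // _.
  by rewrite -[in LHS]sS mxE.
move=> i; rewrite -[i]splitK; case: (fintype.split i) => k /=.
  by rewrite block_mxEul mxE.
by rewrite block_mxEdr mxE eqxx.
Qed.

Lemma psiOL_Hol n (S : 'M[R]_n) : Sym n S -> Hol n.+1 (psiOL S).
Proof. exact: psib_Hol. Qed.

Lemma psibVK n (M : 'M[R]_(1 + n)) : Hol (1 + n) M -> psib (psiOLV M) = M.
Proof.
move=> [sM M0]; rewrite -[RHS]submxK /psib.
have -> : ulsubmx M = 0 by apply/matrixP => i j; rewrite !ord1 !mxE M0.
have -> : ursubmx M = (dlsubmx M)^T by rewrite trmx_dlsub sM.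
have -> : diag_lift (psiOLV M) = dlsubmx M.
  apply/matrixP => i j; rewrite ord1 !mxE !eqxx add0r mulr1n mulrA mulVf ?mul1r //.
congr (block_mx _ _ _ _); apply/matrixP => i j; rewrite !mxE.
by case: eqVneq => [->|_]; [rewrite M0|rewrite mulr0n addr0].
Qed.

Lemma psiOLVK n (M : 'M[R]_(1 + n)) : Hol n.+1 M -> psiOL (psiOLV M) = M.
Proof. exact: psibVK. Qed.

Lemma psiOLV_Sym n (M : 'M[R]_(1 + n)) : Hol n.+1 M -> Sym n (psiOLV M).
Proof.
move=> [sM _]; rewrite /Sym /= /psiOLV linearD /= tr_diag_mx; congr (_ + _).
apply/matrixP => i j; rewrite !mxE eq_sym; case: ifP => // _.
by rewrite -[in LHS]sM mxE.
Qed.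

(** On [Hol] the lifted diagonal is zero, so [psib] merely adds a zero row and column. *)
Lemma psib_frobenius n (S T : 'M[R]_n) : Hol n S -> Hol n T ->
  frobenius (psib S) (psib T) = frobenius S T.
Proof.
have psibE (A : 'M[R]_n) : Hol n A -> psib A = block_mx 0 0 0 A.
  move=> HA; rewrite /psib (off_id HA); have [_ A0] := HA.
  have -> : diag_lift A = 0 by apply/matrixP => i j; rewrite !mxE A0 mulr0.
  by rewrite trmx0.
move=> HS HT; rewrite (psibE S HS) (psibE T HT) /frobenius.
by rewrite mulmx_block !mul0mx !mulmx0 !add0r mxtrace_block mxtrace0 add0r.
Qed.

Lemma psiOL_frobenius n (S T : 'M[R]_n) : Hol n S -> Hol n T ->
  frobenius (psiOL S) (psiOL T) = frobenius S T.
Proof. exact: psib_frobenius. Qed.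

Lemma PhiOLE n (X : 'M[R]_n) : SymPD n X -> PhiOL X = Xp (psiOL (logm X)).
Proof.
move=> PX; rewrite Xp_ExpOL; last by apply/psiOL_Hol/logm_sym.
by rewrite /PhiOL /ExpOL addrC.
Qed.

(** [PhiOL] is the composite of [logm], [psiOL] and [Xp], each invertible on the sets concerned. As
    [PhiOLV] is a chosen partial inverse, its value is reached through the injectivity of [PhiOL] on
    [SymPD]. *)
Lemma PhiOLVE n (C : 'M[R]_n.+1) : Corp n.+1 C ->
  PhiOLV C = expm (psiOLV (Lg C)).
Proof.
move=> CC; have HL := Lg_Hol (Corp_PDs CC).
have sL := psiOLV_Sym HL.
have PX := expm_SymPD sL.
have e : PhiOL (expm (psiOLV (Lg C))) = C.
  by rewrite PhiOLE // logmK // psiOLVK // LgK.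
have Phi_inj : {in SymPD n &, injective (@PhiOL R n)}.
  move=> X Y /set_mem pX /set_mem pY; rewrite (PhiOLE pX) (PhiOLE pY) => eXY.
  have HX := psiOL_Hol (logm_sym pX); have HY := psiOL_Hol (logm_sym pY).
  have e1 := etrans (esym (XpK HX)) (etrans (congr1 (@Lg R n.+1) eXY) (XpK HY)).
  have e2 := etrans (esym (psiOLK _)) (etrans (congr1 (@psiOLV n) e1) (psiOLK _)).
  exact: etrans (esym (expmK pX)) (etrans (congr1 (@expm R n) e2) (expmK pY)).
have pK : PhiOLV (PhiOL (expm (psiOLV (Lg C)))) = expm (psiOLV (Lg C)).
  by apply: pinvKV; [exact: Phi_inj|rewrite inE].
exact: etrans (congr1 PhiOLV (esym e)) pK.
Qed.

(** [FOL] after [PhiOLV] yields the matrix whose logarithm is [Lg C], because [psiOL] undoes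
    [psiOLV] on [Hol]; the outer [PhiOL] then applies [psiOL] of the next size once. *)
Lemma EOLE n (C : 'M[R]_n.+1) : Corp n.+1 C -> EOL R n C = Xp (psiOL (Lg C)).
Proof.
move=> CC; have HL := Lg_Hol (Corp_PDs CC); have [sH _] := HL.
have e1 : FOL (PhiOLV C) = expm (Lg C).
  by rewrite (PhiOLVE CC) /FOL (logmK (psiOLV_Sym HL)) (psiOLVK HL).
apply: (etrans (congr1 PhiOL e1)); apply: (etrans (PhiOLE (expm_SymPD sH))).
exact: (congr1 (fun M => Xp (psiOL M)) (logmK sH)).
Qed.

Lemma Hol_Sym n (S : 'M[R]_n) : Hol n S -> Sym n S.
Proof. by case. Qed.

Lemma EOL_TGIE n :
  totally_geodesic_isometric_embedding (corOL R n.+1) (corOL R n.+2) (EOL R n).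
Proof.
apply: (@off_log_linear_TGIE R _ _ (@psiOL R n.+1) (@psiOLV n.+1)).
- exact: psiOL_linear.
- exact: psiOLV_linear.
- by move=> S /Hol_Sym; exact: psiOL_Hol.
- exact: psiOL_frobenius.
- by move=> S _; exact: psiOLK.
- exact: EOLE.
Qed.

(** The linear data are composed rather than the embeddings: the induction carries [lam], its left
    inverse and the off-log formula, the inner [Lg] and [Xp] cancel by [XpK], and
    [off_log_linear_TGIE] is then used once for the whole composite. *)
Lemma EOLcomp_off_log m d : exists (lam : 'M[R]_m.+1 -> 'M[R]_((d + m).+1))
    (rho : 'M[R]_((d + m).+1) -> 'M[R]_m.+1),
  [/\ linear lam, linear rho,
      forall S, Hol m.+1 S -> Hol (d + m).+1 (lam S),
      forall S T, Hol m.+1 S -> Hol m.+1 T -> frobenius (lam S) (lam T) = frobenius S T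
    & forall S, Hol m.+1 S -> rho (lam S) = S] /\
  forall C, Corp m.+1 C -> EOLcomp R m d C = Xp (lam (Lg C)).
Proof.
elim: d => [|d [lam [rho [[lamL rhoL lamH lamI lamK] lamE]]]].
  by exists id, id; split; [split|move=> C CC; rewrite (LgK CC)].
exists (fun S => psiOL (lam S)), (fun M => rho (psiOLV M)); split; first split.
- by move=> a X Y; rewrite lamL psiOL_linear.
- by move=> a X Y; rewrite psiOLV_linear rhoL.
- by move=> S /lamH/Hol_Sym; exact: psiOL_Hol.
- by move=> S T HS HT; rewrite (psiOL_frobenius (lamH _ HS) (lamH _ HT)) lamI.
- by move=> S HS; rewrite psiOLK (lamK _ HS).
- move=> C CC; apply: (etrans (congr1 (EOL R (d + m)) (lamE C CC))).
  apply: (etrans (EOLE (Xp_Corp _))).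
  by rewrite (XpK (lamH _ (Lg_Hol (Corp_PDs CC)))).
Qed.

Lemma EOLcomp_TGIE m d :
  totally_geodesic_isometric_embedding
    (corOL R m.+1) (corOL R (d + m).+1) (EOLcomp R m d).
Proof.
have [lam [rho [[lamL rhoL lamH lamI lamK] lamE]]] := EOLcomp_off_log m d.
exact: (off_log_linear_TGIE lamL rhoL lamH lamI lamK lamE).
Qed.

End Extension.

(* The paper's n is n.+1 here; in the last clause its m is m.+1 and its n is
   (m + d).+1, so that E_n \o ... \o E_m has d.+1 factors. *)
Theorem theorem4p35 (R : realType) :
  (forall n : nat, (2 <= n.+1)%N ->
    [/\ totally_geodesic_isometric_embedding
          (corOL R n.+1) (corOL R n.+2) (EOL R n),
        set_fun (Hol n.+1) (Hol n.+2) (iotaOL R n)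
          /\ set_inj (Hol n.+1) (iotaOL R n),
        forall C : 'M[R]_n.+1, Corp n.+1 C ->
          LogOL (EOL R n C) = iotaOL R n (LogOL C)
      & forall C : 'M[R]_n.+1, Corp n.+1 C ->
          EOL R n C = ExpOL (iotaOL R n (LogOL C)) /\
          ExpOL (iotaOL R n (LogOL C)) =
            expm (iotaOL R n (LogOL C) + Dcor (iotaOL R n (LogOL C)))])
  /\
  (forall m d : nat, (2 <= m.+1)%N -> (0 < d)%N ->
    totally_geodesic_isometric_embedding
      (corOL R m.+1) (corOL R (d.+1 + m).+1) (EOLcomp R m d.+1)).
Proof.
split=> [n _|m d _ _]; last exact: EOLcomp_TGIE.
have iH (C : 'M[R]_n.+1) : Corp n.+1 C -> Hol n.+2 (psiOL (Lg C)).
  by move=> /Corp_PDs/Lg_Hol/Hol_Sym; exact: psiOL_Hol.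
split.
- exact: EOL_TGIE.
- split; first by move=> S /Hol_Sym; exact: psiOL_Hol.
  by move=> S T _ _ /(congr1 (@psiOLV R n.+1)); rewrite !psiOLK.
- move=> C CC; rewrite (EOLE CC) -(Lg_LogOL (Xp_Corp _)) (XpK (iH C CC)).
  by rewrite (Lg_LogOL CC).
- move=> C CC; split; last by [].
  by rewrite (EOLE CC) (Xp_ExpOL (iH C CC)) (Lg_LogOL CC).
Qed.
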